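(* Let $h>0$ and suppose the initial data satisfy $y^0\in W^{1,p}(\mathbb{T}^3)$, $\partial_t y^0=v^0\in L^2(\mathbb{T}^3)$, $\eta^0\in L^{\ell}(\mathbb{T}^3)$, and are such that, with $F^0=\nabla y^0\in L^p(\mathbb{T}^3)$, one has $\xi^0:=\Phi(F^0)=(F^0,\operatorname{cof}F^0,\det F^0)\in (L^p\times L^q\times L^{\rho})(\mathbb{T}^3)$. Assume the growth condition $$c\big(|F|^p+|\zeta|^q+|w|^{\rho}+|\eta|^{\ell}\big)-c\le \hat e(F,\zeta,w,\eta)\le c\big(|F|^p+|\zeta|^q+|w|^{\rho}+|\eta|^{\ell}\big)+c .$$ 1. If $\hat e(\xi,\eta)$ is strictly convex, there exists a unique $(v,\xi,\eta)\in(L^2\times L_{p,q,\rho}\times L^{\ell})(\mathbb{T}^3)$ which minimizes the functional $$J(v,\xi,\eta)=\int_{\mathbb{T}^3}\tfrac12|v-v^0|^2+\hat e(\xi,\eta)\,dx$$ over the weakly closed affine subspace $\mathcal{C}$ of $L^2\times L_{p,q,\rho}\times L^{\ell}$ consisting of those $(v,\xi,\eta)$ such that, for all $\phi\in C^\infty(\mathbb{T}^3)$ and $B=1,\dots,19$, $$\int_{\mathbb{T}^3}\phi\,\tfrac1h(\xi-\xi^0)^B\,dx=-\int_{\mathbb{T}^3}\frac{\partial\Phi^B}{\partial F_{i\alpha}}(F^0)\,v_i\,\partial_\alpha\phi\,dx,\qquad \int_{\mathbb{T}^3}\phi\,\tfrac1h(\eta-\eta^0)\,dx=\int_{\mathbb{T}^3}\frac{r}{\hat\theta(\xi^0,\eta^0)}\,\phi\,dx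 .$$ 2. Assuming further that $$|\partial_F\hat e|^{\frac{p}{p-1}}+|\partial_\zeta\hat e|^{\frac{p}{p-2}}+|\partial_w\hat e|^{\frac{p}{p-3}}\le c\big(|F|^p+|\zeta|^q+|w|^\rho+|\eta|^\ell\big)+c,$$ the minimizer satisfies the Euler–Lagrange equation $$\int_{\mathbb{T}^3}\phi\,\tfrac1h(v_i-v_i^0)\,dx=-\int_{\mathbb{T}^3}\frac{\partial\hat e}{\partial\xi^B}(\xi,\eta)\,\frac{\partial\Phi^B}{\partial F_{i\alpha}}(F^0)\,\partial_\alpha\phi\,dx,\qquad \phi\in C^\infty(\mathbb{T}^3),\ i=1,2,3.$$ 3. Moreover, the condition $\partial_\alpha F_{i\beta}=\partial_\beta F_{i\alpha}$ $(i,\alpha,\beta=1,2,3)$ is preserved by the solution operator $S_h:(v^0,F^0,\zeta^0,w^0,\eta^0)\mapsto(v,F,\zeta,w,\eta)$ that sends the data, with $\xi^0=(F^0,\zeta^0,w^0)$, to the minimizer, with $\xi=(F,\zeta,w)$. That is, whenever $F^0$ is a gradient, $F$ is also a gradient. Therefore there exists a function $y:\mathbb{T}^3\to\mathbb{R}^3$ in $W^{1,p}(\mathbb{T}^3)$ such that $\partial_\alpha y_i=F_{i\alpha}$.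
   Context: $\mathbb{T}^3$ is the three-dimensional torus; $\mathbb{M}^{3\times3}$ denotes the real $3\times3$ matrices; repeated indices are summed. The exponents satisfy $p\ge4$, $q\ge2$, $\rho>1$, $\ell>1$, and $L_{p,q,\rho}:=L^p\times L^q\times L^\rho$. The vector of null-Lagrangians is $\Phi(F)=(F,\operatorname{cof}F,\det F)\in\mathbb{M}^{3\times3}\times\mathbb{M}^{3\times3}\times\mathbb{R}\simeq\mathbb{R}^{19}$, with components $\Phi^B(F)$, $B=1,\dots,19$, where $(\operatorname{cof}F)_{i\alpha}=\frac12\epsilon_{ijk}\epsilon_{\alpha\beta\gamma}F_{j\beta}F_{k\gamma}$. The extended variable is $\xi=(F,\zeta,w)\in\mathbb{M}^{3\times3}\times\mathbb{M}^{3\times3}\times\mathbb{R}\simeq\mathbb{R}^{19}$; $v$ takes values in $\mathbb{R}^3$ (velocity) and $\eta$ is scalar (entropy). The internal energy is a function $\hat e=\hat e(\xi,\eta)\in C^3(\mathbb{R}^{19}\times[0,\infty))$; strictly convex means $\nabla^2_{(\xi,\eta)}\hat e>0$. The temperature is $\hat\theta(\xi,\eta):=\frac{\partial\hat e}{\partial\eta}(\xi,\eta)$, and $r$ is the given radiative heat supply. In the growth conditions $c>0$ denotes a generic constant, which may differ from one occurrence to the next.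
   Formalization: It is assumed in addition that η⁰ ≥ 0 a.e., that r/θ̂(ξ⁰,η⁰) lies in L^ℓ, and that η⁰ + h r/θ̂(ξ⁰,η⁰) ≥ 0 a.e. (likewise for general data in part 3); otherwise 𝒞 is empty or ê and θ̂ are evaluated outside their domain. *)

(* Defs.v *)
From mathcomp Require Import all_boot all_order all_algebra.
From mathcomp Require Import all_classical all_reals all_analysis.

Set Implicit Arguments.
Unset Strict Implicit.
Unset Printing Implicit Defensive.

Import Order.TTheory GRing.Theory Num.Theory.
Import numFieldNormedType.Exports.

Local Open Scope classical_set_scope.
Local Open Scope ring_scope.

(** * The torus

  The torus is R^3 / Z^3.  A measurable function on it is represented by a
  function on R^3 of which only the values on the fundamental domain [0, 1]^3
  matter, through a measure carried by that cube; smooth functions on the torus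
  are the Z^3-periodic smooth functions on R^3. *)

Notation space3 R := (R * R * R)%type.

(** [R * R * R] with the sigma-algebra that carries the Lebesgue measure. *)
Notation mspace3 R :=
  (measurableTypeR R * measurableTypeR R * measurableTypeR R)%type.

Definition unit_cube (R : realType) : set (mspace3 R) :=
  `[0, 1] `*` `[0, 1] `*` `[0, 1].

Lemma measurable_unit_cube (R : realType) : measurable (@unit_cube R).
Proof. by do 2 (apply: measurableX; last exact: measurable_itv). Qed.

Definition torus_measure (R : realType) :
    {measure set (mspace3 R) -> \bar R} :=
  mrestr ((@lebesgue_measure R \x @lebesgue_measure R)
            \x @lebesgue_measure R)%E
    (@measurable_unit_cube R).

Definition unit_vec (R : realType) (a : 'I_3) : space3 R :=
  ((a == 0)%:R, (a == 1)%:R, (a == 2)%:R).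

Definition spartial (R : realType) (a : 'I_3) (f : space3 R -> R) :
    space3 R -> R :=
  'D_(unit_vec R a) f.

Definition test_function (R : realType) (phi : space3 R -> R) :=
  (forall a (x : space3 R), phi (x + unit_vec R a) = phi x) /\
  (forall s : seq 'I_3, let g := foldr (@spartial R) phi s in
     continuous g /\ forall a (x : space3 R), derivable g x (unit_vec R a)).

Definition Lp (R : realType) (s : R) (f : space3 R -> R) : Prop :=
  f \in Lfun (torus_measure R) s%:E.

Definition torus_int (R : realType) (f : space3 R -> R) : R :=
  \int[torus_measure R]_x f x.

Definition weak_partial (R : realType) (a : 'I_3) (f g : space3 R -> R) :=
  forall phi, test_function phi ->
    torus_int (fun x => f x * spartial a phi x) =
    - torus_int (fun x => g x * phi x).

Definition sobolev1 (R : realType) (p : R) (y : space3 R -> 'rV[R]_3) :=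
  forall i, Lp p (fun x => y x 0 i) /\
    forall a, exists g, Lp p g /\ weak_partial a (fun x => y x 0 i) g.

Definition weak_gradient (R : realType)
    (y : space3 R -> 'rV[R]_3) (F : space3 R -> 'M[R]_3) :=
  forall i a, weak_partial a (fun x => y x 0 i) (fun x => F x i a).

(** [d_a F_ib = d_b F_ia] in the sense of distributions. *)
Definition curl_free (R : realType) (F : space3 R -> 'M[R]_3) :=
  forall (i a b : 'I_3) phi, test_function phi ->
    torus_int (fun x => F x i b * spartial a phi x) =
    torus_int (fun x => F x i a * spartial b phi x).

(** * Extended variables *)

(** [xi = (F, zeta, w)] and [y = (v, xi, eta)]. *)
Notation ext_var R := ('M[R]_3 * 'M[R]_3 * R)%type.
Notation state R := ('rV[R]_3 * ext_var R * R)%type.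

Definition vel (R : realType) (y : state R) : 'rV[R]_3 := y.1.1.
Definition ext (R : realType) (y : state R) : ext_var R := y.1.2.
Definition ent (R : realType) (y : state R) : R := y.2.
Definition Fpart (R : realType) (xi : ext_var R) : 'M[R]_3 := xi.1.1.

(** The index [B] ranges over the entries of [F], those of [zeta], and [w]. *)
Notation ext_idx := ('I_3 * 'I_3 + 'I_3 * 'I_3 + unit)%type.

Lemma card_ext_idx : #|{: ext_idx}| = 19%N.
Proof. by rewrite !card_sum !card_prod !card_ord card_unit. Qed.

Definition ext_coord (R : realType) (B : ext_idx) (xi : ext_var R) : R :=
  match B with
  | inl (inl (i, a)) => xi.1.1 i a
  | inl (inr (i, a)) => xi.1.2 i a
  | inr tt => xi.2
  end.

Definition ext_vec (R : realType) (B : ext_idx) : ext_var R :=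
  match B with
  | inl (inl (i, a)) => (delta_mx i a, 0, 0)
  | inl (inr (i, a)) => (0, delta_mx i a, 0)
  | inr tt => (0, 0, 1)
  end.

(** Levi-Civita symbol, as the normalised Vandermonde product of the indices. *)
Definition levi_civita (R : realType) (i j k : 'I_3) : R :=
  let n (m : 'I_3) : R := (m : nat)%:R in
  (n j - n i) * (n k - n i) * (n k - n j) / 2.

Definition cofmx (R : realType) (F : 'M[R]_3) : 'M[R]_3 :=
  \matrix_(i, a) (2^-1 * \sum_j \sum_k \sum_b \sum_c
    levi_civita R i j k * levi_civita R a b c * F j b * F k c).

Definition Phi (R : realType) (F : 'M[R]_3) : ext_var R :=
  (F, cofmx F, \det F).

(** [dPhi B i a F] is the partial derivative of [Phi^B] in [F_ia]. *)
Definition dPhi (R : realType) (B : ext_idx) (i a : 'I_3) (F : 'M[R]_3) : R :=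
  'D_(delta_mx i a : 'M[R]_3) (fun G : 'M[R]_3 => ext_coord B (Phi G)) F.

(** * The space [L^2 x L_{p,q,rho} x L^l] and its weak topology *)

Definition ext_exponent (R : realType) (p q rho : R) (B : ext_idx) : R :=
  match B with
  | inl (inl _) => p
  | inl (inr _) => q
  | inr _ => rho
  end.

Definition state_space (R : realType) (p q rho l : R)
    (z : space3 R -> state R) : Prop :=
  [/\ forall i, Lp 2 (fun x => vel (z x) 0 i),
      forall B, Lp (ext_exponent p q rho B) (fun x => ext_coord B (ext (z x)))
    & Lp l (fun x => ent (z x))].

(** Equality in the product of Lebesgue spaces. *)
Definition ae_equal (R : realType) (z z' : space3 R -> state R) : Prop :=
  {ae torus_measure R, forall x, z x = z' x}.

Definition conj_exp (R : realType) (s : R) : R := s / (s - 1).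

(** The exponents being finite and [> 1], the dual of [L^2 x L_{p,q,rho} x L^l]
  is the product of the Lebesgue spaces with the conjugate exponents. *)
Definition dual_space (R : realType) (p q rho l : R) :
    (space3 R -> state R) -> Prop :=
  state_space (conj_exp p) (conj_exp q) (conj_exp rho) (conj_exp l).

Definition pairing (R : realType) (g z : space3 R -> state R) : R :=
  torus_int (fun x => \sum_i vel (g x) 0 i * vel (z x) 0 i
    + \sum_(B : ext_idx) ext_coord B (ext (g x)) * ext_coord B (ext (z x))
    + ent (g x) * ent (z x)).

Definition weakly_closed (R : realType) (p q rho l : R)
    (C : set (space3 R -> state R)) : Prop :=
  forall z, state_space p q rho l z -> ~ C z ->
    exists (n : nat) (g : 'I_n -> space3 R -> state R) (eps : R),
      [/\ 0 < eps, forall k, dual_space p q rho l (g k)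
        & forall z', state_space p q rho l z' ->
            (forall k, `|pairing (g k) z' - pairing (g k) z| < eps) -> ~ C z'].

Definition affine_subspace (R : realType) (p q rho l : R)
    (C : set (space3 R -> state R)) : Prop :=
  [/\ forall z, C z -> state_space p q rho l z, C !=set0
    & forall z z' (t : R), C z -> C z' ->
        C (fun x => t *: z x + (1 - t) *: z' x)].

(** * The internal energy *)

(** The domain R^19 x [0, oo[ of the energy. *)
Definition half_space (R : realType) : set (ext_var R * R) :=
  [set u | 0 <= u.2].

(** The coordinate [None] is [eta]. *)
Notation energy_idx := (option ext_idx).

Definition energy_vec (R : realType) (j : energy_idx) : ext_var R * R :=
  if j is Some B then (ext_vec R B, 0) else (0, 1).

(** Partial derivatives relative to the half-space: the increments are
  restricted to those that remain in it, so that the derivative in [eta] is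
  one-sided at [eta = 0].  Outside of the half-space, where the energy is not
  defined, the derivative is set to [0]. *)
Definition difference_quotient (R : realType) (j : energy_idx)
    (f : ext_var R * R -> R) (u : ext_var R * R) : set_system R :=
  (fun t : R => t^-1 * (f (u + t *: energy_vec R j) - f u)) @
    within [set t | half_space (u + t *: energy_vec R j)] 0^'.

Definition epartial (R : realType) (j : energy_idx)
    (f : ext_var R * R -> R) : ext_var R * R -> R :=
  patch (fun=> 0) (@half_space R) (fun u => lim (difference_quotient j f u)).

(** Class C^k on the closed half-space. *)
Definition C_k (R : realType) (k : nat) (f : ext_var R * R -> R) : Prop :=
  forall s : seq energy_idx, (size s <= k)%N ->
    let g := foldr (@epartial R) f s in
    {within @half_space R, continuous g} /\
    ((size s < k)%N ->
      forall j u, half_space u -> cvg (difference_quotient j g u)).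

(** The Hessian in all 20 variables is positive definite. *)
Definition strictly_convex (R : realType) (e : ext_var R * R -> R) : Prop :=
  forall u, half_space u ->
  forall c : energy_idx -> R, (exists j, c j != 0) ->
    0 < \sum_j \sum_k epartial j (epartial k e) u * c j * c k.

Definition temperature (R : realType) (e : ext_var R * R -> R) :
    ext_var R * R -> R :=
  epartial None e.

Definition frob (R : realType) (A : 'M[R]_3) : R :=
  Num.sqrt (\sum_i \sum_j A i j ^+ 2).

Definition growth_fun (R : realType) (p q rho l : R)
    (F zeta : 'M[R]_3) (w eta : R) : R :=
  frob F `^ p + frob zeta `^ q + `|w| `^ rho + `|eta| `^ l.

Definition energy_growth (R : realType) (p q rho l : R)
    (e : ext_var R * R -> R) : Prop :=
  exists c1 c2 c3 c4 : R, [/\ 0 < c1, 0 < c2, 0 < c3, 0 < c4 &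
    forall (F zeta : 'M[R]_3) (w eta : R), 0 <= eta ->
      c1 * growth_fun p q rho l F zeta w eta - c2 <= e (F, zeta, w, eta)
        <= c3 * growth_fun p q rho l F zeta w eta + c4].

Definition dF (R : realType) (e : ext_var R * R -> R) u : 'M[R]_3 :=
  \matrix_(i, a) epartial (Some (inl (inl (i, a)))) e u.
Definition dzeta (R : realType) (e : ext_var R * R -> R) u : 'M[R]_3 :=
  \matrix_(i, a) epartial (Some (inl (inr (i, a)))) e u.
Definition dw (R : realType) (e : ext_var R * R -> R) u : R :=
  epartial (Some (inr tt)) e u.

Definition stress_growth (R : realType) (p q rho l : R)
    (e : ext_var R * R -> R) : Prop :=
  exists c c' : R, [/\ 0 < c, 0 < c' &
    forall (F zeta : 'M[R]_3) (w eta : R), 0 <= eta ->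
      frob (dF e (F, zeta, w, eta)) `^ (p / (p - 1))
      + frob (dzeta e (F, zeta, w, eta)) `^ (p / (p - 2))
      + `|dw e (F, zeta, w, eta)| `^ (p / (p - 3))
      <= c * growth_fun p q rho l F zeta w eta + c'].

(** * The variational problem

  The data [(v0, xi0, eta0)] are bundled in [z0], and [F0] is the first
  component of [xi0]. *)

Definition heating (R : realType) (e : ext_var R * R -> R) (r : space3 R -> R)
    (z0 : space3 R -> state R) (x : space3 R) : R :=
  r x / temperature e (ext (z0 x), ent (z0 x)).

(** The problem is meaningful: the source term lies in [L^l], and both the
  initial entropy and the updated one, [eta0 + h r / theta(xi0, eta0)], take
  their values in the domain [0, oo[ of the energy. *)
Definition compatible_heating (R : realType) (l h : R)
    (e : ext_var R * R -> R) (r : space3 R -> R) (z0 : space3 R -> state R) :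
    Prop :=
  [/\ {ae torus_measure R, forall x, 0 <= ent (z0 x)},
      Lp l (heating e r z0)
    & {ae torus_measure R, forall x, 0 <= ent (z0 x) + h * heating e r z0 x}].

Definition constraint_set (R : realType) (p q rho l h : R)
    (e : ext_var R * R -> R) (r : space3 R -> R) (z0 : space3 R -> state R) :
    set (space3 R -> state R) :=
  [set z | [/\ state_space p q rho l z,
    forall phi, test_function phi -> forall B : ext_idx,
      torus_int (fun x => phi x *
        (h^-1 * (ext_coord B (ext (z x)) - ext_coord B (ext (z0 x))))) =
      - torus_int (fun x => \sum_i \sum_a
          dPhi B i a (Fpart (ext (z0 x))) * vel (z x) 0 i * spartial a phi x)
    & forall phi, test_function phi ->
      torus_int (fun x => phi x * (h^-1 * (ent (z x) - ent (z0 x)))) =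
      torus_int (fun x => heating e r z0 x * phi x)]].

(** The value given to the energy outside of its domain is immaterial when the
  heating is compatible: the second constraint then forces the entropy to be
  nonnegative almost everywhere. *)
Definition functional (R : realType) (e : ext_var R * R -> R)
    (z0 z : space3 R -> state R) : \bar R :=
  (\int[torus_measure R]_x
    (2^-1 * (\sum_i (vel (z x) 0 i - vel (z0 x) 0 i) ^+ 2)
     + patch (fun=> 0) (@half_space R) e (ext (z x), ent (z x)))%:E)%E.

(** The graph of the solution operator [S_h : z0 |-> z]. *)
Definition minimizer (R : realType) (p q rho l h : R)
    (e : ext_var R * R -> R) (r : space3 R -> R) (z0 z : space3 R -> state R) :
    Prop :=
  constraint_set p q rho l h e r z0 z /\
  forall z', constraint_set p q rho l h e r z0 z' ->
    (functional e z0 z <= functional e z0 z')%E.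

Definition euler_lagrange (R : realType) (h : R) (e : ext_var R * R -> R)
    (z0 z : space3 R -> state R) : Prop :=
  forall phi, test_function phi -> forall i,
    torus_int (fun x => phi x * (h^-1 * (vel (z x) 0 i - vel (z0 x) 0 i))) =
    - torus_int (fun x => \sum_(B : ext_idx) \sum_a
        epartial (Some B) e (ext (z x), ent (z x)) *
        dPhi B i a (Fpart (ext (z0 x))) * spartial a phi x).

(* Main.v *)
(** The constraints are affine and continuous for the weak topology, and they
  prescribe the entropy almost everywhere.  No weak compactness is needed for
  the existence of a minimizer: if [G(v, xi, eta) = |v|^2 / 2 + e(xi, eta)] and
  [g(a, b) = (G a + G b) / 2 - G ((a + b) / 2)], the integral of [g] along a
  minimizing sequence tends to [0]; on bounded sets [g] controls the distance
  by strict convexity, so the sequence is Cauchy in measure.  Along an almost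
  everywhere convergent subsequence, Fatou's lemma bounds the limit of the
  functional and the coercivity gives the weak convergence of the constraints.
  Uniqueness is [g = 0].

  For the Euler-Lagrange equation, the velocity [v + t phi e_i] forces [xi] to
  move by [t h (d Phi^B / d F_ia)(F0) d_a phi], by the Piola identity
  [d_a ((d Phi^B / d F_ia)(F0)) = 0].  This increment lies in the right space
  because the growth conditions on [e] and on its derivatives imply
  [2 q <= p] and [3 rho <= p].  By convexity the difference quotients at the
  steps [2^-n] lie between those at [-1] and [1], which dominates them.

  The constraint on [F] reads [F = F0 + h grad v], so that [F] is the gradient of
  [y0 + h v]; this function lies in [L^p] by a Poincare inequality.

  Weak derivatives are handled by mollification with the powers of
  [prod_a (1 + cos (2 pi (x_a - z_a)))], which turns an integrable function
  into a trigonometric polynomial. *)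

Require Import Defs.
From HB Require Import structures.
From mathcomp Require Import all_boot all_order all_algebra.
From mathcomp Require Import all_classical all_reals all_analysis.
From mathcomp Require Import measurable_realfun ring lra.

Set Implicit Arguments.
Unset Strict Implicit.
Unset Printing Implicit Defensive.

Import Order.TTheory GRing.Theory Num.Theory.
Import numFieldNormedType.Exports.

Local Open Scope classical_set_scope.
Local Open Scope ring_scope.

(** * Integrals on a finite measure space *)

(** Two obstacles shape the proof. The energy lives on the closed half-space eta >= 0, so its
    derivatives are one-sided at the boundary and it may not be evaluated beyond: segments are
    differentiated only in their interior, coordinates are discretised by rounding down, and the
    entropy is clipped at 0 before the density is evaluated. The other obstacle is that a function
    on the torus is known only through its values on one cube, which makes convolution by
    translation awkward. A polynomial in the cos (2 pi (x_a - z_a)) is a function of x - z and also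
    a finite sum of products p(x) q(z). The first property moves derivatives from x to z, where they
    meet the weak derivative; the second makes differentiation under the integral sign plain
    algebra. Symmetry of mixed derivatives, the vanishing of a function orthogonal to all test
    functions, the Piola identity for the determinant and the Poincare inequality all reach their
    general form through trigonometric polynomials. The bounds 2 q <= p and 3 rho <= p come from
    comparing, along one axis, the lower growth bound of e with the integrated bound on its
    derivative. *)

Section finite_measure.
Context d (T : measurableType d) (R : realType).
Variable mu : {measure set T -> \bar R}.
Implicit Types f g : T -> R.

Lemma ae_imp (P Q : T -> Prop) : (forall x, P x -> Q x) ->
  {ae mu, forall x, P x} -> {ae mu, forall x, Q x}.
Proof. by move=> PQ; apply: filterS. Qed.

Lemma ae_imp2 (P Q S : T -> Prop) : (forall x, P x -> Q x -> S x) ->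
  {ae mu, forall x, P x} -> {ae mu, forall x, Q x} -> {ae mu, forall x, S x}.
Proof. by move=> PQ; apply: filterS2. Qed.

Lemma ae_and (P Q : T -> Prop) : {ae mu, forall x, P x} ->
  {ae mu, forall x, Q x} -> {ae mu, forall x, P x /\ Q x}.
Proof. by apply: ae_imp2 => x; split. Qed.

Definition integ f := mu.-integrable [set: T] (EFin \o f).

Lemma integ_mfun f : integ f -> measurable_fun setT f.
Proof. by move=> /integrableP[/measurable_EFinP]. Qed.

Lemma integ_ext f g : f =1 g -> integ f -> integ g.
Proof. by move=> /funext ->. Qed.

Lemma integD f g : integ f -> integ g -> integ (fun x => f x + g x).
Proof. by move=> mf mg; rewrite /integ (_ : _ \o _ = (EFin \o f) \+ (EFin \o g))%E//; exact: integrableD. Qed.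

Lemma integZ c f : integ f -> integ (fun x => c * f x).
Proof. by move=> mf; apply: (integrableZl measurableT c mf). Qed.

Lemma integN f : integ f -> integ (fun x => - f x).
Proof. by move=> /(integZ (-1)); apply: integ_ext => x; rewrite mulN1r. Qed.

Lemma integB f g : integ f -> integ g -> integ (fun x => f x - g x).
Proof. by move=> mf /integN; exact: integD. Qed.

Lemma integ0 : integ (fun=> 0).
Proof. exact: integrable0. Qed.

Lemma integ_sum (I : Type) (s : seq I) (P : pred I) (F : I -> T -> R) :
  (forall i, P i -> integ (F i)) -> integ (fun x => \sum_(i <- s | P i) F i x).
Proof.
move=> iF; elim: s => [|i s ih].
  by apply: integ_ext integ0 => x; rewrite big_nil.
under eq_fun do rewrite big_cons.
by case: (boolP (P i)) => // Pi; apply: integD => //; exact: iF.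
Qed.

Lemma integ_norm f : integ f -> integ (fun x => `|f x|).
Proof. exact: integrable_norm. Qed.

Lemma integ_le f g : measurable_fun setT f ->
  (forall x, `|f x| <= g x) -> integ g -> integ f.
Proof.
move=> mf fg ig; apply: (le_integrable measurableT _ _ ig).
  exact/measurable_EFinP.
by move=> x _ /=; rewrite lee_fin (le_trans (fg x))// ler_norm.
Qed.

Lemma integM_bounded f g M : integ f -> measurable_fun setT g ->
  (forall x, `|g x| <= M) -> integ (fun x => g x * f x).
Proof.
move=> iF mg gM; apply: (@integ_le _ (fun x => M * `|f x|)).
- by apply: measurable_funM => //; exact: integ_mfun.
- by move=> x; rewrite normrM ler_wpM2r.
- exact/integZ/integ_norm.
Qed.

Lemma Rint_ae f g : measurable_fun setT f -> measurable_fun setT g ->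
  {ae mu, forall x, f x = g x} -> \int[mu]_x f x = \int[mu]_x g x.
Proof.
move=> mf mg fg; rewrite /Rintegral; congr fine; apply: ae_eq_integral => //.
- exact/measurable_EFinP.
- exact/measurable_EFinP.
- by apply: filterS fg => x /= -> _.
Qed.

Lemma RintD f g : integ f -> integ g ->
  \int[mu]_x (f x + g x) = \int[mu]_x f x + \int[mu]_x g x.
Proof. exact: RintegralD. Qed.

Lemma RintB f g : integ f -> integ g ->
  \int[mu]_x (f x - g x) = \int[mu]_x f x - \int[mu]_x g x.
Proof. exact: RintegralB. Qed.

Lemma RintZ c f : integ f -> \int[mu]_x (c * f x) = c * \int[mu]_x f x.
Proof. by move=> iF; rewrite RintegralZl. Qed.

Lemma RintN f : integ f -> \int[mu]_x (- f x) = - \int[mu]_x f x.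
Proof.
by move=> iF; rewrite -mulN1r -RintZ//; apply: eq_Rintegral => x _; rewrite mulN1r.
Qed.

Lemma Rint_zero : \int[mu]_x (0:R) = 0.
Proof. by rewrite /Rintegral integral0. Qed.

Lemma Rint_sum (I : Type) (s : seq I) (P : pred I) (F : I -> T -> R) :
  (forall i, P i -> integ (F i)) ->
  \int[mu]_x (\sum_(i <- s | P i) F i x) = \sum_(i <- s | P i) \int[mu]_x F i x.
Proof.
move=> iF; elim: s => [|i s ih].
  by rewrite big_nil -[RHS]Rint_zero; apply: eq_Rintegral => x _; rewrite big_nil.
rewrite big_cons -ih; under eq_Rintegral do rewrite big_cons.
by case: (boolP (P i)) => // Pi; rewrite RintD//; [exact: iF|exact: integ_sum].
Qed.

Lemma EFin_Rint f : integ f -> (\int[mu]_x f x)%:E = (\int[mu]_x (f x)%:E)%E.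
Proof. by move=> iF; rewrite /Rintegral fineK//; exact: integrable_fin_num. Qed.

Lemma le_Rint f g : integ f -> integ g -> (forall x, f x <= g x) ->
  \int[mu]_x f x <= \int[mu]_x g x.
Proof. by move=> iF ig fg; apply: le_Rintegral. Qed.

Lemma Rint_ge0 f : {ae mu, forall x, 0 <= f x} -> measurable_fun setT f ->
  0 <= \int[mu]_x f x.
Proof.
move=> f0 mf; rewrite (@Rint_ae _ (fun x => Num.max (f x) 0)) //.
- by apply: Rintegral_ge0 => x _; rewrite le_max lexx orbT.
- exact: measurable_maxr.
- by apply: filterS f0 => x fx; rewrite max_l.
Qed.

Lemma le_Rint_ae f g : integ f -> integ g -> {ae mu, forall x, f x <= g x} ->
  \int[mu]_x f x <= \int[mu]_x g x.
Proof.
move=> iF ig fg; rewrite -subr_ge0 -RintB//; apply: Rint_ge0.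
  by apply: filterS fg => x; rewrite subr_ge0.
by apply: measurable_funB; exact: integ_mfun.
Qed.

Lemma le_norm_Rint f : integ f -> `|\int[mu]_x f x| <= \int[mu]_x `|f x|.
Proof. by move=> iF; exact: le_normr_Rintegral. Qed.

Lemma Rint_eq0_ae f : integ f -> {ae mu, forall x, 0 <= f x} ->
  \int[mu]_x f x <= 0 -> {ae mu, forall x, f x = 0}.
Proof.
move=> iF f0 If.
have H : (\int[mu]_x `|(EFin \o f) x| = 0)%E.
  have -> : (\int[mu]_x `|(EFin \o f) x|)%E = (\int[mu]_x (f x)%:E)%E.
    apply: ae_eq_integral => //.
    - by apply: measurableT_comp => //; exact/measurable_EFinP/integ_mfun.
    - exact/measurable_EFinP/integ_mfun.
    - by apply: filterS f0 => x fx0 _ /=; rewrite ger0_norm.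
  rewrite -EFin_Rint//; congr EFin; apply/eqP; rewrite eq_le If/=.
  by apply: Rint_ge0 => //; exact: integ_mfun.
have := (ae_eq_integral_abs mu measurableT (proj2 (measurable_EFinP _ _) (integ_mfun iF))).1 H.
by apply: filterS => x /(_ Logic.I)/= [].
Qed.

Lemma lty_integ f : measurable_fun setT f -> (forall x, 0 <= f x) ->
  (\int[mu]_x (f x)%:E < +oo)%E -> integ f.
Proof.
move=> mf f0 fi; apply/integrableP; split; first exact/measurable_EFinP.
by under eq_integral do rewrite gee0_abs ?lee_fin//.
Qed.

Lemma integ_lty f : integ f -> (forall x, 0 <= f x) ->
  (\int[mu]_x (f x)%:E < +oo)%E.
Proof. by move=> iF _; rewrite -EFin_Rint// ltry. Qed.

(** Real exponents and no norm: integrability of the power is all that is used of L^s, and it agrees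
    with [Lfun] for s >= 1 by [LfunE]. *)
Definition Lq (s : R) f := measurable_fun setT f /\ integ (fun x => `|f x| `^ s).

Lemma mfun_powR s f : measurable_fun setT f -> measurable_fun setT (fun x => `|f x| `^ s).
Proof.
move=> mf; apply: (measurableT_comp (measurable_powR s)).
exact: measurableT_comp.
Qed.

Lemma LfunE (s : R) f : 1 <= s -> f \in Lfun mu s%:E <-> Lq s f.
Proof.
move=> s1; split.
  move=> fs; split; last exact: Lfun_integrable.
  by move: fs; rewrite inE => /andP[]; rewrite inE.
move=> [mf ifs]; rewrite inE; apply/andP; split; rewrite inE//= /finite_norm.
rewrite unlock poweR_lty//.
exact: integ_lty.
Qed.

Lemma LqZ s c f : Lq s f -> Lq s (fun x => c * f x).
Proof.
move=> [mf ifs]; split; first exact: measurable_funM.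
apply: integ_ext (integZ (`|c| `^ s) ifs) => x.
by rewrite normrM powRM.
Qed.

(** Since a + b <= 2 max(a, b), the constant 2^s serves for every s >= 0, with no recourse to
    convexity. *)
Lemma powRD_le (s a b : R) : 0 <= s -> 0 <= a -> 0 <= b ->
  (a + b) `^ s <= 2 `^ s * (a `^ s + b `^ s).
Proof.
move=> s0 a0 b0; rewrite (@le_trans _ _ ((2 * Num.max a b) `^ s))//.
  apply: ge0_ler_powR => //; rewrite ?nnegrE ?addr_ge0// ?mulr_ge0// ?le_max ?a0//.
  by rewrite mulr_natl mulr2n lerD// le_max lexx// orbT.
rewrite powRM// ?le_max ?a0// ler_wpM2l ?powR_ge0//.
by case: (leP a b) => _; rewrite ?lerDr ?lerDl ?powR_ge0.
Qed.

Lemma LqD s f g : 0 <= s -> Lq s f -> Lq s g -> Lq s (fun x => f x + g x).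
Proof.
move=> s0 [mf ifs] [mg igs]; split; first exact: measurable_funD.
apply: integ_le; [exact/mfun_powR/measurable_funD | |
  exact: (integZ (2 `^ s) (integD ifs igs))].
move=> x; rewrite ger0_norm ?powR_ge0//.
apply: (le_trans _ (powRD_le s0 (normr_ge0 _) (normr_ge0 _))).
by apply: ge0_ler_powR => //; rewrite ?nnegrE ?addr_ge0// ler_normD.
Qed.

Lemma Lq_dom s f g : 0 <= s -> measurable_fun setT f -> (forall x, `|f x| <= `|g x|) ->
  Lq s g -> Lq s f.
Proof.
move=> s0 mf fg [mg igs]; split => //; apply: integ_le igs; first exact: mfun_powR.
by move=> x; rewrite ger0_norm ?powR_ge0// ge0_ler_powR ?nnegrE.
Qed.

Lemma LqM_bounded s f g M : 0 <= s -> Lq s f -> measurable_fun setT g ->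
  (forall x, `|g x| <= M) -> Lq s (fun x => g x * f x).
Proof.
move=> s0 lf mg gM; have [mf _] := lf.
apply: (Lq_dom _ _ _ (LqZ M lf)) => //; first exact: measurable_funM.
by move=> x; rewrite !normrM ler_wpM2r// (le_trans (gM x))// ler_norm.
Qed.

(** The weights 1/s and (s - 1)/s of Young's inequality are at most 1 and are dropped. Integrated,
    this pointwise bound takes the place of Hoelder's inequality where only integrability
    matters. *)
Lemma young (s a b : R) : 1 < s -> 0 <= a -> 0 <= b ->
  a * b <= a `^ s + b `^ (s / (s - 1)).
Proof.
move=> s1 a0 b0; have s0 : 0 < s by rewrite (lt_trans _ s1).
have s10 : 0 < s - 1 by rewrite subr_gt0.
apply: (le_trans (@conjugate_powR _ a b s (s / (s - 1)) a0 b0 s0 _ _)).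
- by rewrite divr_gt0.
- by rewrite invf_div; field; rewrite !gt_eqF.
- rewrite lerD//.
    by rewrite ler_pdivrMr// ler_peMr ?powR_ge0// ltW.
  rewrite ler_pdivrMr ?divr_gt0// ler_peMr ?powR_ge0//.
  by rewrite ler_pdivlMr// mul1r gerBl.
Qed.

Lemma LqM s f g : 1 < s -> Lq s f -> Lq (s / (s - 1)) g -> integ (fun x => f x * g x).
Proof.
move=> s1 [mf ifs] [mg igs]; apply: integ_le (integD ifs igs).
  exact: measurable_funM.
by move=> x; rewrite normrM young.
Qed.

Hypothesis mufin : (mu setT < +oo)%E.

Lemma integ_cst c : integ (fun=> c).
Proof.
apply: measurable_bounded_integrable => //.
exact: bounded_cst.
Qed.

Lemma integ_bounded f M : measurable_fun setT f -> (forall x, `|f x| <= M) -> integ f.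
Proof. by move=> mf fM; apply: integ_le (integ_cst M). Qed.

Lemma integ_indic (A : set T) : measurable A -> integ (\1_A : T -> R).
Proof.
move=> mA; apply: (integ_bounded (M := 1)) => // x.
by rewrite ger0_norm// indicE lern1 leq_b1.
Qed.

(** The bound |f|^s <= 1 + |f|^t, whose right-hand side is integrable because the measure is
    finite. *)
Lemma Lq_le (s t : R) f : 0 <= s -> s <= t -> Lq t f -> Lq s f.
Proof.
move=> s0 st [mf ift]; split => //; apply: integ_le (integD (integ_cst 1) ift).
  exact: mfun_powR.
move=> x; rewrite ger0_norm ?powR_ge0//.
have [f1|f1] := leP `|f x| 1.
  rewrite (@le_trans _ _ 1) ?lerDl ?powR_ge0//.
  by have := ge0_ler_powR s0 _ _ f1; rewrite powR1; apply; rewrite nnegrE.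
by rewrite (@le_trans _ _ (`|f x| `^ t)) ?lerDr ?ler01// ler_powR// ltW.
Qed.

Lemma Lq_bounded s f M : 0 <= s -> measurable_fun setT f -> (forall x, `|f x| <= M) -> Lq s f.
Proof.
move=> s0 mf fM; split => //; apply: (@integ_bounded _ (M `^ s)).
  exact: mfun_powR.
move=> x; rewrite ger0_norm ?powR_ge0// ge0_ler_powR ?nnegrE//.
exact: le_trans (fM x).
Qed.

Lemma Lq_integ s f : 1 <= s -> Lq s f -> integ f.
Proof.
move=> s1 lf; have [mf [_ +]] : measurable_fun setT f /\ Lq 1 f.
  by split; [case: lf|apply: Lq_le lf].
by apply: integ_le => // x; rewrite powRr1.
Qed.

Lemma Lq2M f g : Lq 2 f -> Lq 2 g -> integ (fun x => f x * g x).
Proof.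
move=> f2 g2; apply: (@LqM 2) => //; first by rewrite ltr1n.
by rewrite (_ : 2 / (2 - 1) = 2 :> R)//; field.
Qed.

(** Young's inequality with exponent 2, applied to |f|^s and |g|^s; it places the products of two
    entries of F in L^(p/2). *)
Lemma Lq_mul s f g : 0 < s -> Lq (s * 2) f -> Lq (s * 2) g -> Lq s (fun x => f x * g x).
Proof.
move=> s0 [mf ifs] [mg igs]; split; first exact: measurable_funM.
apply: integ_le (integD ifs igs); first exact/mfun_powR/measurable_funM.
move=> x; rewrite ger0_norm ?powR_ge0// normrM powRM// !powRrM.
have := young (_ : 1 < 2) (powR_ge0 `|f x| s) (powR_ge0 `|g x| s).
rewrite (_ : 2 / (2 - 1) = 2 :> R); last by field.
by apply; rewrite ltr1n.
Qed.

End finite_measure.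

Lemma cvg_norm_powR (R : realType) (s : R) (u : nat -> R) (a : R) : 0 < s ->
  u @ \oo --> a -> `|u n| `^ s @[n --> \oo] --> `|a| `^ s.
Proof.
(* At 0 the power need not be differentiable, so continuity there is checked by hand; elsewhere it
   follows from differentiability. *)
move=> s0 ua; have [a0|a0] := eqVneq a 0.
  rewrite a0 in ua *; rewrite normr0 powR0 ?gt_eqF//; apply/cvgr0Pnorm_le => c c0.
  have d0 : 0 < c `^ s^-1 by rewrite powR_gt0.
  near=> n; rewrite ger0_norm ?powR_ge0// -[leRHS](@powRr1 _ c) ?(ltW c0)//.
  rewrite -(mulVf (lt0r_neq0 s0)) powRrM ge0_ler_powR ?nnegrE ?(ltW s0) ?powR_ge0//.
  by near: n; exact: (@cvgr0_norm_le _ _ _ _ _ u ua _ d0).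
have: {for `|a|, continuous (@powR R ^~ s)}.
  apply/differentiable_continuous/derivable1_diffP/derivable_powR.
  by rewrite in_itv/= normr_gt0 a0.
by move=> /continuous_cvg; apply; exact: cvg_norm.
Unshelve. all: by end_near. Qed.

(** * Fatou's lemma, dominated convergence and weak convergence in L^s *)

Section limits.
Context d (T : measurableType d) (R : realType).
Variable mu : {measure set T -> \bar R}.

(** Integrability of the limit is part of the conclusion, and the bounds [a n] may vary with n:
    along a minimizing sequence they tend to the infimum. *)
Lemma fatou_Rint (h_ : nat -> T -> R) (h : T -> R) (a : nat -> R) (b : R) :
  (forall n, integ mu (h_ n)) -> (forall n x, 0 <= h_ n x) ->
  measurable_fun setT h -> (forall x, 0 <= h x) ->
  {ae mu, forall x, h_ ^~ x @ \oo --> h x} ->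
  (forall n, \int[mu]_x h_ n x <= a n) -> a @ \oo --> b ->
  integ mu h /\ \int[mu]_x h x <= b.
Proof.
move=> ih h0 mh hh0 hc Ia ab.
have mE n : measurable_fun setT (EFin \o h_ n).
  exact/measurable_EFinP/(integ_mfun (ih n)).
have E1 : (\int[mu]_x (h x)%:E <= b%:E)%E.
  rewrite (_ : (\int[mu]_x _ = \int[mu]_x limn_einf (fun n => (h_ n x)%:E))%E).
    apply: (le_trans (fatou mu measurableT mE _)).
      by move=> n x _; rewrite lee_fin.
    have ab' : (EFin \o a) @ \oo --> b%:E by apply: cvg_EFin ab; exact: nearW.
    rewrite -((cvg_limn_einf_sup ab').1) !limn_einf_lim.
    apply: lee_lim; [exact: is_cvg_einfs|exact: is_cvg_einfs|].
    apply: nearW => n; apply: le_ereal_inf_tmp => _ [k /= nk <-].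
    apply: (@le_trans _ _ (\int[mu]_x (EFin \o h_ k) x)%E).
      by apply: ereal_inf_lbound; exists k.
    by rewrite -EFin_Rint// lee_fin.
  apply: ae_eq_integral => //.
  - exact/measurable_EFinP.
  - apply: (@eq_measurable_fun _ _ _ _ setT
      (fun x => - limn_esup (fun n => - (h_ n x)%:E))%E).
      by move=> x _; rewrite (limn_esupN (fun n => (h_ n x)%:E)) oppeK.
    apply: measurableT_comp => //; apply: measurable_fun_limn_esup => n.
    exact/measurable_EFinP/measurableT_comp/integ_mfun/ih.
  - apply: filterS hc => x /= hx _; apply/esym.
    have hx' : (EFin \o (h_ ^~ x)) @ \oo --> (h x)%:E.
      by apply: cvg_EFin hx; exact: nearW.
    by rewrite ((cvg_limn_einf_sup hx').1).
have ih' : integ mu h.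
  by apply: lty_integ => //; rewrite (le_lt_trans E1)// ltry.
by split => //; rewrite -lee_fin EFin_Rint.
Qed.

Lemma integ_cvg_dominated (f_ : nat -> T -> R) (f g : T -> R) :
  (forall n, measurable_fun setT (f_ n)) -> measurable_fun setT f ->
  integ mu g -> {ae mu, forall x, f_ ^~ x @ \oo --> f x} ->
  {ae mu, forall x n, `|f_ n x| <= g x} ->
  integ mu f /\ (\int[mu]_x f_ n x) @[n --> \oo] --> \int[mu]_x f x.
Proof.
move=> mf_ mf ig fc fg.
have [] := @dominated_convergence _ _ _ mu setT measurableT
  (fun n => EFin \o f_ n) (EFin \o f) (EFin \o g).
- by move=> n; exact/measurable_EFinP.
- exact/measurable_EFinP.
- apply: filterS fc => x fx _; apply: cvg_EFin fx; exact: nearW.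
- exact: ig.
- by apply: filterS fg => x fgx n _; rewrite lee_fin; exact: fgx.
move=> iF _ cv; split => //; rewrite -(EFin_Rint iF) in cv.
by have [_] := (fine_cvgP _ _).1 cv.
Qed.

(* The negative of the claim gives a subsequence with [int h_n |g| > c] for
   [h_n = |f_n - f|]; Fatou's lemma applied to
   [d^s h_n^s + d^-s' |g|^s' - h_n |g| >= 0] then gives [c <= C d^s] for all [d]. *)
Lemma cvg_Rint_weak (s M : R) (f_ : nat -> T -> R) (f g : T -> R) : 1 < s ->
  (forall n, Lq mu s (f_ n)) -> (forall n, \int[mu]_x `|f_ n x| `^ s <= M) ->
  measurable_fun setT f -> {ae mu, forall x, f_ ^~ x @ \oo --> f x} ->
  Lq mu (s / (s - 1)) g ->
  Lq mu s f /\ (\int[mu]_x (f_ n x * g x)) @[n --> \oo] --> \int[mu]_x (f x * g x).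
Proof.
move=> s1 lf_ IM mf fc lg.
have s0 : 0 < s by rewrite (lt_trans _ s1).
have mf_ n : measurable_fun setT (f_ n) by case: (lf_ n).
have [mg ig] := lg.
have lf : Lq mu s f.
  split => //.
  have [] // := @fatou_Rint (fun n x => `|f_ n x| `^ s)
     (fun x => `|f x| `^ s) (fun=> M) M.
  - by move=> n; case: (lf_ n).
  - exact: mfun_powR.
  - apply: filterS fc => x fx.
    exact: cvg_norm_powR.
  - exact: cvg_cst.
split=> //.
pose h n x : R := `|f_ n x - f x|.
have lh n : Lq mu s (h n).
  have := LqD (ltW s0) (lf_ n) (LqZ (-1) lf).
  apply: Lq_dom; [exact: ltW| |by move=> x; rewrite /h mulN1r normr_id].
  exact/measurableT_comp/measurable_funB.
pose M' := 2 `^ s * (M + \int[mu]_x `|f x| `^ s).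
have IM' n : \int[mu]_x `|h n x| `^ s <= M'.
  apply: (@le_trans _ _ (\int[mu]_x (2 `^ s * (`|f_ n x| `^ s + `|f x| `^ s)))).
    apply: le_Rint; [by case: (lh n)| |].
      by apply/integZ/integD; [case: (lf_ n)|case: lf].
    move=> x; apply: le_trans (powRD_le (ltW s0) (normr_ge0 _) (normr_ge0 _)).
    rewrite ge0_ler_powR ?nnegrE ?addr_ge0 ?(ltW s0)//.
    by rewrite /h normr_id ler_normB.
  rewrite RintZ; last by apply: integD; [case: (lf_ n)|case: lf].
  rewrite RintD; [|by case: (lf_ n)|by case: lf].
  by rewrite ler_wpM2l ?powR_ge0// lerD2r.
have ihg n : integ mu (fun x => h n x * `|g x|).
  apply: (LqM s1 (lh n)); apply: Lq_dom lg => //.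
    by rewrite divr_ge0 ?(ltW s0)// subr_ge0 ltW.
  exact: measurableT_comp.
  by move=> x; rewrite normr_id.
suff H : forall c, 0 < c -> \forall n \near \oo, \int[mu]_x (h n x * `|g x|) <= c.
  apply/cvgrPdist_le => c c0; near=> n.
  rewrite -RintB; [|exact: LqM lf lg|exact: LqM (lf_ n) lg].
  apply: (le_trans (le_norm_Rint _)); first by apply: integB; apply: LqM; eauto.
  have -> : \int[mu]_x `|f x * g x - f_ n x * g x| = \int[mu]_x (h n x * `|g x|).
    by apply: eq_Rintegral => x _; rewrite -mulrBl normrM distrC.
  by near: n; exact: H.
move=> c c0; apply: contrapT => nH.
have /choice[phi phiP] : forall N, exists n,
    (N <= n)%N /\ c < \int[mu]_x (h n x * `|g x|).
  move=> N; apply: contrapT => /forallNP nn; apply: nH; exists N => // n /= Nn.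
  by rewrite leNgt; apply/negP => cn; apply: (nn n).
have phioo : phi @ \oo --> \oo.
  apply/cvgnyPge => A; exists A => // n /= An.
  exact: leq_trans (phiP n).1.
have M'0 : 0 <= M'.
  apply: le_trans (IM' 0%N); apply: Rintegral_ge0 => x _; exact: powR_ge0.
(* Here [D] is the d^s of the strategy, small enough that [D * M' < c], whereas Fatou's lemma will
   yield [c <= D * M'] once the terms in |g|^s' cancel. *)
pose D := c / (2 * (M' + 1)).
have D0 : 0 < D by rewrite divr_gt0// mulr_gt0// ltr_wpDl.
pose dl := D `^ s^-1.
have dl0 : 0 < dl by rewrite powR_gt0.
have dlE : dl `^ s = D by rewrite /dl -powRrM mulVf ?powRr1 ?gt_eqF// ltW.
pose s' := s / (s - 1).
have [] := @fatou_Rint (fun n x => (D * `|h (phi n) x| `^ s + (dl^-1 `^ s') * `|g x| `^ s')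
         - h (phi n) x * `|g x|)
     (fun x => dl^-1 `^ s' * `|g x| `^ s')
     (fun=> (D * M' + dl^-1 `^ s' * \int[mu]_x `|g x| `^ s') - c)
     ((D * M' + dl^-1 `^ s' * \int[mu]_x `|g x| `^ s') - c).
- move=> n; apply: integB => //; apply: integD; apply: integZ => //.
  by case: (lh (phi n)).
- move=> n x; rewrite subr_ge0 -dlE -!powRM ?invr_ge0 ?(ltW dl0)//.
  have -> : h (phi n) x * `|g x| = (dl * `|h (phi n) x|) * (dl^-1 * `|g x|).
    by rewrite /h normr_id mulrACA divff ?gt_eqF// mul1r.
  by apply: young => //; rewrite mulr_ge0 ?invr_ge0// ltW.
- by apply: measurable_funM => //; exact: mfun_powR.
- by move=> x; rewrite mulr_ge0 ?powR_ge0.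
- apply: filterS fc => x fx.
  have hx : h (phi n) x @[n --> \oo] --> 0.
    rewrite -(normr0 R); apply: cvg_norm; rewrite -(subrr (f x)).
    by apply: cvgB; [exact: (cvg_comp _ _ phioo fx)|exact: cvg_cst].
  have hxs : `|h (phi n) x| `^ s @[n --> \oo] --> 0.
    have : `|h (phi n) x| `^ s @[n --> \oo] --> `|0 : R| `^ s.
      by apply: cvg_norm_powR.
    by rewrite normr0 powR0// gt_eqF.
  rewrite -[X in _ --> X]subr0 -[X in _ --> X - _]add0r.
  apply: cvgB; last by rewrite -(mul0r `|g x|); exact: cvgMl.
  apply: cvgD; last exact: cvg_cst.
  by rewrite -(mulr0 D); exact: cvgMr.
- move=> n; rewrite RintB//; last first.
    by apply: integD; apply: integZ => //; case: (lh (phi n)).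
  rewrite RintD; [|by apply: integZ; case: (lh (phi n))|exact: integZ].
  rewrite !RintZ//; last by case: (lh (phi n)).
  by rewrite lerB ?lerD2r ?ler_wpM2l ?(ltW D0) ?IM'// ltW// (phiP n).2.
- exact: cvg_cst.
move=> _; rewrite RintZ// -lerBlDl; last first.
move=> abs.
have : c <= D * M' by lra.
rewrite leNgt => /negP; apply.
rewrite /D -mulrA gtr_pMr// mulrC ltr_pdivrMr; last by rewrite mulr_gt0// ltr_wpDl.
by lra.
Unshelve. all: by end_near.
Qed.

End limits.

(** * Measurability of functions of finitely many coordinates *)

Section coordinates.
Context d (T : measurableType d) (R : realType).

Lemma measurable_comp_countable (K : countType) (k : T -> K) (G : K -> R) :
  (forall a, measurable (k @^-1` [set a])) -> measurable_fun setT (G \o k).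
Proof.
move=> mk _ Y mY; rewrite setTI.
have -> : (G \o k) @^-1` Y = \bigcup_(a in [set a | Y (G a)]) (k @^-1` [set a]).
  by apply/seteqP; split => [x Yx|x [a Ya /= kx]] /=; [exists (k x)|rewrite kx].
rewrite bigcup_mkcond; apply: countable_bigcupT_measurable => // a.
by case: ifPn.
Qed.

Lemma measurable_fun_floor (f : T -> R) (a : int) : measurable_fun setT f ->
  measurable ((fun x => Num.floor (f x)) @^-1` [set a]).
Proof.
move=> mf.
have -> : (fun x => Num.floor (f x)) @^-1` [set a] = f @^-1` `[a%:~R, (a + 1)%:~R[%classic.
  apply/seteqP; split => x /=.
    by move=> <-; rewrite in_itv/= floor_le_tmp floorD1_gt.
  by rewrite in_itv/= => /andP[ax xa]; apply: floor_def; rewrite ax.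
by rewrite -[X in measurable X]setTI; exact: mf.
Qed.

Variable J : finType.
Implicit Types u v : J -> R.

(** Rounding down, rather than to the nearest point, keeps a nonnegative coordinate nonnegative, so
    that the half-space is preserved. *)
Definition discretize (n : nat) v : J -> R :=
  fun j => (Num.floor (n.+1%:R * v j))%:~R / n.+1%:R.

Lemma discretize_dist n v j : `|discretize n v j - v j| <= n.+1%:R^-1.
Proof.
rewrite /discretize -[X in _ - X](mulKf (_ : n.+1%:R != 0))// mulrC -mulrBr normrM.
rewrite ger0_norm// ler_piMr//.
set y := n.+1%:R * _.
have := floor_le_tmp y; have := floorD1_gt y; rewrite intrD1.
by move=> h1 h2; rewrite distrC ger0_norm; lra.
Qed.

(* A function of finitely many measurable coordinates is the limit of functions
   of the discretised coordinates, which take countably many values. *)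
Lemma measurable_comp_continuous (D : set (J -> R)) (G : (J -> R) -> R)
    (c : T -> J -> R) :
  (forall j, measurable_fun setT (fun x => c x j)) -> (forall x, D (c x)) ->
  (forall n v, D v -> D (discretize n v)) ->
  (forall v, D v -> forall eps, 0 < eps -> exists2 del, 0 < del &
    forall v', D v' -> (forall j, `|v' j - v j| < del) -> `|G v' - G v| < eps) ->
  measurable_fun setT (fun x => G (c x)).
Proof.
move=> mc Dc Dd Gc.
apply: (@measurable_fun_cvg _ _ _ _ (fun n x => G (discretize n (c x)))).
- move=> n.
  pose k x := [ffun j => Num.floor (n.+1%:R * c x j)].
  apply: (@eq_measurable_fun _ _ _ _ setT
     ((fun a : {ffun J -> int} => G (fun j => (a j)%:~R / n.+1%:R)) \o k)).
    move=> x _; rewrite /= ; congr (G _); apply/funext => j.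
    by rewrite /k ffunE.
  apply: measurable_comp_countable => a.
  have -> : k @^-1` [set a] = \bigcap_(j in [set: J])
      ((fun x => Num.floor (n.+1%:R * c x j)) @^-1` [set a j]).
    apply/seteqP; split => x /=.
      by move=> <- j _ /=; rewrite ffunE.
    by move=> ka; apply/ffunP => j; rewrite ffunE; exact: ka.
  rewrite -bigsetI_fset_set/=; last exact: finite_finset.
  elim/big_ind: _ => //; first exact: measurableI.
  by move=> j _; apply: measurable_fun_floor; exact: measurable_funM.
- move=> x _; apply/cvgrPdist_lt => eps eps0.
  have [del del0 Gd] := Gc _ (Dc x) _ eps0.
  near=> n; rewrite distrC; apply: Gd; first exact: Dd.
  move=> j; apply: (le_lt_trans (discretize_dist n (c x) j)).
  by near: n; exact: near_infty_natSinv_lt (PosNum del0).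
Unshelve. all: by end_near.
Qed.

End coordinates.

(** * Almost everywhere convergent subsequences *)

Lemma cvg_of_summable_steps (R : realType) (a dd : nat -> R) (K : nat) :
  (forall k, 0 <= dd k) -> cvgn (series dd) ->
  (forall k, (K <= k)%N -> `|a k.+1 - a k| <= dd k) -> cvgn a.
Proof.
move=> d0 cd ad.
pose b k := a (k + K)%N.
suff: cvgn b.
  move=> /cvg_ex[l bl]; apply/cvg_ex; exists l.
  by rewrite -(cvg_shiftn K).
have cb : cvgn (series (telescope b)).
  apply: normed_cvg; apply: (@series_le_cvg _ _ (fun k => dd (k + K)%N)) => //.
  - by move=> n /=.
  - by move=> n; rewrite /b /telescope/= addSn ad// leq_addl.
  - have /cvg_ex[l dl] := cd.
    apply/cvg_ex; exists (l - series dd K).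
    have -> : series (fun k => dd (k + K)%N) = fun n => series dd (n + K)%N - series dd K.
      apply/funext => n; rewrite /series/=.
      elim: n => [|n ih]; first by rewrite big_geq// add0n subrr.
      by rewrite big_nat_recr//= ih addSn [X in _ = X - _]big_nat_recr//= addrAC.
    by apply: cvgB; [rewrite cvg_shiftn|exact: cvg_cst].
move: cb; rewrite telescopeK => /cvg_ex[l bl]; apply/cvg_ex; exists (l + b 0%N).
have := @cvgD _ _ _ _ _ _ _ _ _ bl (@cvg_cst _ (b 0%N) _ \oo _).
rewrite (_ : _ + _ = b); first exact.
by apply/funext => n; rewrite fctE /= subrK.
Qed.

Section subsequence.
Context d (T : measurableType d) (R : realType).
Variable mu : {measure set T -> \bar R}.
Hypothesis mufin : (mu setT < +oo)%E.
Variable J : finType.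

(** By monotone convergence the sum of the series has integral at most 2, hence is finite almost
    everywhere: the Borel-Cantelli argument in series form. *)
Lemma ae_series_cvg (dd : nat -> T -> R) : (forall k, integ mu (dd k)) ->
  (forall k x, 0 <= dd k x) -> (forall k, \int[mu]_x dd k x <= 2^-1 ^+ k) ->
  {ae mu, forall x, cvgn (series (dd ^~ x))}.
Proof.
move=> idd dd0 ddle; have mdd k := integ_mfun (idd k).
have S : (\int[mu]_x (\sum_(k <oo) (dd k x)%:E) < +oo)%E.
  rewrite integral_nneseries//; last 2 first.
  - by move=> n; exact/measurable_EFinP.
  - by move=> n x _; rewrite lee_fin.
  apply: (@le_lt_trans _ _ 2%:E); last exact: ltry.
  apply: lime_le.
    by apply: is_cvg_nneseries => n _ _; apply: integral_ge0 => x _; rewrite lee_fin.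
  apply: nearW => n.
  apply: (@le_trans _ _ (series (geometric 1 2^-1) n)%:E).
    rewrite /series/= -sumEFin; apply: lee_sum => k _.
    by rewrite -EFin_Rint// lee_fin mul1r.
  rewrite lee_fin; apply: (le_trans (geometric_le_lim _ _ _ _)) => //.
    by rewrite ger0_norm// invf_lt1// ltr1n.
  by rewrite mul1r (_ : 1 - 2^-1 = 2^-1) ?invrK//; lra.
have iS : mu.-integrable setT (fun x => \sum_(k <oo) (dd k x)%:E)%E.
  apply/integrableP; split.
    apply: ge0_emeasurable_sum => [k x _ _|k _]; first by rewrite lee_fin.
    exact/measurable_EFinP.
  rewrite (eq_integral (fun x => \sum_(k <oo) (dd k x)%:E)%E)// => x _.
  by rewrite gee0_abs// nneseries_ge0// => n _ _; rewrite lee_fin.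
have := integrable_ae measurableT iS; apply: ae_imp => x /(_ Logic.I) fx.
apply: nondecreasing_is_cvgn; first by apply: nondecreasing_series => n _ _.
exists (fine (\sum_(k <oo) (dd k x)%:E)%E) => _ [n _ <-].
rewrite -lee_fin fineK// /series/= -sumEFin.
by apply: nneseries_lim_ge => k _ _; rewrite lee_fin.
Qed.

(** Bounded, so integrable for all measurable u and v; its mean is a distance for convergence in
    measure, the mode of convergence that strict convexity controls. *)
Definition cut_dist (u v : J -> R) : R := Num.min 1 (\sum_j `|u j - v j|).

Lemma cut_dist_ge0 u v : 0 <= cut_dist u v.
Proof. by rewrite le_min ler01/= sumr_ge0. Qed.

Lemma measurable_cut_dist (u v : T -> J -> R) :
  (forall j, measurable_fun setT (fun x => u x j)) ->
  (forall j, measurable_fun setT (fun x => v x j)) ->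
  measurable_fun setT (fun x => cut_dist (u x) (v x)).
Proof.
move=> mu_ mv; apply: measurable_minr => //; apply: measurable_sum => j.
by apply: measurableT_comp => //; exact: measurable_funB.
Qed.

Lemma integ_cut_dist (u v : T -> J -> R) :
  (forall j, measurable_fun setT (fun x => u x j)) ->
  (forall j, measurable_fun setT (fun x => v x j)) ->
  integ mu (fun x => cut_dist (u x) (v x)).
Proof.
move=> mu_ mv; apply: (@integ_bounded _ _ _ mu mufin _ 1).
  exact: measurable_cut_dist.
by move=> x; rewrite ger0_norm ?cut_dist_ge0// ge_min lexx.
Qed.

Lemma ae_cvg_subseq (u_ : nat -> T -> J -> R) :
  (forall n j, measurable_fun setT (fun x => u_ n x j)) ->
  (forall eps, 0 < eps -> exists N, forall n m, (N <= n)%N -> (n <= m)%N ->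
     \int[mu]_x cut_dist (u_ n x) (u_ m x) <= eps) ->
  exists phi : nat -> nat, (forall n, (n <= phi n)%N) /\
    {ae mu, forall x j, cvgn (fun n => u_ (phi n) x j)}.
Proof.
move=> mu_ cu.
have /choice[N NP] : forall k : nat, exists N, forall n m, (N <= n)%N -> (n <= m)%N ->
     \int[mu]_x cut_dist (u_ n x) (u_ m x) <= 2^-1 ^+ k.
  by move=> k; apply: cu; rewrite exprn_gt0.
(* Nondecreasing, at least [k] and at least [N k]: the terms of ranks [phi k] and [phi k.+1] are
   then at mean distance at most 2^-k. *)
pose phi k := (k + \sum_(i < k.+1) N i)%N.
have phile k : (k <= phi k)%N by rewrite leq_addr.
have phiS k : (phi k <= phi k.+1)%N.
  by rewrite /phi [X in (_ <= _ + X)%N]big_ord_recr/= leq_add// leq_addr.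
have phiN k : (N k <= phi k)%N.
  by rewrite /phi big_ord_recr/= addnA leq_addl.
exists phi; split => //.
pose dd k x := cut_dist (u_ (phi k) x) (u_ (phi k.+1) x).
have idd k : integ mu (dd k) by exact: integ_cut_dist.
have dd_ge0 k x : 0 <= dd k x by exact: cut_dist_ge0.
have ddle k : \int[mu]_x dd k x <= 2^-1 ^+ k by exact: NP.
have := ae_series_cvg idd dd_ge0 ddle; apply: ae_imp => x cdd j.
have dd0 := cvg_series_cvg_0 cdd.
(* A summable sequence is eventually below 1, where the truncation in [cut_dist] is inactive and
   [dd k x] bounds the step of each coordinate. *)
have [K _ KP] : \forall k \near \oo, `|dd k x| < 1 by exact: cvgr0_norm_lt.
apply: (@cvg_of_summable_steps _ _ (dd ^~ x) K) => // k Kk.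
have := KP k Kk; rewrite ger0_norm ?cut_dist_ge0// /dd /cut_dist.
rewrite gt_min => /orP[]; first by rewrite ltxx.
move=> s1; rewrite min_r ?(ltW s1)//.
rewrite (bigD1 j)//= distrC lerDl sumr_ge0//.
Qed.

Lemma ae_cvg_subseq_L1 (u_ : nat -> J -> T -> R) (u : J -> T -> R) :
  (forall n j, integ mu (u_ n j)) -> (forall j, integ mu (u j)) ->
  (forall j, (fun n => \int[mu]_x `|u_ n j x - u j x|) @ \oo --> 0) ->
  exists phi : nat -> nat, (forall n, (n <= phi n)%N) /\
    {ae mu, forall x j, u_ (phi n) j x @[n --> \oo] --> u j x}.
Proof.
move=> iu_ iu cu.
have id_ n j : integ mu (fun x => `|u_ n j x - u j x|) by apply/integ_norm/integB.
have S : (fun n => \sum_j \int[mu]_x `|u_ n j x - u j x|) @ \oo --> 0.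
  by rewrite -[X in _ --> X](@big1_eq _ 0 +%R J (index_enum J) predT); apply: (@cvg_big _ _ _ 0 xpredT add_continuous) => j _; exact: cu.
have /choice[phi phiP] : forall k : nat, exists n, (k <= n)%N /\
    \sum_j \int[mu]_x `|u_ n j x - u j x| <= 2^-1 ^+ k.
  move=> k; have e0 : 0 < (2^-1 ^+ k : R) by rewrite exprn_gt0.
  have /cvgr0Pnorm_le/(_ _ e0)[N _ NP] := S.
  exists (maxn k N); rewrite leq_maxl; split => //.
  by apply: le_trans (ler_norm _) (NP _ _); rewrite /= leq_maxr.
exists phi; split; first by move=> n; have [] := phiP n.
pose dd k x := \sum_j `|u_ (phi k) j x - u j x|.
have idd k : integ mu (dd k) by exact: integ_sum.
have dd0 k x : 0 <= dd k x by exact: sumr_ge0.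
have ddle k : \int[mu]_x dd k x <= 2^-1 ^+ k by rewrite Rint_sum//; have [] := phiP k.
have := ae_series_cvg idd dd0 ddle; apply: ae_imp => x cdd j.
have dd_0 := cvg_series_cvg_0 cdd.
apply/cvgrPdist_le => eps eps0; have /cvgr0Pnorm_le/(_ _ eps0) := dd_0.
apply: filterS => n; apply: le_trans; rewrite distrC (ger0_norm (dd0 _ _)) /dd.
by rewrite (bigD1 j)//= lerDl sumr_ge0.
Qed.

End subsequence.

(** * Strict convexity on boxes and calculus on the half-space *)

Section convexity_modulus.
Variables (R : realType) (J : finType) (A : J -> set R) (G : (J -> R) -> R).

Definition midpoint (u v : J -> R) : J -> R := fun j => (u j + v j) / 2.

Definition convex_gap (u v : J -> R) : R := (G u + G v) / 2 - G (midpoint u v).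

Definition cont_on_box := forall v, (forall j, A j (v j)) ->
  forall eps, 0 < eps -> exists2 del, 0 < del &
    forall v', (forall j, A j (v' j)) -> (forall j, `|v' j - v j| < del) ->
      `|G v' - G v| < eps.

Hypothesis A_closed : forall j, closed (A j).
Hypothesis A_mid : forall j a b, A j a -> A j b -> A j ((a + b) / 2).
Hypothesis G_cont : cont_on_box.
Hypothesis G_convex : forall u v, (forall j, A j (u j)) -> (forall j, A j (v j)) ->
  (exists j, u j != v j) -> 0 < convex_gap u v.

Lemma convex_gap_ge0 u v : (forall j, A j (u j)) -> (forall j, A j (v j)) ->
  0 <= convex_gap u v.
Proof.
move=> Au Av; have [/forallP uv|/existsP uv] := boolP [forall j, u j == v j]; last first.
  by apply/ltW/G_convex => //; move: uv.
have -> : v = u by apply/funext => j; apply/esym/eqP.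
rewrite /convex_gap (_ : midpoint u u = u); first by rewrite -mulr2n -[_ *+ 2]mulr_natr mulfK// subrr.
by apply/funext => j; rewrite /midpoint -mulr2n -[_ *+ 2]mulr_natr mulfK.
Qed.

(** A pair (u, v) is encoded as one row vector indexed by J + J, so that compactness of the pairs in
    a box is that of a product of segments. *)
Let n := #|{: J + J}|.
Let lc (w : 'rV[R]_n) : J -> R := fun j => w 0 (enum_rank (inl j : J + J)).
Let rc (w : 'rV[R]_n) : J -> R := fun j => w 0 (enum_rank (inr j : J + J)).
Let sideA (s : J + J) : set R := match s with inl j => A j | inr j => A j end.

(** The pairs in the box at distance at least eps form a compact set on which the gap is continuous
    and positive; [c] is its minimum there. *)
Lemma convex_gap_lbound (M eps : R) : 0 < eps -> exists2 c, 0 < c &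
  forall u v, (forall j, A j (u j)) -> (forall j, A j (v j)) ->
    (forall j, `|u j| <= M) -> (forall j, `|v j| <= M) ->
    eps <= \sum_j `|u j - v j| -> c <= convex_gap u v.
Proof.
move=> eps0.
pose K := [set w : 'rV[R]_n | forall i, (sideA (enum_val i) `&` `[- M, M]%classic) (w 0 i)]
  `&` [set w | eps <= \sum_j `|lc w j - rc w j|].
have KA w : K w -> (forall j, A j (lc w j)) /\ (forall j, A j (rc w j)).
  move=> [/= Kw _]; split => j.
    by have [] := Kw (enum_rank (inl j : J + J)); rewrite enum_rankK.
  by have [] := Kw (enum_rank (inr j : J + J)); rewrite enum_rankK.
have midc u v : (forall j, A j (u j)) -> (forall j, A j (v j)) ->
    forall j, A j (midpoint u v j).
  by move=> Au Av j; exact: A_mid.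
have cK : compact K.
  apply: compact_closedI.
    apply: (@rV_compact R n (fun i => sideA (enum_val i) `&` `[- M, M]%classic)) => i.
    apply: (@subclosed_compact _ _ `[- M, M]%classic).
    - apply: closedI; last exact: itv_closed.
      by rewrite /sideA; case: (enum_val i).
    - exact: segment_compact.
    - by move=> x [].
  have -> : [set w | eps <= \sum_j `|lc w j - rc w j|] =
      (fun w => \sum_j `|lc w j - rc w j|) @^-1` [set x | eps <= x] by [].
  apply: preimage_closed; last exact: closed_ge.
  move=> w _; apply: (@cvg_big _ _ _ 0 xpredT add_continuous _ _ _ _ _ (nbhs_filter w)) => j _.
  by apply: cvg_norm; apply: cvgB; exact: coord_continuous.
(* If there is no such pair, any positive constant will do. *)
have [K0|/set0P [w0 Kw0]] := eqVneq K set0.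
  exists 1 => // u v Au Av uM vM uv.
  pose w : 'rV[R]_n := \row_i match enum_val i with inl j => u j | inr j => v j end.
  have lw : lc w = u by apply/funext => j; rewrite /lc mxE enum_rankK.
  have rw : rc w = v by apply/funext => j; rewrite /rc mxE enum_rankK.
  suff : K w by rewrite K0.
  split => /=; last by rewrite lw rw.
  move=> i; rewrite mxE /sideA; case: (enum_val i) => j; split => //=; rewrite in_itv/= -ler_norml//.
have cgap : {within K, continuous (fun w => convex_gap (lc w) (rc w))}.
  (* One continuity statement covers G(u), G(v) and G at the midpoint: each coordinate of the
     argument depends on at most two entries of [w]. *)
  have cG (a b : J -> J + J) (F : 'rV[R]_n -> J -> R) w : K w ->
     (forall w, K w -> forall j, A j (F w j)) ->
     (forall w w' j, `|F w' j - F w j| <= `|w' 0 (enum_rank (a j)) - w 0 (enum_rank (a j))|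
         + `|w' 0 (enum_rank (b j)) - w 0 (enum_rank (b j))|) ->
     (fun w => G (F w)) @ within K (nbhs w) --> G (F w).
    move=> Kw AF Fab; apply/cvgrPdist_lt => e e0.
    have [del del0 Gd] := G_cont (AF _ Kw) e0.
    have d20 : 0 < del / 2 by rewrite divr_gt0.
    rewrite near_withinE; near=> w' => Kw'; rewrite distrC.
    apply: Gd; first exact: AF.
    have [_ ww'] : ball w (del / 2) w' by near: w'; exact: nbhsx_ballx.
    move=> j; apply: (le_lt_trans (Fab w w' j)).
    rewrite [ltRHS]splitr ltrD// distrC; exact: ww'.
  apply/subspace_continuousP => w Kw; apply: cvgB.
    apply: cvgM; last exact: cvg_cst.
    apply: cvgD.
      apply: (cG inl inl) => // [w' /KA[]//|w' w'' j]; rewrite lerDl//.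
    apply: (cG inr inr) => // [w' /KA[]//|w' w'' j]; rewrite lerDl//.
  apply: (cG inl inr) => // [w' /KA[Al Ar] j|w' w'' j]; first exact: A_mid.
  rewrite /midpoint -mulrBl normrM (@ger0_norm _ 2^-1)//.
  rewrite ler_pdivrMr// opprD addrACA (le_trans (ler_normD _ _))//.
  by rewrite ler_peMr// ?addr_ge0// ler1n.
have [w /set_mem Kw wmin] := compact_EVT_min (ex_intro _ w0 Kw0) cK cgap.
have [Al Ar] := KA w Kw.
exists (convex_gap (lc w) (rc w)).
  apply: G_convex => //; apply: contrapT => /forallNP lr.
  case: Kw => _ /=; rewrite big1 ?leNgt ?eps0// => j _.
  by have /negP := lr j; rewrite negbK => /eqP ->; rewrite subrr normr0.
move=> u v Au Av uM vM uv.
pose w' : 'rV[R]_n := \row_i match enum_val i with inl j => u j | inr j => v j end.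
have lw : lc w' = u by apply/funext => j; rewrite /lc mxE enum_rankK.
have rw : rc w' = v by apply/funext => j; rewrite /rc mxE enum_rankK.
rewrite -lw -rw; apply: wmin; rewrite inE.
split => /=; last by rewrite lw rw.
by move=> i; rewrite mxE /sideA; case: (enum_val i) => j; split => //=; rewrite in_itv/= -ler_norml.
Unshelve. all: by end_near.
Qed.

End convexity_modulus.

(** * Differential calculus on the closed half-space *)

Section half_space_calculus.
Variable R : realType.
Local Notation U := (ext_var R * R)%type.
Local Notation H := (@half_space R).
Implicit Types (u v w d : U) (g : U -> R) (j k : energy_idx).

Definition ecoord j u : R := if j is Some B then ext_coord B u.1 else u.2.

Definition of_ecoord (c : energy_idx -> R) : U :=
  (\matrix_(i, a) c (Some (inl (inl (i, a)))),
   \matrix_(i, a) c (Some (inl (inr (i, a)))), c (Some (inr tt)), c None).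

Lemma of_ecoordK c j : ecoord j (of_ecoord c) = c j.
Proof. by case: j => [[[[i a]|[i a]]|[]]|]//=; rewrite mxE. Qed.

Lemma ecoordK u : of_ecoord (ecoord^~ u) = u.
Proof.
case: u => [[[F z] w] eta]; rewrite /of_ecoord /=.
by congr (_, _, _, _); apply/matrixP => i a; rewrite mxE.
Qed.

Lemma ecoord_inj u v : (forall j, ecoord j u = ecoord j v) -> u = v.
Proof.
move=> uv; rewrite -(ecoordK u) -(ecoordK v); congr of_ecoord.
exact/funext.
Qed.

Lemma ecoordD j u v : ecoord j (u + v) = ecoord j u + ecoord j v.
Proof. by case: j => [[[[i a]|[i a]]|[]]|]//=; rewrite mxE. Qed.

Lemma ecoordZ j (t : R) u : ecoord j (t *: u) = t * ecoord j u.
Proof. by case: j => [[[[i a]|[i a]]|[]]|]//=; rewrite mxE. Qed.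

Lemma ecoord0 j : ecoord j 0 = 0.
Proof. by case: j => [[[[i a]|[i a]]|[]]|]//=; rewrite mxE. Qed.

Lemma ecoordB j u v : ecoord j (u - v) = ecoord j u - ecoord j v.
Proof. by rewrite ecoordD -scaleN1r ecoordZ mulN1r. Qed.

Lemma ecoord_sum (I : Type) (s : seq I) (P : pred I) (F : I -> U) j :
  ecoord j (\sum_(i <- s | P i) F i) = \sum_(i <- s | P i) ecoord j (F i).
Proof. by elim/big_rec2: _ => [|i y1 y2 _ <-]; rewrite ?ecoord0// ecoordD. Qed.

Lemma ecoord_vec j k : ecoord j (energy_vec R k) = (j == k)%:R.
Proof.
case: j k => [[[[i a]|[i a]]|[]]|] [[[[i' a']|[i' a']]|[]]|]//=;
  rewrite mxE//.
Qed.

Lemma half_spaceE u : H u = (0 <= ecoord None u) :> Prop.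
Proof. by []. Qed.

Definition hcont g := forall u, H u -> forall eps, 0 < eps ->
  exists2 del, 0 < del & forall u', H u' ->
    (forall j, `|ecoord j u' - ecoord j u| < del) -> `|g u' - g u| < eps.

Lemma within_hcont g : {within H, continuous g} -> hcont g.
Proof.
move=> /subspace_continuousP gc u Hu eps eps0.
have := gc u Hu => /cvgrPdist_lt/(_ eps eps0).
rewrite near_withinE => /nbhs_ballP[del /= del0 gd].
exists del => // u' Hu' uu'; rewrite distrC; apply: gd => //.
split; [split; [split|]|]; [split => // i a| split => // i a| |].
- by have := uu' (Some (inl (inl (i, a)))); rewrite distrC.
- by have := uu' (Some (inl (inr (i, a)))); rewrite distrC.
- by have := uu' (Some (inr tt)); rewrite distrC.
- by have := uu' None; rewrite distrC.
Qed.

Definition hC1 g := hcont g /\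
  forall j u, H u -> cvg (difference_quotient j g u).

Lemma C_k_hC1 (k : nat) g (s : seq energy_idx) : C_k k g -> (size s < k)%N ->
  hC1 (foldr (@epartial R) g s).
Proof.
move=> gk sk; have [gc /(_ sk) gd] := gk s (ltnW sk).
by split => //; exact: within_hcont.
Qed.

Lemma C_k_hcont (k : nat) g (s : seq energy_idx) : C_k k g -> (size s <= k)%N ->
  hcont (foldr (@epartial R) g s).
Proof. by move=> gk sk; have [gc _] := gk s sk; exact: within_hcont. Qed.

(** When the line stays in the half-space on both sides of s, the restriction on the increments is
    vacuous near 0, and the relative derivative is the ordinary one. *)
Lemma is_derive_coord g j u (s del : R) : hC1 g -> 0 < del ->
  (forall t, `|t| < del -> H (u + (s + t) *: energy_vec R j)) ->
  is_derive s 1 (fun t : R => g (u + t *: energy_vec R j))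
    (epartial j g (u + s *: energy_vec R j)).
Proof.
move=> [_ gd] del0 Hu.
have Hs : H (u + s *: energy_vec R j) by have := Hu 0; rewrite normr0 addr0; apply.
have gs := gd j _ Hs.
set w := u + s *: energy_vec R j in gs *.
set F := (fun t : R => g (u + t *: energy_vec R j)).
have FE : (fun t : R => t^-1 *: (F (t *: 1 + s) - F s)) =
    (fun t : R => t^-1 * (g (w + t *: energy_vec R j) - g w)).
  apply/funext => t; rewrite /F /w scaler1 -addrA -scalerDl [s + t]addrC.
  by [].
have cF : (fun t : R => t^-1 *: (F (t *: 1 + s) - F s)) @ 0^' --> epartial j g w.
  rewrite FE /epartial patchE mem_set//.
  apply: cvg_trans gs => P; rewrite /difference_quotient /= !nbhs_simpl /= => PP.
  have : \forall t \near (0:R)^', H (w + t *: energy_vec R j).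
    near=> t; rewrite /w -addrA -scalerDl; apply: Hu.
    near: t; apply: nbhs_dnbhs; near=> t.
    near: t; apply: (@nbhs0_lt R R); exact: del0.
  move: PP; rewrite /within /=; apply: filterS2 => t PP Ht; exact: PP.
split; first by apply/cvg_ex; exists (epartial j g w).
exact/cvg_lim.
Unshelve. all: by end_near.
Qed.

Lemma half_space_segment u w (t : R) : 0 <= t -> t <= 1 -> H u -> H (u + w) -> H (u + t *: w).
Proof.
rewrite !half_spaceE !ecoordD !ecoordZ => t0 t1 u0 uw.
rewrite (_ : _ + _ = (1 - t) * ecoord None u + t * (ecoord None u + ecoord None w)); last ring.
by rewrite addr_ge0// mulr_ge0// subr_ge0.
Qed.

Lemma hcont_line g u d (s : R) : hcont g -> H (u + s *: d) ->
  forall eps, 0 < eps -> exists2 del, 0 < del &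
    forall t, `|t - s| < del -> H (u + t *: d) -> `|g (u + t *: d) - g (u + s *: d)| < eps.
Proof.
move=> gc Hs eps eps0; have [del del0 gd] := gc _ Hs eps eps0.
pose B := \sum_j `|ecoord j d| + 1.
have B0 : 0 < B by rewrite ltr_wpDl// sumr_ge0.
exists (del / B); first by rewrite divr_gt0.
move=> t ts Ht; apply: gd => // j.
rewrite !ecoordD !ecoordZ opprD addrACA subrr add0r -mulrBl normrM.
move: ts; rewrite ltr_pdivlMr//; apply: le_lt_trans.
rewrite ler_wpM2l// /B (bigD1 j)//= -addrA lerDl addr_ge0// sumr_ge0//.
Qed.

Lemma hcont_line_within g u d (a b : R) : hcont g ->
  (forall t, t \in `[a, b] -> H (u + t *: d)) ->
  {within `[a, b], continuous (fun t : R => g (u + t *: d))}.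
Proof.
move=> gc Hab; apply/subspace_continuousP => s sab.
apply/cvgrPdist_lt => eps eps0.
have [del del0 gd] := hcont_line gc (Hab s sab) eps0.
rewrite near_withinE; near=> t => tab; rewrite distrC; apply: gd; last exact: Hab.
by rewrite distrC; near: t; exact: (@cvgr_dist_lt _ _ _ _ _ id s).
Unshelve. all: by end_near.
Qed.

(** The mean value theorem needs derivatives only inside the segment and continuity up to its ends,
    so either end may lie on the boundary eta = 0. *)
Lemma MVT_coord g j u (s : R) : hC1 g -> H u -> H (u + s *: energy_vec R j) ->
  exists2 th : R, 0 <= th <= 1 & g (u + s *: energy_vec R j) - g u =
    s * epartial j g (u + (th * s) *: energy_vec R j).
Proof.
move=> gC Hu Hs.
have Hseg t : 0 <= t <= 1 -> H (u + (t * s) *: energy_vec R j).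
  by move=> /andP[t0 t1]; rewrite -scalerA; exact: half_space_segment.
have [s0|s0|->] := ltgtP s 0; last first.
- by exists 0; rewrite ?lexx ?ler01// scale0r addr0 subrr mul0r.
- have Hin t : t \in `[0, s] -> H (u + t *: energy_vec R j).
    rewrite in_itv/= => /andP[t0 ts]; rewrite -(divfK (lt0r_neq0 s0) t).
    apply: Hseg; rewrite divr_ge0 ?(ltW s0)//= ler_pdivrMr// mul1r//.
  have [|c + E] := @MVT R _ (fun t => epartial j g (u + t *: energy_vec R j)) 0 s s0 _
      (hcont_line_within gC.1 Hin).
    move=> x; rewrite in_itv/= => /andP[x0 xs].
    apply: (@is_derive_coord g j u x (Num.min x (s - x))) => //.
      by rewrite lt_min x0/= subr_gt0.
    move=> t; rewrite lt_min => /andP[]; rewrite !ltr_norml => /andP[? _] /andP[_ ?].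
    by apply: Hin; rewrite in_itv/=; apply/andP; split; lra.
  rewrite in_itv/= => /andP[c0 cs].
  exists (c / s); first by rewrite divr_ge0 ?(ltW c0) ?(ltW s0)//= ler_pdivrMr// mul1r ltW.
  by rewrite divfK ?gt_eqF//; move: E; rewrite scale0r addr0 subr0 mulrC.
- have Hin t : t \in `[s, 0] -> H (u + t *: energy_vec R j).
    rewrite in_itv/= => /andP[t0 ts]; rewrite -(divfK (ltr0_neq0 s0) t).
    apply: Hseg; rewrite mulr_le0 ?invr_le0 ?(ltW s0)//= ler_ndivrMr// mul1r//.
  have [|c + E] := @MVT R _ (fun t => epartial j g (u + t *: energy_vec R j)) s 0 s0 _
      (hcont_line_within gC.1 Hin).
    move=> x; rewrite in_itv/= => /andP[x0 xs].
    apply: (@is_derive_coord g j u x (Num.min (x - s) (- x))) => //.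
      by rewrite lt_min subr_gt0 x0/= oppr_gt0.
    move=> t; rewrite lt_min => /andP[]; rewrite !ltr_norml => /andP[? _] /andP[_ ?].
    by apply: Hin; rewrite in_itv/=; apply/andP; split; lra.
  rewrite in_itv/= => /andP[c0 cs].
  exists (c / s); first by rewrite mulr_le0 ?invr_le0 ?(ltW cs) ?(ltW s0)//= ler_ndivrMr// mul1r ltW.
  rewrite divfK ?lt_eqF//; move: E; rewrite scale0r addr0 sub0r mulrN => E.
  by rewrite mulrC -opprB E opprK.
Qed.

(* Summing the mean value theorem over the coordinates; changing them one at a
   time never leaves the half-space. *)
Lemma first_order_expansion g w d (a b : R) (s : seq energy_idx) : hC1 g ->
  (forall j, hcont (epartial j g)) -> uniq s -> a < 0 -> 0 < b ->
  (forall t, a < t < b -> H (w + t *: d)) ->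
  forall eps, 0 < eps -> exists2 del, 0 < del & forall t, `|t| < del ->
    `|g (w + t *: (\sum_(j <- s) ecoord j d *: energy_vec R j)) - g w
      - t * (\sum_(j <- s) ecoord j d * epartial j g w)| <= eps * `|t|.
Proof.
move=> gC gpC + a0 b0 Hab.
have Hw : H w by have := Hab 0; rewrite scale0r addr0; apply; rewrite a0.
pose D (s : seq energy_idx) := \sum_(j <- s) ecoord j d *: energy_vec R j.
have DE (s' : seq energy_idx) k : uniq s' -> ecoord k (D s') = if k \in s' then ecoord k d else 0.
  move=> us'; rewrite /D ecoord_sum.
  under eq_bigr do rewrite ecoordZ ecoord_vec.
  have [ks|ks] := boolP (k \in s').
    rewrite (big_rem k)//= eqxx mulr1 big_seq big1 ?addr0// => i.
    rewrite mem_rem_uniq// inE => /andP[ik _]; rewrite eq_sym (negbTE ik) mulr0//.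
  by rewrite big_seq big1// => i is_; rewrite (_ : k == i = false) ?mulr0//; apply/negbTE; apply: contraNneq ks => ->.
(* Only the entropy is constrained, and a partial increment either moves it as the full increment
   does or not at all. *)
have HD s' t : uniq s' -> a < t < b -> H (w + t *: D s').
  move=> us' tab; rewrite half_spaceE ecoordD ecoordZ DE//.
  case: ifP => _; last by rewrite mulr0 addr0.
  by have := Hab t tab; rewrite half_spaceE ecoordD ecoordZ.
elim: s => [_ eps eps0|j s ih /= /andP[js us] eps eps0].
  by exists 1 => // t _; rewrite !big_nil scaler0 addr0 subrr mulr0 subr0 normr0 mulr_ge0 ?(ltW eps0).
have e20 : 0 < eps / 2 by rewrite divr_gt0.
have [del1 del10 d1] := ih us _ e20.
(* With this tolerance on the derivative, the contribution of the new coordinate stays below eps / 2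
   per unit of |t|; the added 1 covers a zero coordinate. *)
have e3 : 0 < eps / 2 / (`|ecoord j d| + 1) by rewrite divr_gt0// ltr_wpDl.
have [del2 del20 d2] := gpC j w Hw _ e3.
pose B := \sum_k `|ecoord k d| + 1.
have B0 : 0 < B by rewrite ltr_wpDl// sumr_ge0.
exists (Num.min (Num.min del1 (del2 / B)) (Num.min (- a) b)).
  by rewrite !lt_min del10 oppr_gt0 a0 b0 !andbT/= divr_gt0.
move=> t; rewrite !lt_min => /andP[/andP[td1 td2] /andP[ta tb]].
have tab : a < t < b by move: ta tb; rewrite !ltr_norml opprK => /andP[-> _] /andP[_ ->].
rewrite !big_cons -/(D s).
have -> : w + t *: (ecoord j d *: energy_vec R j + D s) =
    (w + t *: D s) + (t * ecoord j d) *: energy_vec R j.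
  by rewrite scalerDr scalerA [_ + t *: D s]addrC addrA.
have Hs1 : H (w + t *: D s) by exact: HD.
have Hs2 : H (w + t *: D s + (t * ecoord j d) *: energy_vec R j).
  have := @HD (j :: s) t _ tab; rewrite /= js us => /(_ isT).
  by rewrite /D big_cons scalerDr scalerA [_ *: _ + t *: _]addrC addrA.
have [th th01 E] := MVT_coord gC Hs1 Hs2.
set p := w + t *: D s + (th * _) *: _ in E.
have pw : `|epartial j g p - epartial j g w| < eps / 2 / (`|ecoord j d| + 1).
  apply: d2.
    by rewrite /p -scalerA; apply: half_space_segment => //; case/andP: th01.
  move=> k; rewrite /p 2!ecoordD !ecoordZ ecoord_vec DE//.
  move: td2; rewrite ltr_pdivlMr//; apply: le_lt_trans.
  have -> : ecoord k w + t * (if k \in s then ecoord k d else 0) + th * (t * ecoord j d) * (k == j)%:R - ecoord k w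
     = t * (th * ecoord j d * (k == j)%:R + (if k \in s then ecoord k d else 0)) by ring.
  rewrite normrM ler_wpM2l//.
  have kB : `|ecoord k d| <= B.
    by rewrite /B (bigD1 k)//= -addrA lerDl addr_ge0// sumr_ge0.
  have [kj|kj] := eqVneq k j.
    rewrite kj (negbTE js) addr0 mulr1 normrM.
    rewrite (le_trans _ kB)// kj ler_piMl//.
    by case/andP: th01 => th0 th1; rewrite ger0_norm.
  rewrite mulr0 add0r; case: ifP => _ //; by rewrite normr0 ltW.
have -> : g (w + t *: D s + (t * ecoord j d) *: energy_vec R j) - g w -
    t * (ecoord j d * epartial j g w + \sum_(j0 <- s) ecoord j0 d * epartial j0 g w) =
   t * ecoord j d * (epartial j g p - epartial j g w) +
   (g (w + t *: D s) - g w - t * (\sum_(j0 <- s) ecoord j0 d * epartial j0 g w)).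
  by rewrite mulrBr -E; ring.
apply: (le_trans (ler_normD _ _)).
rewrite [eps]splitr mulrDl lerD//; last exact: d1.
rewrite !normrM -mulrA mulrC ler_wpM2r//.
apply: (@le_trans _ _ (`|ecoord j d| * (eps / 2 / (`|ecoord j d| + 1)))).
  by rewrite ler_wpM2l// ltW.
rewrite mulrCA ler_piMr ?(ltW e20)// ler_pdivrMr ?ltr_wpDl// mul1r lerDl//.
Qed.

(** Chain rule from continuous partial derivatives: the first-order expansion based at [u + s *: d],
    over the complete list of coordinates. *)
Lemma is_derive_line g u d (a b s : R) : hC1 g ->
  (forall j, hcont (epartial j g)) -> a < s < b ->
  (forall t, a < t < b -> H (u + t *: d)) ->
  is_derive s 1 (fun t : R => g (u + t *: d))
    (\sum_j ecoord j d * epartial j g (u + s *: d)).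
Proof.
move=> gC gpC /andP[as_ sb] Hab.
pose w := u + s *: d.
have dE : d = \sum_j ecoord j d *: energy_vec R j.
  apply: ecoord_inj => k; rewrite ecoord_sum.
  under eq_bigr do rewrite ecoordZ ecoord_vec.
  rewrite (bigD1 k)//= eqxx mulr1 big1 ?addr0// => i ik.
  by rewrite eq_sym (negbTE ik) mulr0.
have Hw t : a - s < t < b - s -> H (w + t *: d).
  move=> /andP[? ?]; rewrite /w -addrA -scalerDl; apply: Hab.
  by apply/andP; split; lra.
have as0 : a - s < 0 by rewrite subr_lt0.
have bs0 : 0 < b - s by rewrite subr_gt0.
set L := \sum_j _.
set F := fun t : R => g _.
have cF : (fun t : R => t^-1 *: (F (t *: 1 + s) - F s)) @ 0^' --> L.
  apply/cvgrPdist_le => eps eps0.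
  have [del del0 dP] := @first_order_expansion g w d (a - s) (b - s) (index_enum _) gC gpC
    (index_enum_uniq _) as0 bs0 Hw eps eps0.
  near=> t.
  have t0 : t != 0 by near: t; exact: nbhs_dnbhs_neq.
  have /dP : `|t| < del.
    near: t; apply: nbhs_dnbhs; exact: (@nbhs0_lt R R).
  rewrite -dE -/L => tP.
  have -> : F (t *: 1 + s) = g (w + t *: d).
    by rewrite /F /w scaler1 -addrA -scalerDl [s + t]addrC.
  have -> : F s = g w by [].
  rewrite distrC -(@ler_pM2r _ `|t|) ?normr_gt0// -normrM mulrBl.
  rewrite -[_ *: _]/(_ * _) mulrAC mulVf// mul1r [L * t]mulrC//.
split; first by apply/cvg_ex; exists L.
exact/cvg_lim.
Unshelve. all: by end_near.
Qed.

(** With mean value points x1 and x2 on the two halves, f a + f b - 2 f m equals (df x2 - df x1)(b -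
    a)/2, which is positive by a third mean value argument. Derivatives are assumed only inside,
    since the ends of the segment may lie on the boundary of the half-space. *)
Lemma midpoint_strictly_convex (a b m : R) (f df ddf : R -> R) : a < b ->
  m = (a + b) / 2 -> {within `[a, b], continuous f} ->
  (forall x : R, x \in `]a, b[ -> is_derive x 1 f (df x)) ->
  (forall x : R, x \in `]a, b[ -> is_derive x 1 df (ddf x)) ->
  (forall x : R, x \in `]a, b[ -> 0 < ddf x) -> f m < (f a + f b) / 2.
Proof.
move=> ab mE fc fd dfd ddf0.
have am : a < m by lra.
have mb : m < b by lra.
have oo (c1 c2 x : R) : a <= c1 -> c2 <= b -> x \in `]c1, c2[ -> x \in `]a, b[.
  by rewrite !in_itv/= => h1 h2 /andP[h3 h4]; apply/andP; split; lra.
have cc (c1 c2 : R) : a <= c1 -> c2 <= b -> {within `[c1, c2], continuous f}.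
  move=> h1 h2; apply: continuous_subspaceW fc => x /=; rewrite !in_itv/=.
  by move=> /andP[h3 h4]; apply/andP; split; lra.
have [x1] := MVT am (fun x xP => fd x (oo _ _ _ (lexx a) (ltW mb) xP)) (cc _ _ (lexx a) (ltW mb)).
have [x2] := MVT mb (fun x xP => fd x (oo _ _ _ (ltW am) (lexx b) xP)) (cc _ _ (ltW am) (lexx b)).
rewrite !in_itv/= => /andP[x20 x21] E2 /andP[x10 x11] E1.
have x12 : x1 < x2 by lra.
have ax1 : a <= x1 by lra.
have x2b : x2 <= b by lra.
have dfc : {within `[x1, x2], continuous df}.
  apply: derivable_within_continuous => x; rewrite in_itv/= => /andP[h3 h4].
  have xab : x \in `]a, b[ by rewrite in_itv/=; apply/andP; split; lra.
  by have [] := dfd x xab.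
have [x3 x3P E3] := MVT x12 (fun x xP => dfd x (oo _ _ _ ax1 x2b xP)) dfc.
have ddf3 : 0 < ddf x3 by apply: ddf0; exact: oo x3P.
have : 0 < ddf x3 * (x2 - x1) by rewrite mulr_gt0// subr_gt0.
rewrite -E3 => E4.
have : 0 < (df x2 - df x1) * (b - a) by rewrite mulr_gt0// subr_gt0.
move: E1 E2; rewrite mE; nra.
Qed.

(** Along the segment the second derivative is the Hessian form in the nonzero direction v - u. *)
Lemma strictly_convex_midpoint g u v : C_k 3 g -> strictly_convex g ->
  H u -> H v -> u != v -> g (u + (1 / 2) *: (v - u)) < (g u + g v) / 2.
Proof.
move=> gC gconv Hu Hv uv.
have gC0 : hC1 g by exact: (@C_k_hC1 3 g [::] gC isT).
have gC1 j : hC1 (epartial j g) by exact: (@C_k_hC1 3 g [:: j] gC isT).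
have gC2 j k : hcont (epartial j (epartial k g)) by exact: (@C_k_hcont 3 g [:: j; k] gC isT).
have Huv : H (u + (v - u)) by rewrite addrC subrK.
have Hseg t : 0 < t < 1 -> H (u + t *: (v - u)).
  by move=> /andP[t0 t1]; apply: half_space_segment => //; exact: ltW.
have := @midpoint_strictly_convex 0 1 (1 / 2) (fun t => g (u + t *: (v - u)))
  (fun t => \sum_j ecoord j (v - u) * epartial j g (u + t *: (v - u)))
  (fun t => \sum_j ecoord j (v - u) * \sum_k ecoord k (v - u) * epartial k (epartial j g) (u + t *: (v - u))).
rewrite scale0r addr0 scale1r [u + (v - u)]addrC subrK; apply.
- exact: ltr01.
- by rewrite add0r.
- apply: hcont_line_within; first exact: gC0.1.
  by move=> t; rewrite in_itv/= => /andP[t0 t1]; exact: half_space_segment.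
- move=> x; rewrite in_itv/= => x01; apply: (@is_derive_line g u (v - u) 0 1) => // j.
  exact: (gC1 j).1.
- move=> x; rewrite in_itv/= => x01.
  have dj j : is_derive x 1 (fun t : R => ecoord j (v - u) * epartial j g (u + t *: (v - u)))
      (ecoord j (v - u) * \sum_k ecoord k (v - u) * epartial k (epartial j g) (u + x *: (v - u))).
    apply: (@is_deriveZ _ _ _ _ (ecoord j (v - u))).
    by apply: (@is_derive_line _ u (v - u) 0 1).
  have -> : (fun t : R => \sum_j ecoord j (v - u) * epartial j g (u + t *: (v - u))) =
     \sum_j (fun t : R => ecoord j (v - u) * epartial j g (u + t *: (v - u))).
    by apply/funext => t; rewrite fct_sumE.
  elim/big_ind2: _ => [|*|j _]; [exact: is_derive_cst|exact: is_deriveD|exact: dj].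
- move=> x; rewrite in_itv/= => x01.
  have ex : exists j, ecoord j (v - u) != 0.
    apply: contrapT => /forallNP c0; move/eqP: uv; apply; apply: ecoord_inj => j.
    have /negP := c0 j; rewrite negbK ecoordB subr_eq0 => /eqP ->//.
  have := gconv (u + x *: (v - u)) (Hseg _ x01) (ecoord^~ (v - u)) ex.
  rewrite exchange_big/= => E; rewrite [ltRHS](_ : _ = \sum_j \sum_i
    epartial i (epartial j g) (u + x *: (v - u)) * ecoord i (v - u) * ecoord j (v - u))//.
  by apply: eq_bigr => j _; rewrite mulr_sumr; apply: eq_bigr => k _; ring.
Qed.

End half_space_calculus.

(** * Test functions and the torus measure *)

Section test_functions.
Variable R : realType.
Local Notation X := (space3 R).
Implicit Types (f g : X -> R) (a b : 'I_3).

(** Smoothness up to order n. A derivative of a product is a sum of products with one order less to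
    check, so closure under products is an induction on n. *)
Definition test_level (n : nat) f := forall s : seq 'I_3, (size s <= n)%N ->
  let g := foldr (@spartial R) f s in
  continuous g /\ forall a (x : X), derivable g x (unit_vec R a).

Lemma spartialD a f g : (forall x, derivable f x (unit_vec R a)) ->
  (forall x, derivable g x (unit_vec R a)) ->
  spartial a (fun x => f x + g x) = (fun x => spartial a f x + spartial a g x).
Proof. by move=> df dg; apply/funext => x; exact: deriveD. Qed.

Lemma spartialM a f g : (forall x, derivable f x (unit_vec R a)) ->
  (forall x, derivable g x (unit_vec R a)) ->
  spartial a (fun x => f x * g x) = (fun x => f x * spartial a g x + g x * spartial a f x).
Proof. by move=> df dg; apply/funext => x; exact: deriveM. Qed.

Lemma spartialZ a (c : R) f : (forall x, derivable f x (unit_vec R a)) ->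
  spartial a (fun x => c * f x) = (fun x => c * spartial a f x).
Proof. by move=> df; apply/funext => x; exact: (@deriveZ _ _ _ f c). Qed.

Lemma spartial_cst a (c : R) : spartial a (fun=> c) = fun=> 0.
Proof. by apply/funext => x; exact: derive_cst. Qed.

Lemma test_level_derivable n f a x : test_level n f -> derivable f x (unit_vec R a).
Proof. by move=> /(_ [::] (leq0n _))[_]; exact. Qed.

Lemma test_level_le m n f : (m <= n)%N -> test_level n f -> test_level m f.
Proof. by move=> mn fn s sm; apply: fn; exact: leq_trans mn. Qed.

Lemma test_levelS n f a : test_level n.+1 f -> test_level n (spartial a f).
Proof.
move=> fn s sn; have := fn (rcons s a).
by rewrite foldr_rcons size_rcons; exact.
Qed.

Lemma test_levelD n f g : test_level n f -> test_level n g ->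
  test_level n (fun x => f x + g x).
Proof.
elim/ltn_ind: n f g => n ih f g fn gn.
(* [last_ind] peels off the innermost derivative, the one applied to the sum itself. *)
move=> s; elim/last_ind: s => [_ /=|s a _]; last first.
  rewrite size_rcons foldr_rcons => sn.
  rewrite spartialD; [|by move=> x; exact: test_level_derivable fn|by move=> x; exact: test_level_derivable gn].
  case: n => [|n] // in ih fn gn sn *.
  by apply: (ih n) => //; exact: test_levelS.
split.
  move=> x; apply: continuousD; [exact: (fn [::] (leq0n _)).1|exact: (gn [::] (leq0n _)).1].
by move=> a x; apply: derivableD; [exact: test_level_derivable fn|exact: test_level_derivable gn].
Qed.

Lemma test_levelM n f g : test_level n f -> test_level n g ->
  test_level n (fun x => f x * g x).
Proof.
elim/ltn_ind: n f g => n ih f g fn gn.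
move=> s; elim/last_ind: s => [_ /=|s a _]; last first.
  rewrite size_rcons foldr_rcons => sn.
  rewrite spartialM; [|by move=> x; exact: test_level_derivable fn|by move=> x; exact: test_level_derivable gn].
  case: n => [|n] // in ih fn gn sn *.
  apply: (@test_levelD n) => //; apply: (ih n) => //.
  - exact: test_level_le fn.
  - exact: test_levelS.
  - exact: test_level_le gn.
  - exact: test_levelS.
split.
  move=> x; apply: continuousM; [exact: (fn [::] (leq0n _)).1|exact: (gn [::] (leq0n _)).1].
by move=> a x; apply: derivableM; [exact: test_level_derivable fn|exact: test_level_derivable gn].
Qed.

Lemma test_functionP f : test_function f <->
  (forall a x, f (x + unit_vec R a) = f x) /\ (forall n, test_level n f).
Proof.
split=> [[pf ff]|[pf ff]]; first by split => // n s _; exact: ff.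
by split => // s; exact: (ff (size s)).
Qed.

Lemma test_continuous f : test_function f -> continuous f.
Proof. by move=> [_ /(_ [::])[]]. Qed.

Lemma test_derivable f a x : test_function f -> derivable f x (unit_vec R a).
Proof. by move=> [_ /(_ [::])[_]]; exact. Qed.

Lemma test_functionM f g : test_function f -> test_function g ->
  test_function (fun x => f x * g x).
Proof.
move=> /test_functionP[pf ff] /test_functionP[pg gg]; apply/test_functionP; split.
  by move=> a x; rewrite pf pg.
by move=> n; exact: test_levelM.
Qed.

Lemma test_spartial f a : test_function f -> test_function (spartial a f).
Proof.
move=> /[dup] tf /test_functionP[pf ff]; apply/test_functionP; split; last first.
  by move=> n; exact: test_levelS.
move=> b x; rewrite /spartial /derive.
set F := (fun h : R => _); rewrite (_ : F = (fun h : R =>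
  h^-1 *: ((f \o shift x) (h *: unit_vec R a) - f x)))//.
by apply/funext => h; rewrite /F /= addrA; congr (_ *: (_ - _)); exact: pf.
Qed.

Definition crd a (x : X) : R := if a == 0 then x.1.1 else if a == 1 then x.1.2 else x.2.

Lemma crdD a x y : crd a (x + y) = crd a x + crd a y.
Proof. by rewrite /crd; case: ifP => // _; case: ifP. Qed.

Lemma crdZ a (t : R) x : crd a (t *: x) = t * crd a x.
Proof. by rewrite /crd; case: ifP => // _; case: ifP. Qed.

Lemma crd_unit a b : crd a (unit_vec R b) = (a == b)%:R.
Proof.
rewrite /crd /unit_vec /=; move: a b.
by do 2 (case; case=> [|[|[|//]]] ?).
Qed.

Lemma crd_continuous a : continuous (crd a).
Proof.
move=> x; rewrite /crd; case: (a == 0); last case: (a == 1).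
- apply: (@continuous_comp _ _ _ fst fst); exact: cvg_fst.
- by apply: (@continuous_comp _ _ _ fst snd); [exact: cvg_fst|exact: cvg_snd].
- exact: cvg_snd.
Qed.

Lemma is_derive_crd (phi : R -> R) (dphi : R) a b x : is_derive (crd a x) 1 phi dphi ->
  is_derive x (unit_vec R b) (phi \o crd a) ((a == b)%:R * dphi).
Proof.
move=> [dp pE]; set u := unit_vec R b.
have E : (fun h : R => h^-1 *: (((phi \o crd a) \o shift x) (h *: u) - (phi \o crd a) x))
   = (fun h : R => h^-1 *: ((phi \o shift (crd a x)) (h *: (a == b)%:R) - phi (crd a x))).
  by apply/funext => h /=; rewrite crdD crdZ crd_unit.
move: E; case: (a == b) => E; last first.
  have E0 : (fun h : R => h^-1 *: ((phi \o shift (crd a x)) (h *: 0%:R) - phi (crd a x))) = fun=> 0.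
    by apply/funext => h /=; rewrite scaler0 add0r subrr scaler0.
  rewrite mul0r; split; rewrite /derivable /derive E E0.
    by apply/cvg_ex; exists 0; exact: cvg_cst.
  by apply/cvg_lim => //; exact: cvg_cst.
rewrite mul1r; split; rewrite /derivable /derive E//.
Qed.

Definition tcos a (x : X) : R := cos ((pi *+ 2) * crd a x).
Definition tsin a (x : X) : R := sin ((pi *+ 2) * crd a x).

Lemma is_derive_tcos a b x :
  is_derive x (unit_vec R b) (tcos a) (- (a == b)%:R * (pi *+ 2) * tsin a x).
Proof.
have -> : - (a == b)%:R * (pi *+ 2) * tsin a x = (a == b)%:R * (- (pi *+ 2) * tsin a x) by ring.
apply: (@is_derive_crd (fun t => cos ((pi *+ 2) * t))).
apply: is_derive_eq; rewrite /tsin scaler1.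
by rewrite !mulNr mulrC.
Qed.

Lemma is_derive_tsin a b x :
  is_derive x (unit_vec R b) (tsin a) ((a == b)%:R * (pi *+ 2) * tcos a x).
Proof.
rewrite -mulrA.
apply: (@is_derive_crd (fun t => sin ((pi *+ 2) * t))).
apply: is_derive_eq; rewrite /tcos scaler1.
by rewrite mulrC.
Qed.

Lemma spartial_tcos b a : spartial b (tcos a) = fun x => - (a == b)%:R * (pi *+ 2) * tsin a x.
Proof. by apply/funext => x; have [] := is_derive_tcos a b x. Qed.

Lemma spartial_tsin b a : spartial b (tsin a) = fun x => (a == b)%:R * (pi *+ 2) * tcos a x.
Proof. by apply/funext => x; have [] := is_derive_tsin a b x. Qed.

(** The algebra generated by the cos (2 pi x_a) and sin (2 pi x_a), given by its syntax:
    periodicity, smoothness and commutation of derivatives are inductions on it. *)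
Inductive trig : (X -> R) -> Prop :=
| trig_cst c : trig (fun=> c)
| trig_cos a : trig (tcos a)
| trig_sin a : trig (tsin a)
| trigD f g : trig f -> trig g -> trig (fun x => f x + g x)
| trigM f g : trig f -> trig g -> trig (fun x => f x * g x).

Lemma trig_derivable f : trig f -> forall a x, derivable f x (unit_vec R a).
Proof.
elim=> [c a x|a b x|a b x|{}f g _ df _ dg a x|{}f g _ df _ dg a x].
- exact: derivable_cst.
- by have [] := is_derive_tcos a b x.
- by have [] := is_derive_tsin a b x.
- exact: derivableD.
- exact: derivableM.
Qed.

Lemma trig_spartialD a f g : trig f -> trig g ->
  spartial a (fun x => f x + g x) = (fun x => spartial a f x + spartial a g x).
Proof. by move=> tf tg; apply: spartialD; exact: trig_derivable. Qed.

Lemma trig_spartialM a f g : trig f -> trig g ->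
  spartial a (fun x => f x * g x) = (fun x => f x * spartial a g x + g x * spartial a f x).
Proof. by move=> tf tg; apply: spartialM; exact: trig_derivable. Qed.

Lemma trig_spartial f a : trig f -> trig (spartial a f).
Proof.
elim=> [c|b|b|{}f g tf tdf tg tdg|{}f g tf tdf tg tdg].
- rewrite spartial_cst; exact: trig_cst.
- by rewrite spartial_tcos; apply: (trigM (trig_cst _)); exact: trig_sin.
- by rewrite spartial_tsin; apply: (trigM (trig_cst _)); exact: trig_cos.
- by rewrite spartialD; [exact: trigD|exact: trig_derivable|exact: trig_derivable].
- by rewrite spartialM; [apply: trigD; exact: trigM|exact: trig_derivable|exact: trig_derivable].
Qed.

Lemma trig_continuous f : trig f -> continuous f.
Proof.
elim=> [c|a|a|{}f g _ cf _ cg|{}f g _ cf _ cg] x.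
- exact: cst_continuous.
- apply: (@continuous_comp _ _ _ (fun x => (pi *+ 2) * crd a x) cos).
    by apply: cvgMr; exact: crd_continuous.
  exact: continuous_cos.
- apply: (@continuous_comp _ _ _ (fun x => (pi *+ 2) * crd a x) sin).
    by apply: cvgMr; exact: crd_continuous.
  exact: continuous_sin.
- by apply: continuousD; [exact: cf|exact: cg].
- by apply: continuousM; [exact: cf|exact: cg].
Qed.

Lemma trig_periodic f : trig f -> forall a x, f (x + unit_vec R a) = f x.
Proof.
have E a b x : (pi *+ 2) * crd a (x + unit_vec R b) = (pi *+ 2) * crd a x + (pi *+ 2) *+ (a == b) :> R.
  by rewrite crdD crd_unit mulrDr mulr_natr.
elim=> [c|a|a|{}f g _ pf _ pg|{}f g _ pf _ pg] b x //.
- by rewrite /tcos E; case: (a == b); rewrite ?mulr1n ?cosD2pi// mulr0n addr0.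
- by rewrite /tsin E; case: (a == b); rewrite ?mulr1n ?sinD2pi// mulr0n addr0.
- by rewrite pf pg.
- by rewrite pf pg.
Qed.

Lemma trig_test f : trig f -> test_function f.
Proof.
move=> tf; split; first exact: trig_periodic.
move=> s; have ts : trig (foldr (@spartial R) f s).
  by elim: s => //= a s; exact: trig_spartial.
by split; [exact: trig_continuous|exact: trig_derivable].
Qed.

Lemma trig_spartialC f a b : trig f -> spartial a (spartial b f) = spartial b (spartial a f).
Proof.
elim=> [c|c|c|{}f g tf tdf tg tdg|{}f g tf tdf tg tdg].
- by rewrite !spartial_cst.
- have dsin x k : derivable (tsin c) x (unit_vec R k) by have [] := is_derive_tsin c k x.
  rewrite !spartial_tcos; do 2 (rewrite (@spartialZ _ _ (tsin c)); last by []).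
  by rewrite !spartial_tsin; apply/funext => x; ring.
- have dcos x k : derivable (tcos c) x (unit_vec R k) by have [] := is_derive_tcos c k x.
  rewrite !spartial_tsin; do 2 (rewrite (@spartialZ _ _ (tcos c)); last by []).
  by rewrite !spartial_tcos; apply/funext => x; ring.
- rewrite !(trig_spartialD _ tf tg).
  by rewrite !(trig_spartialD _ (trig_spartial _ tf) (trig_spartial _ tg)) tdf tdg.
- rewrite !(trig_spartialM _ tf tg).
  have ts c h := trig_spartial c h.
  rewrite !(trig_spartialD _ (trigM tf (ts _ _ tg)) (trigM tg (ts _ _ tf))).
  rewrite !(trig_spartialM _ tf (ts _ _ tg)) !(trig_spartialM _ tg (ts _ _ tf)) tdf tdg.
  apply/funext => x; move: (spartial b (spartial a g) x) (spartial b (spartial a f) x)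
    (spartial b g x) (spartial a f x) (spartial b f x) (spartial a g x) => *; ring.
Qed.

(** The generator is cos (2 pi (x_a - z_a)) expanded by the addition formula: these kernels are
    functions of x - z, which is what [conv_spartial] exploits. *)
Inductive conv_kernel : (X -> X -> R) -> Prop :=
| conv_cst c : conv_kernel (fun _ _ => c)
| conv_cos a : conv_kernel (fun x z => tcos a x * tcos a z + tsin a x * tsin a z)
| convD k l : conv_kernel k -> conv_kernel l -> conv_kernel (fun x z => k x z + l x z)
| convM k l : conv_kernel k -> conv_kernel l -> conv_kernel (fun x z => k x z * l x z).

Lemma conv_trigl k z : conv_kernel k -> trig (k ^~ z).
Proof.
elim=> [c|a|{}k l _ tk _ tl|{}k l _ tk _ tl].
- exact: trig_cst.
- apply: trigD.
    by apply: (@trigM (tcos a) (fun=> tcos a z)); [exact: trig_cos|exact: trig_cst].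
  by apply: (@trigM (tsin a) (fun=> tsin a z)); [exact: trig_sin|exact: trig_cst].
- exact: (trigD tk tl).
- exact: (trigM tk tl).
Qed.

Lemma conv_trigr k x : conv_kernel k -> trig (k x).
Proof.
elim=> [c|a|{}k l _ tk _ tl|{}k l _ tk _ tl].
- exact: trig_cst.
- apply: trigD.
    by apply: (@trigM (fun=> tcos a x) (tcos a)); [exact: trig_cst|exact: trig_cos].
  by apply: (@trigM (fun=> tsin a x) (tsin a)); [exact: trig_cst|exact: trig_sin].
- exact: (trigD tk tl).
- exact: (trigM tk tl).
Qed.

Lemma conv_spartial k : conv_kernel k -> forall a x z,
  spartial a (k ^~ z) x = - spartial a (k x) z.
Proof.
elim=> [c a x z|a b x z|{}k l ck dk cl dl a x z|{}k l ck dk cl dl a x z].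
- by rewrite !spartial_cst oppr0.
- have tc (c : R) : trig (fun=> c) by exact: trig_cst.
  rewrite (trig_spartialD _ (trigM (trig_cos a) (tc (tcos a z))) (trigM (trig_sin a) (tc (tsin a z)))).
  rewrite (trig_spartialD _ (trigM (tc (tcos a x)) (trig_cos a)) (trigM (tc (tsin a x)) (trig_sin a))).
  rewrite (trig_spartialM _ (trig_cos a) (tc _)) (trig_spartialM _ (trig_sin a) (tc _)).
  rewrite (trig_spartialM _ (tc _) (trig_cos a)) (trig_spartialM _ (tc _) (trig_sin a)).
  by rewrite !spartial_cst spartial_tcos spartial_tsin; ring.
- rewrite (trig_spartialD _ (conv_trigl z ck) (conv_trigl z cl)).
  by rewrite (trig_spartialD _ (conv_trigr x ck) (conv_trigr x cl)) dk dl opprD.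
- rewrite (trig_spartialM _ (conv_trigl z ck) (conv_trigl z cl)).
  by rewrite (trig_spartialM _ (conv_trigr x ck) (conv_trigr x cl)) dk dl; ring.
Qed.

(** Finite sums of products: the integral operator with such a kernel has finite rank, and its
    values on integrable functions are trigonometric polynomials. *)
Inductive separable_kernel : (X -> X -> R) -> Prop :=
| sep_prod p q : trig p -> trig q -> separable_kernel (fun x z => p x * q z)
| sepD k l : separable_kernel k -> separable_kernel l ->
    separable_kernel (fun x z => k x z + l x z).

Lemma separable_kernel_ext k l : (forall x z, k x z = l x z) ->
  separable_kernel k -> separable_kernel l.
Proof. by move=> kl; have -> : k = l by apply/funext => x; apply/funext => z. Qed.

Lemma sepM k l : separable_kernel k -> separable_kernel l ->
  separable_kernel (fun x z => k x z * l x z).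
Proof.
move=> sk sl; elim: sk => [p q tp tq|k1 k2 _ h1 _ h2]; last first.
  by apply: separable_kernel_ext (sepD h1 h2) => x z; rewrite mulrDl.
elim: sl => [p' q' tp' tq'|l1 l2 _ h1 _ h2]; last first.
  by apply: separable_kernel_ext (sepD h1 h2) => x z; rewrite mulrDr.
apply: separable_kernel_ext (sep_prod (trigM tp tp') (trigM tq tq')) => x z.
by rewrite mulrACA.
Qed.

Lemma conv_separable k : conv_kernel k -> separable_kernel k.
Proof.
elim=> [c|a|{}k l _ sk _ sl|{}k l _ sk _ sl].
- apply: separable_kernel_ext (sep_prod (trig_cst c) (trig_cst 1)) => x z.
  by rewrite mulr1.
- exact: (sepD (sep_prod (trig_cos a) (trig_cos a)) (sep_prod (trig_sin a) (trig_sin a))).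
- exact: sepD.
- exact: sepM.
Qed.

End test_functions.

(* The library's product of two finite measures is not canonically finite. *)
Section finite_product.
Context d1 d2 (T1 : measurableType d1) (T2 : measurableType d2) (R : realType).
Variable m1 : {finite_measure set T1 -> \bar R}.
Variable m2 : {finite_measure set T2 -> \bar R}.

Definition finite_product := (m1 \x m2)%E.

HB.instance Definition _ := Measure.on finite_product.

Lemma finite_productX (B : set T1) (C : set T2) : measurable B -> measurable C ->
  finite_product (B `*` C) = (m1 B * m2 C)%E.
Proof. exact: product_measure1E. Qed.

Let finite_product_fin : fin_num_fun finite_product.
Proof.
move=> A mA; rewrite ge0_fin_numE ?measure_ge0//.
rewrite (@le_lt_trans _ _ (finite_product (setT `*` setT)))//.
  by rewrite le_measure// inE//; exact: measurableX.
by rewrite finite_productX// lte_mul_pinfty// ?fin_num_measure// -ge0_fin_numE// fin_num_measure.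
Qed.

HB.instance Definition _ := Measure_isFinite.Build _ _ _ finite_product finite_product_fin.

End finite_product.

(** * The torus measure as a product of finite measures *)

Section torus_measure.
Variable R : realType.
Local Notation X := (mspace3 R).
Local Notation mu := (@torus_measure R).
Local Notation I01 := (`[0, 1]%classic : set (measurableTypeR R)).

Lemma measurable_I01 : measurable I01.
Proof. exact: measurable_itv. Qed.

Lemma I01_lty : (@lebesgue_measure R I01 < +oo)%E.
Proof. by rewrite lebesgue_measure_itv/= lte_fin ltr01 -EFinB ltry. Qed.

(** Restricting each factor first gives a product of finite measures, the form suited to Fubini's
    theorem; uniqueness of product measures identifies it with the restricted product that defines
    the torus measure. *)
Definition unit_measure : {finite_measure set (measurableTypeR R) -> \bar R} :=
  mfrestr measurable_I01 I01_lty.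
Local Notation nu := unit_measure.

Definition unit_measure2 :
    {finite_measure set (measurableTypeR R * measurableTypeR R)%type -> \bar R} :=
  finite_product nu nu.

Definition unit_measure3 : {finite_measure set X -> \bar R} :=
  finite_product unit_measure2 nu.

Lemma unit_measure2X (B C : set (measurableTypeR R)) : measurable B -> measurable C ->
  unit_measure2 (B `*` C) = (nu B * nu C)%E.
Proof. exact: finite_productX. Qed.

Lemma unit_measureT : nu setT = 1%E.
Proof.
rewrite /= /mfrestr /mrestr setTI lebesgue_measure_itv/= lte_fin ltr01.
by rewrite oppr0 adde0.
Qed.

Lemma unit_measure2T : unit_measure2 setT = 1%E.
Proof.
rewrite -setXTT unit_measure2X//.
have -> : nu [set: _] = 1%E by exact: unit_measureT.
by rewrite mule1.
Qed.

Lemma measurable_I01X : measurable (I01 `*` I01).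
Proof. by apply: measurableX; exact: measurable_I01. Qed.

Lemma unit_measure2E (A : set (measurableTypeR R * measurableTypeR R)) :
  measurable A -> unit_measure2 A =
  (@lebesgue_measure R \x @lebesgue_measure R)%E (A `&` (I01 `*` I01)).
Proof.
apply: (@product_measure_unique _ _ _ _ _ nu nu
  (mrestr (@lebesgue_measure R \x @lebesgue_measure R)%E measurable_I01X)).
move=> B C mB mC; rewrite [LHS]/((_ \x _)%E _) -setXI; apply: product_measure1E.
  by apply: measurableI => //; exact: measurable_I01.
by apply: measurableI => //; exact: measurable_I01.
Qed.

Lemma torus_measureX (B : set (measurableTypeR R * measurableTypeR R))
    (C : set (measurableTypeR R)) : measurable B -> measurable C ->
  mu (B `*` C) = (unit_measure2 B * nu C)%E.
Proof.
move=> mB mC; rewrite unit_measure2E//.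
rewrite [LHS]/((_ \x _)%E _) /unit_cube -setXI.
apply: (@product_measure1E _ _ _ _ _ (@lebesgue_measure R \x @lebesgue_measure R)%E
  (@lebesgue_measure R)).
  apply: measurableI => //; apply: measurableX; exact: measurable_I01.
by apply: measurableI => //; exact: measurable_I01.
Qed.

Lemma torus_measureE (A : set X) : measurable A -> unit_measure3 A = mu A.
Proof.
exact: (@product_measure_unique _ _ _ _ _ unit_measure2 nu mu torus_measureX A).
Qed.

Lemma torus_integralE (f : X -> \bar R) :
  (\int[mu]_x f x = \int[unit_measure3]_x f x)%E.
Proof. by apply: eq_measure_integral => A mA _; exact/esym/torus_measureE. Qed.

Lemma torus_measureT : mu setT = 1%E.
Proof.
rewrite -setXTT torus_measureX// unit_measure2T mul1e; exact: unit_measureT.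
Qed.

Lemma torus_lty : (mu setT < +oo)%E.
Proof. by rewrite torus_measureT ltry. Qed.

Lemma Rint_torus_cst (c : R) : \int[mu]_x c = c.
Proof.
rewrite /Rintegral (integral_cst mu measurableT c%:E) torus_measureT mule1//.
Qed.

Lemma ge0_unit_integralE (f : R -> \bar R) : measurable_fun setT f -> (forall t, 0 <= f t)%E ->
  (\int[nu]_t f t = \int[lebesgue_measure]_(t in I01) f t)%E.
Proof.
move=> mf f0.
rewrite (ge0_negligible_integral (N := ~` I01))//.
- rewrite setTD setCK; apply: eq_measure_integral => A mA AI.
  by rewrite /= /mfrestr /mrestr setIidl.
- apply: measurableC; exact: measurable_I01.
- by rewrite /= /mfrestr /mrestr setICl measure0.
Qed.

Lemma unit_integralE (f : R -> \bar R) : measurable_fun setT f ->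
  (\int[nu]_t f t = \int[lebesgue_measure]_(t in I01) f t)%E.
Proof.
move=> mf; rewrite integralE [RHS]integralE.
by rewrite !ge0_unit_integralE//; [exact: measurable_funeneg|exact: measurable_funepos].
Qed.

End torus_measure.

(** * Test functions on the torus and integration by parts *)

Section torus_calculus.
Variable R : realType.
Local Notation X := (mspace3 R).
Local Notation mu := (@torus_measure R).
Local Notation nu := (@unit_measure R).
Implicit Types (f g u phi : space3 R -> R) (a b : 'I_3).

Lemma measurable_crd a : measurable_fun [set: X] (crd a : X -> R).
Proof.
rewrite (_ : crd a = if a == 0 then fst \o fst else if a == 1 then snd \o fst else snd); last first.
  by apply/funext => x; rewrite /crd; case: ifP => // _; case: ifP.
by case: ifP => _; [|case: ifP => _]; [apply: measurableT_comp|apply: measurableT_comp|].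
Qed.

Lemma ord3P (P : 'I_3 -> Prop) : P 0 -> P 1 -> P 2 -> forall a, P a.
Proof.
move=> h0 h1 h2; case=> [[|[|[|//]]] i3].
- by move: h0; congr P; apply/val_inj.
- by move: h1; congr P; apply/val_inj.
- by move: h2; congr P; apply/val_inj.
Qed.

Lemma continuous_measurable3 phi : continuous phi -> measurable_fun [set: X] (phi : X -> R).
Proof.
move=> cphi.
pose G (v : 'I_3 -> R) := phi (v 0, v 1, v 2).
have -> : phi = (fun x : X => G (fun a => crd a x)).
  by apply/funext => -[[x0 x1] x2].
apply: (@measurable_comp_continuous _ _ _ _ setT) => //.
  exact: measurable_crd.
move=> v _ eps eps0.
have /cvgrPdist_lt/(_ eps eps0)/nbhs_ballP[del /= del0 dP] := cphi (v 0, v 1, v 2).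
exists del => // v' _ vv'; rewrite distrC; apply: dP.
by split; [split|] => /=; rewrite /ball/= distrC.
Qed.

Lemma test_measurable phi : test_function phi -> measurable_fun [set: X] (phi : X -> R).
Proof. by move=> /test_continuous; exact: continuous_measurable3. Qed.

Lemma trig_measurable phi : trig phi -> measurable_fun [set: X] (phi : X -> R).
Proof. by move=> /trig_continuous; exact: continuous_measurable3. Qed.

Lemma periodic_int phi a (x : space3 R) (n : int) :
  (forall x, phi (x + unit_vec R a) = phi x) -> phi (x + n%:~R *: unit_vec R a) = phi x.
Proof.
move=> pphi.
have H (y : space3 R) (m : nat) : phi (y + m%:R *: unit_vec R a) = phi y.
  elim: m => [|m ih]; first by rewrite scale0r addr0.
  by rewrite -natr1 scalerDl scale1r addrA pphi.
case: n => n; first by rewrite -pmulrn H.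
rewrite NegzE mulrNz scaleNr -[in RHS](subrK (n.+1%:R *: unit_vec R a) x) H.
by rewrite pmulrn.
Qed.

(** Integer translations bring every point into the closed cube, where continuity and compactness
    give the bound. *)
Lemma test_bounded phi : test_function phi -> exists M, forall x, `|phi x| <= M.
Proof.
move=> tphi; have [pphi _] := tphi.
pose Q : set (space3 R) := `[0, 1]%classic `*` `[0, 1]%classic `*` `[0, 1]%classic.
have cQ : compact Q.
  by do 2 (apply: compact_setX; last exact: segment_compact); exact: segment_compact.
have /compact_bounded[M [_ MP]] : compact (phi @` Q).
  apply: continuous_compact cQ; apply: continuous_subspaceT.
  exact: test_continuous.
exists (M + 1) => x.
pose x' : space3 R := x + (- Num.floor (crd 0 x))%:~R *: unit_vec R 0
  + (- Num.floor (crd 1 x))%:~R *: unit_vec R 1 + (- Num.floor (crd 2 x))%:~R *: unit_vec R 2.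
have -> : phi x = phi x' by rewrite /x' !periodic_int.
have cx' a : crd a x' = crd a x - (Num.floor (crd a x))%:~R.
  move: a; apply: ord3P; rewrite /x' !crdD !crdZ !crd_unit/= mulrNz; ring.
apply: MP; first by rewrite ltrDl.
exists x' => //; have H a : crd a x' \in `[0, 1].
  rewrite cx' in_itv/= subr_ge0 floor_le_tmp/= lerBlDl -[leRHS]/(_ + 1%:~R) -intrD.
  by rewrite ltW// floorD1_gt.
by split; [split|]; [exact: (H 0)|exact: (H 1)|exact: (H 2)].
Qed.

Lemma test_integ phi : test_function phi -> integ mu (phi : X -> R).
Proof.
move=> tphi; have [M phiM] := test_bounded tphi.
by apply: (integ_bounded (torus_lty R) (test_measurable tphi) phiM).
Qed.

Lemma integ_testM phi f : test_function phi -> integ mu (f : X -> R) ->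
  integ mu (fun x : X => f x * phi x).
Proof.
move=> tphi iF; have [M phiM] := test_bounded tphi.
have := integM_bounded iF (test_measurable tphi) phiM.
by apply: integ_ext => x; rewrite mulrC.
Qed.

Lemma integ_testMl phi f : test_function phi -> integ mu (f : X -> R) ->
  integ mu (fun x : X => phi x * f x).
Proof. by move=> tphi iF; apply: integ_ext (integ_testM tphi iF) => x; rewrite mulrC. Qed.

(** Written as a translation along [unit_vec R a], so that composing u with it and differentiating
    in t gives the partial derivative of index a. *)
Definition upd a (x : space3 R) (t : R) : space3 R := x + (t - crd a x) *: unit_vec R a.

Lemma updE x (t : R) : (upd 0 x t = (t, x.1.2, x.2)) * (upd 1 x t = (x.1.1, t, x.2)) *
  (upd 2 x t = (x.1, t)).
Proof.
case: x => [[x0 x1] x2]; rewrite /upd /unit_vec /crd /=.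
split; [split|].
- rewrite -[LHS]/(x0 + (t - x0) * 1, x1 + (t - x0) * 0, x2 + (t - x0) * 0).
  by congr (_, _, _); ring.
- rewrite -[LHS]/(x0 + (t - x1) * 0, x1 + (t - x1) * 1, x2 + (t - x1) * 0).
  by congr (_, _, _); ring.
- rewrite -[LHS]/(x0 + (t - x2) * 0, x1 + (t - x2) * 0, x2 + (t - x2) * 1).
  by congr (_, _, _); ring.
Qed.

Lemma is_derive_upd u a x (t : R) : (forall x, derivable u x (unit_vec R a)) ->
  is_derive t 1 (fun t : R => u (upd a x t)) (spartial a u (upd a x t)).
Proof.
move=> du; have := du (upd a x t); rewrite /spartial /derive /derivable.
pose F := fun h : R => h^-1 *: ((u \o shift (upd a x t)) (h *: unit_vec R a) - u (upd a x t)).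
rewrite -/F => cF.
have FE : (fun h : R => h^-1 *: (((fun t : R => u (upd a x t)) \o shift t) (h *: 1) - u (upd a x t))) = F.
  apply/funext => h; rewrite /F /=; congr (_ *: (u _ - _)).
  by rewrite /upd -[h%:A]/(h * 1) mulr1 [RHS]addrCA -scalerDl; congr (_ + _ *: _); ring.
by split; rewrite /derivable /derive FE.
Qed.

Lemma continuous_upd a x : continuous (upd a x).
Proof.
move=> t; apply: cvgD; first exact: cvg_cst.
by apply: cvgZl; apply: cvgB; [exact: cvg_id|exact: cvg_cst].
Qed.

Section FTC.
Variables (U dU : R -> R).
Hypothesis cdU : continuous dU.
Hypothesis dUE : forall t : R, is_derive t 1 U (dU t).

Lemma FTC_segment (s t : R) : s < t ->
  (\int[lebesgue_measure]_(x in `[s, t]) (dU x)%:E = (U t - U s)%:E)%E.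
Proof.
move=> st; rewrite EFinB; apply: (@continuous_FTC2 R dU U) => //.
- exact: continuous_subspaceT.
- have cU : continuous U.
    by move=> x; apply/differentiable_continuous/derivable1_diffP; have [] := dUE x.
  split.
  + by move=> x _; have [] := dUE x.
  + by apply: cvg_at_right_filter; exact: cU.
  + by apply: cvg_at_left_filter; exact: cU.
- by move=> x _; rewrite derive1E; have [] := dUE x.
Qed.

Lemma measurable_dU : measurable_fun setT dU.
Proof. exact: continuous_measurable_fun. Qed.

Lemma unit_FTC : (\int[nu]_t (dU t)%:E = (U 1 - U 0)%:E)%E.
Proof.
rewrite unit_integralE; last by apply/measurable_EFinP; exact: measurable_dU.
exact: FTC_segment.
Qed.

Lemma unit_FTC_abs (s t : R) : s \in `[0, 1] -> t \in `[0, 1] ->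
  (`|U t - U s|%:E <= \int[nu]_x `|dU x|%:E)%E.
Proof.
wlog st : s t / s <= t.
  move=> H s0 t0; have [st|/ltW st] := leP s t; first exact: H.
  by rewrite distrC; exact: H.
rewrite !in_itv/= => /andP[s0 s1] /andP[t0 t1].
have [->|st'] := eqVneq s t.
  by rewrite subrr normr0; apply: integral_ge0 => x _; rewrite lee_fin.
have {}st : s < t by rewrite lt_neqAle st' st.
have mdU (D : set R) : measurable_fun D dU by apply: measurable_funS measurable_dU.
rewrite -abse_EFin -FTC_segment//.
apply: (@le_trans _ _ (\int[lebesgue_measure]_(x in `[s, t]) `|(dU x)%:E|)%E).
  by apply: le_abse_integral => //; apply/measurable_EFinP; exact: mdU.
rewrite unit_integralE; last first.
  by apply/measurable_EFinP; apply: measurableT_comp => //; exact: measurable_dU.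
apply: ge0_subset_integral => //.
- by apply: measurableT_comp => //; apply/measurable_EFinP; exact: mdU.
- by move=> x; rewrite /= !in_itv/= => /andP[sx xt]; rewrite (le_trans s0)// (le_trans xt).
Qed.

End FTC.

Lemma test_upd u a x : test_function u ->
  continuous (fun t => spartial a u (upd a x t)) /\
  forall t : R, is_derive t 1 (fun t : R => u (upd a x t)) (spartial a u (upd a x t)).
Proof.
move=> tu; split=> [t|t].
  apply: (@continuous_comp _ _ _ (upd a x) (spartial a u)); first exact: continuous_upd.
  exact/test_continuous/test_spartial.
by apply: is_derive_upd => y; exact: test_derivable.
Qed.

(** Fundamental theorem of calculus between two points that differ by a period. *)
Lemma test_line_integral u a x : test_function u ->
  (\int[nu]_t (spartial a u (upd a x t))%:E = 0)%E.
Proof.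
move=> tu; have [cu du] := test_upd a x tu.
rewrite (unit_FTC cu du) (_ : upd a x 1 = upd a x 0 + unit_vec R a).
  by rewrite (proj1 tu) subrr.
by rewrite /upd -addrA -[X in _ + (_ + X)]scale1r -scalerDl; congr (_ + _ *: _); ring.
Qed.

Lemma integ_unit_bounded d (T : measurableType d) (m : {finite_measure set T -> \bar R})
    (f : T -> R) M : measurable_fun setT f -> (forall x, `|f x| <= M) -> integ m f.
Proof.
by apply: integ_bounded; rewrite -ge0_fin_numE// fin_num_measure.
Qed.

Lemma torus_iterated (f : X -> R) M : measurable_fun setT f -> (forall x, `|f x| <= M) ->
  (\int[mu]_x (f x)%:E = \int[nu]_x2 \int[unit_measure2 R]_x01 (f (x01, x2))%:E)%E
  /\ (\int[mu]_x (f x)%:E = \int[unit_measure2 R]_x01 \int[nu]_x2 (f (x01, x2))%:E)%E.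
Proof.
move=> mf fM; rewrite torus_integralE.
have iF : ((unit_measure2 R) \x nu)%E.-integrable setT (EFin \o f).
  exact: (@integ_unit_bounded _ _ (unit_measure3 R) f M).
by split; [rewrite -integral21_prod_meas1|rewrite -integral12_prod_meas1].
Qed.

Lemma unit2_iterated (f : measurableTypeR R * measurableTypeR R -> R) M :
  measurable_fun setT f -> (forall x, `|f x| <= M) ->
  (\int[unit_measure2 R]_x (f x)%:E = \int[nu]_x1 \int[nu]_x0 (f (x0, x1))%:E)%E
  /\ (\int[unit_measure2 R]_x (f x)%:E = \int[nu]_x0 \int[nu]_x1 (f (x0, x1))%:E)%E.
Proof.
move=> mf fM.
have iF : (nu \x nu)%E.-integrable setT (EFin \o f).
  exact: (@integ_unit_bounded _ _ (unit_measure2 R) f M).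
by split; [rewrite -integral21_prod_meas1|rewrite -integral12_prod_meas1].
Qed.

Lemma measurable_section2 (f : X -> R) (x2 : R) : measurable_fun setT f ->
  measurable_fun [set: measurableTypeR R * measurableTypeR R] (fun x01 => f (x01, x2)).
Proof. by move=> mf; apply: (measurableT_comp mf); exact: measurable_pair2. Qed.

(** Fubini's theorem with the variable of index a innermost, where each line integral vanishes. *)
Lemma Rint_spartial u a : test_function u -> \int[mu]_x (spartial a u x : R) = 0.
Proof.
move=> tu; have tdu := test_spartial a tu.
have mdu := test_measurable tdu; have [M duM] := test_bounded tdu.
rewrite /Rintegral; have [E1 E2] := torus_iterated mdu duM.
have m2 x2 := measurable_section2 x2 mdu.
move: a => a in tdu mdu duM E1 E2 m2 *.
have [|a2] := eqVneq a 2 => [a2|].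
  rewrite E2 integral0_eq// => x01 _.
  under eq_integral do rewrite -(updE (x01, 0) _).2.
  by rewrite -a2 test_line_integral.
rewrite E1 integral0_eq// => x2 _.
have [F1 F2] := unit2_iterated (m2 x2) (fun x => duM _).
have [a0|a0] := eqVneq a 0.
  rewrite F1 integral0_eq// => x1 _.
  under eq_integral do rewrite -(updE (0, x1, x2) _).1.1.
  by rewrite -a0 test_line_integral.
have a1 : a = 1.
  by move: a a0 a2 {tdu mdu duM E1 E2 m2 F1 F2}; apply: ord3P.
rewrite F2 integral0_eq// => x0 _.
under eq_integral do rewrite -(updE (x0, 0, x2) _).1.2.
by rewrite -a1 test_line_integral.
Qed.

Lemma test_by_parts u v a : test_function u -> test_function v ->
  \int[mu]_x (u x * spartial a v x : R) = - \int[mu]_x (v x * spartial a u x).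
Proof.
move=> tu tv; apply/eqP; rewrite -addr_eq0 -RintD.
- apply/eqP; rewrite -[RHS](Rint_spartial a (test_functionM tu tv)).
  apply: eq_Rintegral => x _.
  rewrite spartialM// => y; exact: test_derivable.
- exact/test_integ/test_functionM/test_spartial.
- exact/test_integ/test_functionM/test_spartial.
Qed.

End torus_calculus.

(** * Mollification by trigonometric polynomials *)

Import HBSimple.

Section approximate_identity.
Context d (T : measurableType d) (R : realType).
Variable m : {measure set T -> \bar R}.
Hypothesis finite_lty : (m setT < +oo)%E.
(** Tonelli's theorem is a hypothesis on [m]: the torus measure satisfies it by way of its
    identification with a product of finite measures. *)
Hypothesis tonelli_measurable : forall g : T * T -> \bar R, measurable_fun setT g ->
  (forall p, 0 <= g p)%E -> measurable_fun setT (fun x => \int[m]_z g (x, z))%E.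
Hypothesis tonelli : forall g : T * T -> \bar R, measurable_fun setT g ->
  (forall p, 0 <= g p)%E ->
  (\int[m]_x \int[m]_z g (x, z) = \int[m]_z \int[m]_x g (x, z))%E.
Variable K : nat -> T -> T -> R.

Definition kernel_op (n : nat) (f : T -> R) (x : T) : R := \int[m]_z (K n x z * f z).

Hypothesis mK : forall n, measurable_fun setT (fun p : T * T => K n p.1 p.2).
Hypothesis K_ge0 : forall n x z, 0 <= K n x z.
Hypothesis K_bounded : forall n, exists M, forall x z, K n x z <= M.
Hypothesis K_mass : forall n x, \int[m]_z K n x z = 1.
Hypothesis K_dual_mass : forall n z, \int[m]_x K n x z = 1.
Hypothesis kernel_op_measurable : forall n f, integ m f -> measurable_fun setT (kernel_op n f).

Lemma measurable_Kl n x : measurable_fun setT (K n x).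
Proof. by apply: (measurableT_comp (mK n) (pair1_measurable x)). Qed.

Lemma measurable_Kr n z : measurable_fun setT (K n ^~ z).
Proof. by apply: (measurableT_comp (mK n) (pair2_measurable z)). Qed.

Lemma integ_K n x f : integ m f -> integ m (fun z => K n x z * f z).
Proof.
have [M KM] := K_bounded n => iF; apply: (integM_bounded iF (M := M)).
  exact: measurable_Kl.
by move=> z; rewrite ger0_norm.
Qed.

Lemma kernel_opB n f g : integ m f -> integ m g ->
  kernel_op n (fun x => f x - g x) = (fun x => kernel_op n f x - kernel_op n g x).
Proof.
move=> iF ig; apply/funext => x; rewrite /kernel_op -RintB; [|exact: integ_K..].
by apply: eq_Rintegral => z _; rewrite mulrBr.
Qed.

Lemma kernel_opZ n c f : integ m f ->
  kernel_op n (fun x => c * f x) = (fun x => c * kernel_op n f x).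
Proof.
move=> iF; apply/funext => x; rewrite /kernel_op -RintZ; last exact: integ_K.
by apply: eq_Rintegral => z _; rewrite mulrCA.
Qed.

(** Once Tonelli's theorem has exchanged the integrals, the mass of the kernel in x is 1 for each
    z. *)
Lemma kernel_op_contraction n f : integ m f ->
  integ m (kernel_op n f) /\ \int[m]_x `|kernel_op n f x| <= \int[m]_x `|f x|.
Proof.
move=> iF; have mTf := kernel_op_measurable n iF.
pose g (p : T * T) : \bar R := (K n p.1 p.2 * `|f p.2|)%:E.
have mg : measurable_fun setT g.
  apply/measurable_EFinP; apply: measurable_funM; first exact: mK.
  apply: measurableT_comp => //; apply: measurableT_comp => //; exact: integ_mfun iF.
have g0 p : (0 <= g p)%E by rewrite lee_fin mulr_ge0.
have H : (\int[m]_x `|kernel_op n f x|%:E <= \int[m]_x `|f x|%:E)%E.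
  apply: (@le_trans _ _ (\int[m]_x \int[m]_z g (x, z))%E).
    apply: ge0_le_integral => //.
    - by apply/measurable_EFinP; apply: measurableT_comp.
    - exact: tonelli_measurable.
    - move=> x _; rewrite /kernel_op.
      apply: (@le_trans _ _ (\int[m]_z `|K n x z * f z|)%:E).
        by rewrite lee_fin; apply: le_norm_Rint; exact: integ_K.
      rewrite EFin_Rint; last exact/integ_norm/integ_K.
      rewrite le_eqVlt; apply/orP; left; apply/eqP; apply: eq_integral => z _.
      by rewrite /g/= normrM ger0_norm.
  rewrite tonelli//.
  rewrite le_eqVlt; apply/orP; left; apply/eqP; apply: eq_integral => z _.
  have -> : (\int[m]_x g (x, z) = \int[m]_x (`|f z| * K n x z)%:E)%E.
    by apply: eq_integral => x _; rewrite /g/= mulrC.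
  have iK : integ m (K n ^~ z).
    have [M KM] := K_bounded n.
    apply: (integ_bounded finite_lty (measurable_Kr n z) (M := M)) => x.
    by rewrite ger0_norm.
  by rewrite -EFin_Rint ?RintZ ?K_dual_mass ?mulr1//; exact: integZ.
have iTf : integ m (kernel_op n f).
  have : integ m (fun x => `|kernel_op n f x|).
    apply: lty_integ => //; first exact: measurableT_comp.
    rewrite (le_lt_trans H)//; apply: integ_lty => //; exact: integ_norm.
  by apply: integ_le.
split => //; rewrite -lee_fin !EFin_Rint//; exact: integ_norm.
Qed.

Definition approximable f := integ m f /\
  (fun n => \int[m]_x `|kernel_op n f x - f x|) @ \oo --> 0.

Lemma integ_kernel_diff n f : integ m f -> integ m (fun x => `|kernel_op n f x - f x|).
Proof. by move=> iF; apply/integ_norm/integB => //; exact: (kernel_op_contraction n iF).1. Qed.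

(** A three-epsilon argument: the contraction bounds the image of f - g uniformly in n. *)
Lemma approximable_lim f : integ m f ->
  (forall eps, 0 < eps -> exists2 g, approximable g & \int[m]_x `|f x - g x| <= eps) ->
  approximable f.
Proof.
move=> iF fg; split => //; apply/cvgr0Pnorm_le => eps eps0.
have e3 : 0 < eps / 3 by rewrite divr_gt0.
have [g [ig gc] gP] := fg _ e3.
have /cvgr0Pnorm_le/(_ _ e3) H := gc.
near=> n.
have -> : `|\int[m]_x `|kernel_op n f x - f x| | = \int[m]_x `|kernel_op n f x - f x|.
  by rewrite ger0_norm//; apply: Rintegral_ge0.
have iFg : integ m (fun x => f x - g x) by exact: integB.
have [iT Tc] := kernel_op_contraction n iFg.
apply: (@le_trans _ _ (\int[m]_x (`|kernel_op n (fun x => f x - g x) x| +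
    `|kernel_op n g x - g x| + `|f x - g x|))).
  apply: le_Rint.
  - exact: integ_kernel_diff.
  - by apply: integD; [apply: integD; [exact: integ_norm|exact: integ_kernel_diff]|exact: integ_norm].
  - move=> x; rewrite kernel_opB//.
    rewrite (_ : kernel_op n f x - f x = (kernel_op n f x - kernel_op n g x) + (kernel_op n g x - g x) - (f x - g x)); last ring.
    by rewrite (le_trans (ler_normB _ _))// lerD2r ler_normD.
rewrite RintD; [|by apply: integD; [exact: integ_norm|exact: integ_kernel_diff]|exact: integ_norm].
rewrite RintD; [|exact: integ_norm|exact: integ_kernel_diff].
have : \int[m]_x `|kernel_op n g x - g x| <= eps / 3.
  by rewrite (le_trans (ler_norm _))//; near: n.
move: Tc gP; set A1 := \int[m]_x _; set A2 := \int[m]_x _; set A3 := \int[m]_x _; lra.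
Unshelve. all: by end_near.
Qed.

Lemma approximableB f g : approximable f -> approximable g ->
  approximable (fun x => f x - g x).
Proof.
move=> [iF fc] [ig gc]; split; first exact: integB.
have H : (fun n => \int[m]_x `|kernel_op n f x - f x| + \int[m]_x `|kernel_op n g x - g x|)
    @ \oo --> 0 by rewrite -[X in _ --> X](addr0 0); exact: cvgD.
apply: (@squeeze_cvgr _ _ _ _ (cst 0) _ _ _ _ _ H).
  apply: nearW => n /=; rewrite Rintegral_ge0//=.
  rewrite -RintD; [|exact: integ_kernel_diff..].
  apply: le_Rint; first exact/integ_kernel_diff/integB.
    by apply: integD; exact: integ_kernel_diff.
  move=> x; rewrite kernel_opB//.
  rewrite (_ : _ - _ - _ = (kernel_op n f x - f x) - (kernel_op n g x - g x)); last ring.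
  exact: ler_normB.
exact: cvg_cst.
Qed.

Lemma approximableZ c f : approximable f -> approximable (fun x => c * f x).
Proof.
move=> [iF fc]; split; first exact: integZ.
have -> : (fun n => \int[m]_x `|kernel_op n (fun x => c * f x) x - c * f x|) =
  (fun n => `|c| * \int[m]_x `|kernel_op n f x - f x|).
  apply/funext => n; rewrite -RintZ; last exact: integ_kernel_diff.
  by apply: eq_Rintegral => x _; rewrite kernel_opZ// -mulrBr normrM.
by rewrite -(mulr0 `|c|); exact: cvgMr.
Qed.

Lemma approximable0 : approximable (fun=> 0).
Proof.
split; first exact: integ0.
have -> : (fun n => \int[m]_x `|kernel_op n (fun=> 0) x - 0|) = fun=> 0.
  apply/funext => n; rewrite -[RHS](Rint_zero m); apply: eq_Rintegral => x _.
  rewrite subr0 /kernel_op (_ : \int[m]_z _ = 0) ?normr0//.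
  by rewrite -[RHS](Rint_zero m); apply: eq_Rintegral => z _; rewrite mulr0.
exact: cvg_cst.
Qed.

Lemma approximableD f g : approximable f -> approximable g ->
  approximable (fun x => f x + g x).
Proof.
move=> af ag; have := approximableB af (approximableB approximable0 ag).
by congr approximable; apply/funext => x; rewrite sub0r opprK.
Qed.

Definition approximable_set (A : set T) := measurable A /\ approximable (\1_A : T -> R).

(** For a fixed E, the sets A whose inverse image meets E in an approximable set form a
    lambda-system, and Dynkin's theorem extends the property from the generators. E carries the
    conditions on the other coordinates, so that these can be treated one at a time. *)
Lemma approximable_lambda d' (T' : measurableType d') (pr : T -> T') (E : set T)
    (G : set (set T')) :
  measurable_fun setT pr -> setI_closed G -> (@measurable d' T' = <<s G >>) ->
  approximable_set E -> (forall A, G A -> approximable_set (pr @^-1` A `&` E)) ->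
  forall A, measurable A -> approximable_set (pr @^-1` A `&` E).
Proof.
move=> mpr GI GE [mE aE] GA.
suff : <<s setT, G >> `<=` [set A | approximable_set (pr @^-1` A `&` E)].
  by move=> H A mA; apply: H; rewrite -GE.
apply: lambda_system_subset => //; split => //.
- by rewrite /= preimage_setT setTI.
- move=> A B BA [mA aA] [mB aB].
  rewrite /=; have -> : pr @^-1` (A `\` B) `&` E = (pr @^-1` A `&` E) `\` (pr @^-1` B `&` E).
    apply/seteqP; split => x /=; first by move=> [[Ax Bx] Ex]; split => // -[].
    by move=> [[Ax Ex] nB]; split => //; split => // Bx; exact: nB.
  split; first exact: measurableD.
  have := approximableB aA aB; congr approximable; apply/funext => x.
  rewrite !indicE in_setD; have [xB|xB] := boolP (x \in pr @^-1` B `&` E).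
    rewrite (_ : x \in _) ?subrr//.
    by move: xB; rewrite !inE => -[/BA].
  by rewrite andbT subr0.
- move=> F ndF FA.
  have mU : measurable (pr @^-1` (\bigcup_i F i) `&` E).
    rewrite preimage_bigcup setI_bigcupl; apply: bigcup_measurable => i _.
    by have [] := FA i.
  split => //.
  apply: approximable_lim; first exact: (integ_indic finite_lty mU).
  (* Indicators of an increasing sequence of sets converge in L^1 by dominated convergence; the
     constant 2 dominates their differences. *)
  have [_ cv] : integ m (fun=> 0) /\ (\int[m]_x
      `|\1_(pr @^-1` (\bigcup_i F i) `&` E) x - \1_(pr @^-1` (F n) `&` E) x : R|)
      @[n --> \oo] --> \int[m]_x (0 : R).
    apply: (@integ_cvg_dominated _ _ _ _ _ _ (fun=> 2)) => //.
    - move=> n; apply: measurableT_comp => //; apply: measurable_funB.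
        exact: measurable_indic.
      by apply: measurable_indic; have [] := FA n.
    - exact: integ_cst finite_lty _.
    - apply: aeW => x.
      have [xU|xU] := pselect ((pr @^-1` (\bigcup_i F i) `&` E) x); last first.
        rewrite (_ : (fun _ => _) = fun=> 0); first exact: cvg_cst.
        apply/funext => n; rewrite !indicE !memNset// ?subrr ?normr0//.
        by move=> [Fx Ex]; apply: xU; split => //; exists n.
      have [[k _ Fk] Ex] := xU.
      apply/cvgr0Pnorm_le => e e0; exists k => // n /= kn.
      rewrite !indicE !mem_set// ?subrr ?normr0 ?(ltW e0)//; split => //.
      by have /subsetPset := ndF _ _ kn; apply.
    - apply: aeW => x n; rewrite normr_id.
      by rewrite (le_trans (ler_normB _ _))// (_ : 2 = 1 + 1)// lerD// ger0_norm// indicE lern1 leq_b1.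
  rewrite Rint_zero in cv.
  move=> eps eps0; have /cvgr0Pnorm_le/(_ _ eps0)[n _ nP] := cv.
  exists (\1_(pr @^-1` F n `&` E)); first by have [] := FA n.
  by apply: le_trans (nP n (leqnn n)); exact: ler_norm.
Qed.

(** Density of simple functions in L^1, together with stability under linear combinations and L^1
    limits. *)
Lemma approximable_all : (forall A, measurable A -> approximable (\1_A : T -> R)) ->
  forall f, integ m f -> approximable f.
Proof.
move=> aA f iF; apply: approximable_lim => // eps eps0.
have [g [ig _ gf]] := approximation_sfun_integrable measurableT iF.
have {}gf : (fun n => \int[m]_x `|f x - g n x|) @ \oo --> 0.
  have := (fine_cvgP _ _).1 gf => -[_]; apply: cvg_trans; apply: near_eq_cvg.
  by apply: nearW => n.
have /cvgr0Pnorm_le/(_ _ eps0)[n _ nP] := gf.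
exists (g n); last by apply: le_trans (nP n (leqnn n)); exact: ler_norm.
have -> : (g n : T -> R) = (fun x => \sum_(y \in range (g n)) (y * \1_(g n @^-1` [set y]) x)).
  by apply/funext => x; exact: fimfunE.
have [r rE] : exists r : seq R, forall x, \sum_(y \in range (g n)) (y * \1_(g n @^-1` [set y]) x) =
    \sum_(y <- r) (y * \1_(g n @^-1` [set y]) x).
  by exists (finmap.enum_fset (fset_set (range (g n)))) => x; rewrite fsbig_finite.
under eq_fun do rewrite rE; elim: r {rE} => [|y s ih].
  under eq_fun do rewrite big_nil; exact: approximable0.
under eq_fun do rewrite big_cons; apply: approximableD => //.
by apply/approximableZ/aA; exact: measurable_sfunP.
Qed.

End approximate_identity.

#[local] Opaque unit_measure3 torus_measure.

(** * The trigonometric kernels and their concentration *)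

Section mollifier.
Variable R : realType.
Local Notation X := (mspace3 R).
Local Notation mu := (@torus_measure R).
Local Notation nu := (@unit_measure R).
Local Notation mu3 := (@unit_measure3 R).
Implicit Types (f g u phi : space3 R -> R) (a b : 'I_3) (x z : space3 R).

Lemma torus_tonelli_measurable (g : X * X -> \bar R) : measurable_fun setT g ->
  (forall p, 0 <= g p)%E -> measurable_fun setT (fun x => \int[mu]_z g (x, z))%E.
Proof.
move=> mg g0; have -> : (fun x => \int[mu]_z g (x, z))%E = (fun x => \int[mu3]_z g (x, z))%E.
  apply/funext => x; exact (torus_integralE (fun z => g (x, z))).
exact (measurable_fun_fubini_tonelli_F g mg g0).
Qed.

Lemma torus_tonelli (g : X * X -> \bar R) : measurable_fun setT g ->
  (forall p, 0 <= g p)%E ->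
  (\int[mu]_x \int[mu]_z g (x, z) = \int[mu]_z \int[mu]_x g (x, z))%E.
Proof.
move=> mg g0.
have E1 : (fun x => \int[mu]_z g (x, z))%E = (fun x => \int[mu3]_z g (x, z))%E.
  apply/funext => x; exact (torus_integralE (fun z => g (x, z))).
have E2 : (fun z => \int[mu]_x g (x, z))%E = (fun z => \int[mu3]_x g (x, z))%E.
  apply/funext => z; exact (torus_integralE (fun x => g (x, z))).
refine (etrans (f_equal (fun F : X -> \bar R => \int[mu]_x F x)%E E1) _).
refine (etrans _ (esym (f_equal (fun F : X -> \bar R => \int[mu]_x F x)%E E2))).
refine (etrans (torus_integralE _) (etrans _ (esym (torus_integralE _)))).
exact (fubini_tonelli g mg g0).
Qed.

Lemma ae_torus_neg (N : set X) : measurable N -> mu N = 0%E ->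
  {ae mu, forall x, ~ N x}.
Proof. by move=> mN N0; exists N; split => // x /= /contrapT. Qed.

Lemma ae_unit_cube : {ae mu, forall x : X, unit_cube x}.
Proof.
apply: (ae_imp _ (@ae_torus_neg (~` @unit_cube R) _ _)).
- by move=> x /contrapT.
- apply: measurableC; exact: measurable_unit_cube.
- by rewrite [LHS]/(mrestr _ _ _) /mrestr setICl measure0.
Qed.

Lemma ae_crd_neq a (c : R) : {ae mu, forall x : X, crd a x != c}.
Proof.
have nu0 : nu [set c] = 0%E.
  rewrite /= /mfrestr /mrestr; apply/eqP; rewrite -measure_le0 -(lebesgue_measure_set1 c).
  by apply: le_measure; rewrite ?inE//; apply: measurableI => //; exact: measurable_I01.
have H : mu (crd a @^-1` [set c] : set X) = 0%E.
  move: a; apply: ord3P.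
  - rewrite (_ : _ @^-1` _ = ([set c] `*` setT) `*` setT); last first.
      by apply/seteqP; split => -[[x0 x1] x2] //= [[]].
    by rewrite torus_measureX//; [rewrite unit_measure2X// nu0 !mul0e|exact: measurableX].
  - rewrite (_ : _ @^-1` _ = (setT `*` [set c]) `*` setT); last first.
      by apply/seteqP; split => -[[x0 x1] x2] //= [[]].
    by rewrite torus_measureX//; [rewrite unit_measure2X// nu0 mule0 mul0e|exact: measurableX].
  - rewrite (_ : _ @^-1` _ = setT `*` [set c]); last first.
      by apply/seteqP; split => -[[x0 x1] x2] //= [].
    by rewrite torus_measureX// nu0 mule0.
apply: (ae_imp _ (@ae_torus_neg _ _ H)).
- by move=> x nx; apply/eqP.
- by rewrite -[X in measurable X]setTI; exact: (measurable_crd a).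
Qed.

Lemma sep_trigl k z : separable_kernel k -> trig (k ^~ z).
Proof.
elim=> [p q tp tq|k1 k2 _ t1 _ t2]; last exact: trigD t1 t2.
exact: trigM tp (trig_cst (q z)).
Qed.

Lemma sep_trigr k x : separable_kernel k -> trig (k x).
Proof.
elim=> [p q tp tq|k1 k2 _ t1 _ t2]; last exact: trigD t1 t2.
exact: trigM (trig_cst (p x)) tq.
Qed.

Lemma sep_op k f : separable_kernel k -> integ mu (f : X -> R) ->
  trig (fun x => \int[mu]_z (k x z * f z : R)) /\ forall a x,
    spartial a (fun x => \int[mu]_z (k x z * f z : R)) x =
    \int[mu]_z (spartial a (k ^~ z) x * f z : R).
Proof.
move=> + iF; elim=> [p q tp tq|k1 k2 s1 [t1 d1] s2 [t2 d2]].
  have iqf : integ mu (fun z : X => q z * f z) by exact: integ_testMl (trig_test tq) iF.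
  have E : (fun x => \int[mu]_z (p x * q z * f z : R)) = (fun x => p x * \int[mu]_z (q z * f z : R)).
    by apply/funext => x; rewrite -RintZ//; apply: eq_Rintegral => z _; rewrite mulrA.
  have tc (c : R) : trig (fun=> c) by exact: trig_cst.
  rewrite E; split; first exact: trigM tp (tc _).
  move=> a x; rewrite (trig_spartialM a tp (tc _)) spartial_cst mulr0 add0r.
  rewrite mulrC -RintZ//; apply: eq_Rintegral => z _.
  by rewrite (trig_spartialM a tp (tc (q z))) spartial_cst mulr0 add0r mulrA [q z * _]mulrC.
have ik (l : X -> X -> R) x : separable_kernel l -> integ mu (fun z : X => l x z * f z).
  by move=> sk; apply: integ_testMl iF; exact/trig_test/sep_trigr.
have E : (fun x => \int[mu]_z ((k1 x z + k2 x z) * f z : R)) =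
  (fun x => \int[mu]_z (k1 x z * f z : R) + \int[mu]_z (k2 x z * f z : R)).
  apply/funext => x; rewrite -RintD; [|exact: ik..].
  by apply: eq_Rintegral => z _; rewrite mulrDl.
rewrite E; split; first exact: trigD t1 t2.
move=> a x; rewrite (trig_spartialD a t1 t2) d1 d2.
have ids (l : X -> X -> R) : separable_kernel l -> integ mu (fun z : X => spartial a (l ^~ z) x * f z).
  move=> sk; apply: integ_testMl iF; apply: trig_test.
  elim: sk => [p q tp tq|l1 l2 sl1 tl1 sl2 tl2].
    rewrite (_ : (fun z => _) = (fun z => spartial a p x * q z)).
      exact: trigM (trig_cst (spartial a p x)) tq.
    apply/funext => z; rewrite (trig_spartialM a tp (trig_cst (q z))) spartial_cst mulr0 add0r.
    by rewrite mulrC.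
  rewrite (_ : (fun z => _) = (fun z => spartial a (l1 ^~ z) x + spartial a (l2 ^~ z) x)).
    exact: trigD tl1 tl2.
  by apply/funext => z; rewrite (trig_spartialD a (sep_trigl z sl1) (sep_trigl z sl2)).
rewrite -RintD; [|exact: ids..].
by apply: eq_Rintegral => z _; rewrite (trig_spartialD a (sep_trigl z s1) (sep_trigl z s2)) mulrDl.
Qed.

(** The derivative in x is minus the derivative in z, and [k x] is itself a test function, so the
    weak derivative of f applies to it. *)
Lemma conv_op_partial k f (F : 'I_3 -> space3 R -> R) : conv_kernel k -> integ mu (f : X -> R) ->
  (forall a, integ mu (F a : X -> R)) -> (forall a, weak_partial a f (F a)) -> forall a x,
  spartial a (fun x => \int[mu]_z (k x z * f z : R)) x = \int[mu]_z (k x z * F a z : R).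
Proof.
move=> ck iF iFa fF a x.
have [_ ->] := sep_op (conv_separable ck) iF.
have := fF a _ (trig_test (conv_trigr x ck)); rewrite /torus_int => E.
transitivity (- \int[mu]_z (f z * spartial a (k x) z : R)).
  rewrite -RintN; last exact/integ_testM/iF/test_spartial/trig_test/conv_trigr.
  by apply: eq_Rintegral => z _; rewrite conv_spartial// mulrC mulrN.
by rewrite E opprK; apply: eq_Rintegral => z _; rewrite mulrC.
Qed.

Lemma const_of_spartial0 u : trig u -> (forall a x, spartial a u x = 0) ->
  forall x y, u x = u y.
Proof.
move=> tu du x y.
have H a x' t : u (upd a x' t) = u x'.
  have -> : u x' = u (upd a x' (crd a x')) by rewrite /upd subrr scale0r addr0.
  apply: (@is_derive_0_is_cst _ (fun t => u (upd a x' t))) => s.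
  have [_ /(_ s)] := test_upd a x' (trig_test tu).
  by rewrite du.
rewrite -(H 0 x y.1.1) -(H 1 _ y.1.2) -(H 2 _ y.2); congr u.
by rewrite !updE; case: y => -[].
Qed.

(* This is [1 + cos (2 pi (x_a - z_a))], written as a separable kernel. *)
Definition base_factor a x z : R := 1 + (tcos a x * tcos a z + tsin a x * tsin a z).
Definition base_kernel x z : R := base_factor 0 x z * base_factor 1 x z * base_factor 2 x z.
Definition power_kernel (n : nat) x z : R := base_kernel x z ^+ n.

Lemma base_factorE a x z : base_factor a x z = 1 + cos ((pi *+ 2) * (crd a x - crd a z)).
Proof. by rewrite mulrBr cosB. Qed.

Lemma base_factor_ge0 a x z : 0 <= base_factor a x z.
Proof. by rewrite base_factorE -lerBlDl sub0r cos_geN1. Qed.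

Lemma base_factor_le2 a x z : base_factor a x z <= 2.
Proof. by rewrite base_factorE -lerBrDl (_ : 2 - 1 = 1) ?cos_le1//; ring. Qed.

Lemma conv_power_kernel n : conv_kernel (power_kernel n).
Proof.
have cb : conv_kernel base_kernel.
  have cf a : conv_kernel (base_factor a) by exact: (convD (conv_cst (1 : R)) (conv_cos R a)).
  exact: (convM (convM (cf 0) (cf 1)) (cf 2)).
elim: n => [|n ih]; first exact: conv_cst.
rewrite (_ : power_kernel n.+1 = fun x z => base_kernel x z * power_kernel n x z).
  exact: (convM cb ih).
by apply/funext => x; apply/funext => z; rewrite /power_kernel exprS.
Qed.

Lemma base_kernel_ge0 x z : 0 <= base_kernel x z.
Proof. by rewrite !mulr_ge0// base_factor_ge0. Qed.

(** The other two factors are at most 2: as soon as one coordinate of x - z stays away from the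
    integers, the kernel stays below its maximum 8. *)
Lemma base_kernel_le_factor a x z : base_kernel x z <= 4 * base_factor a x z.
Proof.
have p c := base_factor_ge0 c x z; have q c := base_factor_le2 c x z.
have h b c : base_factor b x z * base_factor c x z <= 4.
  by rewrite (_ : 4 = 2 * 2); [exact: ler_pM|ring].
move: a; apply: ord3P; rewrite /base_kernel.
- by rewrite mulrAC -mulrA mulrC ler_wpM2r// mulrC.
- by rewrite mulrAC ler_wpM2r.
- by rewrite ler_wpM2r.
Qed.

Lemma base_kernel_le8 x z : base_kernel x z <= 8.
Proof.
apply: (le_trans (base_kernel_le_factor 0 x z)).
by rewrite (_ : 8 = 4 * 2); [rewrite ler_wpM2l// base_factor_le2|ring].
Qed.

Lemma power_kernelC n x z : power_kernel n x z = power_kernel n z x.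
Proof.
have h a : base_factor a x z = base_factor a z x.
  by rewrite /base_factor [tcos a x * _]mulrC [tsin a x * _]mulrC.
by rewrite /power_kernel /base_kernel !h.
Qed.

Definition kernel_mass n : R := \int[mu]_z (power_kernel n 0 z : R).

(** Translation invariance obtained by differentiation: the mass at x is the kernel applied to the
    function 1, whose weak derivatives vanish, so the mass has zero partial derivatives in x. *)
Lemma kernel_massE n x : \int[mu]_z (power_kernel n x z : R) = kernel_mass n.
Proof.
have i1 : integ mu (fun=> 1 : R) by exact: integ_cst (torus_lty R) 1.
have i0 : integ mu (fun=> 0 : R) by exact: integ0.
have w0 a : weak_partial a (fun=> 1 : R) (fun=> 0 : R).
  move=> phi tphi; rewrite /torus_int.
  have -> : \int[mu]_z (0 * phi z : R) = 0.
    by rewrite -[RHS](Rint_zero mu); apply: eq_Rintegral => z _; rewrite mul0r.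
  rewrite oppr0 -[RHS](Rint_spartial a tphi).
  by apply: eq_Rintegral => z _; rewrite mul1r.
have E y : \int[mu]_z (power_kernel n y z : R) = \int[mu]_z (power_kernel n y z * 1 : R).
  by apply: eq_Rintegral => z _; rewrite mulr1.
rewrite /kernel_mass E [RHS]E.
apply: (@const_of_spartial0 (fun x => \int[mu]_z (power_kernel n x z * 1 : R))).
  by have [] := sep_op (conv_separable (conv_power_kernel n)) i1.
move=> a y.
rewrite (@conv_op_partial _ (fun=> 1) (fun _ _ => 0) (conv_power_kernel n) i1 (fun=> i0) w0).
by rewrite -[RHS](Rint_zero mu); apply: eq_Rintegral => z _; rewrite mulr0.
Qed.

Lemma integ_power_kernel n x : integ mu (power_kernel n x : X -> R).
Proof. by apply: test_integ; apply/trig_test/conv_trigr/conv_power_kernel. Qed.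

Lemma unit_measure_itv (r : R) : 0 <= r -> r <= 1 -> nu `[0, r]%classic = r%:E.
Proof.
move=> r0 r1; rewrite /= /mfrestr /mrestr.
rewrite (_ : _ `&` _ = `[0, r]%classic :> set R).
  rewrite lebesgue_measure_itv/= lte_fin oppr0 adde0.
  by case: ltP => // r0'; congr EFin; apply/eqP; rewrite eq_le r0 r0'.
apply/seteqP; split => t /=; rewrite !in_itv/= ; first by case.
by move=> /andP[t0 tr]; split; rewrite t0//= (le_trans tr).
Qed.

(* The mass of the kernel is at least [c ^+ n] times that of a small cube on which
   the base kernel exceeds [c]. *)
Lemma kernel_mass_lbound (c : R) : 0 <= c -> c < 8 -> exists2 v : R, 0 < v &
  forall n, v * c ^+ n <= kernel_mass n.
Proof.
move=> c0 c8.
have tb : trig (base_kernel 0).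
  have := conv_trigr 0 (conv_power_kernel 1).
  by congr trig; apply/funext => z; rewrite /power_kernel expr1.
have b0 : base_kernel 0 0 = 8.
  by rewrite /base_kernel !base_factorE !subrr !mulr0 cos0; ring.
have e0 : 0 < 8 - c by rewrite subr_gt0.
have /cvgrPdist_lt/(_ _ e0)/nbhs_ballP[r0 /= r00 rP] := (@trig_continuous _ _ tb) (0 : space3 R).
(* The cube with corner 0 and side r lies in the fundamental domain, since r <= 1, and in the ball
   where the base kernel exceeds c, since r < r0. *)
pose r := Num.min (r0 / 2) (1 / 2).
have rr : 0 < r by rewrite lt_min !divr_gt0.
have r1 : r <= 1 by rewrite ge_min; apply/orP; right; lra.
have rr0 : r < r0 by rewrite gt_min; apply/orP; left; lra.
pose Q : set X := (`[0, r] `*` `[0, r]) `*` `[0, r].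
have mI : measurable (`[0, r]%classic : set (measurableTypeR R)) by exact: measurable_itv.
have mQ : measurable Q by apply: measurableX => //; exact: measurableX.
have QE : mu Q = (r ^+ 3)%:E.
  rewrite torus_measureX//; last exact: measurableX.
  rewrite unit_measure2X// unit_measure_itv ?(ltW rr)// -!EFinM; congr EFin; ring.
exists (r ^+ 3); first by rewrite exprn_gt0.
move=> n.
have iQ : integ mu (\1_Q : X -> R) by exact: (integ_indic (torus_lty R) mQ).
have -> : r ^+ 3 * c ^+ n = \int[mu]_z (c ^+ n * \1_Q z : R).
  rewrite RintZ// mulrC; congr (_ * _).
  by rewrite /Rintegral integral_indic// setIT QE.
apply: le_Rint; [exact: integZ|exact: integ_power_kernel|].
move=> z; rewrite indicE; case: (boolP (z \in Q)) => [|_]; last first.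
  by rewrite mulr0 exprn_ge0// base_kernel_ge0.
rewrite inE mulr1 => -[[/= z0 z1] z2]; rewrite /power_kernel lerXn2r ?nnegrE ?base_kernel_ge0//.
have H t : t \in `[0, r] -> ball 0 r0 t.
  rewrite in_itv/= /ball/= => /andP[t0 tr]; rewrite sub0r normrN ger0_norm//.
  exact: le_lt_trans tr rr0.
have : ball (0 : space3 R) r0 z by split; [split|]; exact: H.
move=> /rP; rewrite b0 ltr_norml => /andP[_ h]; lra.
Qed.

Lemma kernel_mass_gt0 n : 0 < kernel_mass n.
Proof.
have [v v0 /(_ n)] := @kernel_mass_lbound 1 ler01 (ltr1n _ 8).
by rewrite expr1n mulr1; exact: lt_le_trans.
Qed.

Definition moll_kernel n x z : R := power_kernel n x z / kernel_mass n.

Definition moll n f x : R := (kernel_mass n)^-1 * \int[mu]_z (power_kernel n x z * f z : R).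

Lemma mollE n f : integ mu (f : X -> R) ->
  moll n f = kernel_op mu (moll_kernel : nat -> X -> X -> R) n f.
Proof.
move=> iF; apply/funext => x; rewrite /moll /kernel_op -RintZ.
  by apply: eq_Rintegral => z _; rewrite /moll_kernel; ring.
exact/(integ_testMl _ iF)/trig_test/conv_trigr/conv_power_kernel.
Qed.

Lemma moll_trig n f : integ mu (f : X -> R) -> trig (moll n f).
Proof.
move=> iF; have [tf _] := sep_op (conv_separable (conv_power_kernel n)) iF.
exact: trigM (trig_cst _) tf.
Qed.

Lemma moll_spartial n f (F : 'I_3 -> space3 R -> R) : integ mu (f : X -> R) ->
  (forall a, integ mu (F a : X -> R)) -> (forall a, weak_partial a f (F a)) ->
  forall a, spartial a (moll n f) = moll n (F a).
Proof.
move=> iF iFa fF a; apply/funext => x.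
have [tf _] := sep_op (conv_separable (conv_power_kernel n)) iF.
rewrite (trig_spartialM a (trig_cst _) tf) spartial_cst mulr0 addr0.
by rewrite (conv_op_partial (conv_power_kernel n) iF iFa fF).
Qed.

Lemma moll_kernel_measurable n :
  measurable_fun setT (fun p : X * X => moll_kernel n p.1 p.2).
Proof.
apply: measurable_funM => //.
have H : forall k : space3 R -> space3 R -> R, separable_kernel k -> measurable_fun [set: X * X] (fun p : X * X => k p.1 p.2 : R).
  move=> k; elim=> [p q tp tq|k1 k2 _ m1 _ m2]; last exact: measurable_funD.
  apply: measurable_funM.
    by apply: (measurableT_comp (trig_measurable tp)).
  by apply: (measurableT_comp (trig_measurable tq)).
exact: (H _ (conv_separable (conv_power_kernel n))).
Qed.

Lemma moll_kernel_ge0 n x z : 0 <= moll_kernel n x z.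
Proof. by rewrite divr_ge0 ?exprn_ge0 ?base_kernel_ge0 ?(ltW (kernel_mass_gt0 n)). Qed.

Lemma moll_kernel_bounded n : exists M, forall x z, moll_kernel n x z <= M.
Proof.
exists (8 ^+ n / kernel_mass n) => x z.
rewrite ler_wpM2r ?invr_ge0 ?(ltW (kernel_mass_gt0 n))//.
by rewrite lerXn2r ?nnegrE ?base_kernel_ge0 ?base_kernel_le8.
Qed.

Lemma moll_kernel_mass n x : \int[mu]_z (moll_kernel n x z : R) = 1.
Proof.
under eq_Rintegral do rewrite /moll_kernel mulrC.
rewrite RintZ; last exact: integ_power_kernel.
by rewrite kernel_massE mulVf// gt_eqF// kernel_mass_gt0.
Qed.

Lemma moll_kernel_dual_mass n z : \int[mu]_x (moll_kernel n x z : R) = 1.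
Proof.
rewrite -[RHS](moll_kernel_mass n z); apply: eq_Rintegral => x _.
by rewrite /moll_kernel power_kernelC.
Qed.

Lemma moll_measurable n f : integ mu (f : X -> R) ->
  measurable_fun setT (kernel_op mu (moll_kernel : nat -> X -> X -> R) n f).
Proof.
move=> iF; rewrite -mollE//; by apply: trig_measurable; exact: moll_trig.
Qed.

(** The two bounds put t at distance at least [del] from the integers. The symmetry between |t| and
    1 - |t| leads back to [0, 1/2], where cos (2 pi t) decreases. *)
Lemma cos_far (del t : R) : 0 < del -> del <= `|t| -> `|t| <= 1 - del ->
  cos ((pi *+ 2) * t) <= cos ((pi *+ 2) * del).
Proof.
move=> del0 dt td.
have del2 : del <= 1 / 2 by lra.
have cosN_abs : cos ((pi *+ 2) * t) = cos ((pi *+ 2) * `|t|).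
  by have [t0|t0] := ger0P t; rewrite ?mulrN ?cosN.
have pi0 := pi_gt0 R.
have pi2 : 0 <= pi *+ 2 :> R by rewrite mulrn_wge0// ltW.
have in0pi (r : R) : 0 <= r -> r <= 1 / 2 -> (pi *+ 2) * r \in `[0, pi].
  move=> r0 r1; rewrite in_itv/= (mulr_ge0 pi2 r0)/=.
  by rewrite -mulr_natr -mulrA ger_pMr//; lra.
have mono (s : R) : del <= s -> s <= 1 / 2 -> cos ((pi *+ 2) * s) <= cos ((pi *+ 2) * del).
  move=> ds s2; rewrite leNgt ltr_cos; [|by apply: in0pi; lra..].
  by rewrite -leNgt ler_wpM2l.
rewrite cosN_abs; have [t2|t2] := leP `|t| (1 / 2); first exact: mono.
have -> : cos ((pi *+ 2) * `|t|) = cos ((pi *+ 2) * (1 - `|t|)).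
  by rewrite mulrBr mulr1 addrC cosD2pi cosN.
by apply: mono; lra.
Qed.

Lemma cos_del_lt1 (del : R) : 0 < del -> del <= 1 / 2 -> cos ((pi *+ 2) * del) < 1.
Proof.
move=> d0 d2; have pi0 := pi_gt0 R.
rewrite -[ltRHS](cos0 R) ltr_cos ?in_itv/= ?lexx ?(ltW pi0)//.
  by rewrite mulr_gt0// pmulrn_rgt0.
have pi2 : 0 <= pi *+ 2 :> R by rewrite mulrn_wge0// ltW.
rewrite (mulr_ge0 pi2 (ltW d0))/=.
by rewrite -mulr_natr -mulrA ger_pMr//; lra.
Qed.

(** The numerator is at most th^n, while the mass is at least v c^n for c = (th + 8)/2, which lies
    strictly between th and 8; the ratio decays like (th/c)^n. *)
Lemma moll_far (A : set X) x (th : R) : measurable A -> 0 <= th -> th < 8 ->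
  (forall z, A z -> unit_cube (z : X) -> base_kernel x z <= th) ->
  moll n (\1_A : X -> R) x @[n --> \oo] --> 0.
Proof.
move=> mA th0 th8 Ath.
have c8 : (th + 8) / 2 < 8 by lra.
have c0 : 0 < (th + 8) / 2 by lra.
have [v v0 vP] := kernel_mass_lbound (ltW c0) c8.
set c := (th + 8) / 2 in c8 c0 vP.
have iA : integ mu (\1_A : X -> R) by exact: (integ_indic (torus_lty R) mA).
have ipA n : integ mu (fun z : X => power_kernel n x z * \1_A z).
  by apply: integ_testMl iA; exact/trig_test/conv_trigr/conv_power_kernel.
have up n : moll n (\1_A : X -> R) x <= v^-1 * (th / c) ^+ n.
  have I : \int[mu]_z (power_kernel n x z * \1_A z : R) <= th ^+ n.
    rewrite -[leRHS]Rint_torus_cst; apply: le_Rint_ae => //.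
      exact: integ_cst (torus_lty R) _.
    apply: ae_imp (ae_unit_cube) => z Qz; rewrite indicE.
    case: (boolP (z \in A)) => [/set_mem Az|_]; last by rewrite mulr0 exprn_ge0.
    by rewrite mulr1 lerXn2r ?nnegrE ?base_kernel_ge0 ?Ath.
  apply: (@le_trans _ _ ((kernel_mass n)^-1 * th ^+ n)).
    by rewrite ler_wpM2l// invr_ge0 ltW// kernel_mass_gt0.
  rewrite expr_div_n [v^-1 * _]mulrCA mulrC ler_wpM2l ?exprn_ge0// -invfM.
  by rewrite lef_pV2 ?posrE ?kernel_mass_gt0 ?mulr_gt0 ?exprn_gt0// vP.
have lo n : 0 <= moll n (\1_A : X -> R) x.
  rewrite mulr_ge0 ?invr_ge0 ?(ltW (kernel_mass_gt0 n))//.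
  by apply: Rintegral_ge0 => z _; rewrite mulr_ge0// exprn_ge0// base_kernel_ge0.
have H : v^-1 * (th / c) ^+ n @[n --> \oo] --> 0.
  rewrite -(mulr0 v^-1); apply: cvgMr; apply: cvg_expr.
  have tc0 : 0 <= th / c by rewrite divr_ge0// ltW.
  by rewrite (ger0_norm tc0) ltr_pdivrMr// mul1r /c; lra.
apply: (@squeeze_cvgr _ _ _ _ (cst 0) _ _ _ _ _ H); last exact: cvg_cst.
by apply: nearW => n; rewrite /= lo up.
Qed.

(** The half-open intervals generate the Borel sets and are stable under intersection; the whole
    line is added to leave a coordinate free. *)
Definition box_side (I : set R) := I = setT \/ ocitv I.

(** [a] and [b] are the ends of the interval. If t avoids them and 0 and 1, a point s of [0, 1] on
    the other side of the membership is far from t even modulo 1, which is why |t - s| must stay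
    away from 1 as well as from 0. *)
Lemma box_side_gap (I : set R) : box_side I -> exists a b : R, forall t, 0 < t < 1 ->
  t != a -> t != b -> exists2 del, 0 < del & forall s, s \in `[0, 1] ->
    ~ (I s <-> I t) -> del <= `|t - s| <= 1 - del.
Proof.
move=> [->|/ocitvP[->|[[a b] /= ab ->]]].
- by exists 0, 0 => t _ _ _; exists 1 => // s _ [].
- by exists 0, 0 => t _ _ _; exists 1 => // s _ [].
exists a, b => t /andP[t0 t1] ta tb.
pose del := Num.min (Num.min `|t - a| `|t - b|) (Num.min t (1 - t)).
exists del.
  by rewrite !lt_min !normr_gt0 !subr_eq0 ta tb t0/= subr_gt0.
move=> s; rewrite in_itv/= => /andP[s0 s1] st.
have d1 : del <= `|t - a| by rewrite !ge_min lexx.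
have d2 : del <= `|t - b| by rewrite !ge_min lexx orbT.
have d3 : del <= t by rewrite !ge_min lexx !orbT.
have d4 : del <= 1 - t by rewrite !ge_min lexx !orbT.
apply/andP; split; last first.
  by rewrite ler_norml; apply/andP; split; lra.
rewrite leNgt; apply/negP => ts; apply: st; rewrite /= !in_itv/=.
move: ts d1 d2; rewrite !ltr_norml !ler_normr => /andP[h1 h2] /orP h3 /orP h4.
by split => /andP[h5 h6]; apply/andP; split; case: h3; case: h4; lra.
Qed.

(** Almost every x avoids the faces of the box and of the cube; then every z of the cube whose
    membership differs from that of x is far from x in some coordinate, and [moll_far] applies to
    the box or to its complement. *)
Lemma moll_box (I : 'I_3 -> set R) : (forall a, box_side (I a)) ->
  (forall a, measurable (I a : set (measurableTypeR R))) ->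
  {ae mu, forall x : X, moll n (\1_(\bigcap_a (crd a @^-1` I a)) : X -> R) x @[n --> \oo] -->
      (\1_(\bigcap_a (crd a @^-1` I a)) : X -> R) x}.
Proof.
move=> sI mI; set B := \bigcap_a _.
have mB : measurable (B : set X).
  rewrite /B -bigsetI_fset_set/=; last exact: finite_finset.
  elim/big_ind: _ => //; first exact: measurableI.
  by move=> a _; rewrite -[X in measurable X]setTI; exact: (@measurable_crd R a measurableT _ (mI a)).
have /choice[p /choice[q pqP]] := fun a => box_side_gap (sI a).
have H : {ae mu, forall x : X, forall a, (0 < crd a x < 1) /\ crd a x != p a /\ crd a x != q a}.
  have h a : {ae mu, forall x : X, (0 < crd a x < 1) /\ crd a x != p a /\ crd a x != q a}.
    have A1 := ae_and (ae_crd_neq a 0) (ae_crd_neq a 1).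
    have A2 := ae_and ae_unit_cube (ae_and (ae_crd_neq a (p a)) (ae_crd_neq a (q a))).
    have := ae_and A1 A2; apply: ae_imp => x [[n0 n1] [[[Q0 Q1] Q2] pq]]; split => //.
    have : crd a x \in `[0, 1] by move: a {n0 n1 pq A1 A2}; apply: ord3P.
    by rewrite in_itv/= !le_eqVlt eq_sym (negbTE n0) (negbTE n1).
  have := ae_and (h 0) (ae_and (h 1) (h 2)); apply: ae_imp => x [h0 [h1 h2]]; exact: ord3P.
have := ae_and ae_unit_cube H; apply: ae_imp => x [Qx Hx].
have /choice[del delP] : forall a, exists del, 0 < del /\ forall s, s \in `[0, 1] ->
    ~ (I a s <-> I a (crd a x)) -> del <= `|crd a x - s| <= 1 - del.
  by move=> a; have [x01 [xp xq]] := Hx a; have [d d0 dP] := pqP a _ x01 xp xq; exists d.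
pose dl := Num.min (Num.min (del 0) (Num.min (del 1) (del 2))) (1 / 2).
have dl0 : 0 < dl by rewrite !lt_min !(delP _).1/= divr_gt0.
have dl2 : dl <= 1 / 2 by rewrite ge_min lexx orbT.
have dla a : dl <= del a by move: a; apply: ord3P; rewrite !ge_min lexx ?orbT.
pose th := 4 * (1 + cos ((pi *+ 2) * dl)).
have th0 : 0 <= th by rewrite mulr_ge0// -lerBlDl sub0r cos_geN1.
have th8 : th < 8 by have := cos_del_lt1 dl0 dl2; rewrite /th; lra.
have far z : unit_cube (z : X) -> (exists a, ~ (I a (crd a z) <-> I a (crd a x))) ->
    base_kernel x z <= th.
  move=> [[Q0 Q1] Q2] [a na].
  apply: (le_trans (base_kernel_le_factor a x z)); rewrite ler_wpM2l// base_factorE lerD2l.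
  have za : crd a z \in `[0, 1] by move: a {na}; apply: ord3P.
  have /andP[h1 h2] := (delP a).2 _ za na; have h3 := dla a.
  by apply: cos_far => //; lra.
have [Bx|nBx] := pselect (B x).
  rewrite indicE mem_set//.
  (* The normalised kernel has mass 1, so convergence to 1 inside the box is convergence to 0 for
     its complement. *)
  have -> : (fun n => moll n (\1_B : X -> R) x) = (fun n => 1 - moll n (\1_(~` B) : X -> R) x).
    apply/funext => n; apply/eqP; rewrite eq_sym subr_eq; apply/eqP.
    have ip (A : set X) : measurable A -> integ mu (fun z : X => power_kernel n x z * \1_A z).
      move=> mA; apply: integ_testMl (integ_indic (torus_lty R) mA); exact/trig_test/conv_trigr/conv_power_kernel.
    rewrite /moll -mulrDr -RintD; [|exact: ip|apply: ip; exact: measurableC].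
    rewrite (_ : \int[mu]_z _ = kernel_mass n) ?mulVf// ?gt_eqF ?kernel_mass_gt0//.
    rewrite -(kernel_massE n x); apply: eq_Rintegral => z _.
    rewrite -mulrDr !indicE in_setC; case: (z \in B); rewrite ?addr0 ?add0r mulr1//.
  rewrite -[X in _ --> X](subr0 1); apply: cvgB; first exact: cvg_cst.
  apply: (@moll_far _ _ th) => //; first exact: measurableC.
  move=> z nBz Qz; apply: far => //; apply: contrapT => /forallNP h; apply: nBz => a _.
  by have /contrapT [_] := h a; apply; exact: Bx.
rewrite indicE memNset//; apply: (@moll_far _ _ th) => //.
move=> z Bz Qz; apply: far => //; apply: contrapT => /forallNP h; apply: nBx => a _.
by have /contrapT [+ _] := h a; apply; exact: Bz.
Qed.

End mollifier.

(** * Convergence of the mollifications in L^1 *)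

Section mollifier_convergence.
Variable R : realType.
Local Notation X := (mspace3 R).
Local Notation mu := (@torus_measure R).
Implicit Types (f g u phi : space3 R -> R) (a b : 'I_3) (x z : space3 R).
Local Notation aset := (approximable_set mu (@moll_kernel R : nat -> X -> X -> R)).

Definition box3 (A B C : set R) : set X := (A `*` B) `*` C.

(** Almost everywhere convergence on boxes becomes L^1 convergence by domination: the indicator and
    its mollifications take values in [0, 1]. *)
Lemma approximable_box3_side (A B C : set R) :
  box_side A -> box_side B -> box_side C -> aset (box3 A B C).
Proof.
have mside (I : set R) : box_side I -> measurable (I : set (measurableTypeR R)).
  by move=> [->//|Ii]; exact: sub_sigma_algebra.
move=> sA sB sC.
have mABC : measurable (box3 A B C) by apply: measurableX; [apply: measurableX|]; exact: mside.
pose I (a : 'I_3) := if a == 0 then A else if a == 1 then B else C.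
have sI a : box_side (I a) by move: a; apply: ord3P.
have BE : \bigcap_a (crd a @^-1` I a) = box3 A B C.
  apply/seteqP; split => x.
    by move=> h; split; [split|]; [exact: (h 0)|exact: (h 1)|exact: (h 2)].
  by move=> [[xA xB] xC] a _; move: a; apply: ord3P.
have := moll_box sI (fun a => mside _ (sI a)); rewrite BE => cv.
have iB := integ_indic (torus_lty R) mABC.
split => //; split => //.
have mm n : measurable_fun setT (moll n (\1_(box3 A B C) : X -> R) : X -> R).
  by rewrite mollE//; exact: moll_measurable.
have [_] : integ mu (fun=> 0 : R) /\ (\int[mu]_x
    `|moll n (\1_(box3 A B C) : X -> R) x - \1_(box3 A B C) x : R|)
    @[n --> \oo] --> \int[mu]_x (0 : R).
  apply: (@integ_cvg_dominated _ _ _ _ _ _ (fun=> 2)).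
  - move=> n; apply: measurableT_comp => //; apply: measurable_funB => //.
  - by [].
  - exact: integ_cst (torus_lty R) _.
  - apply: ae_imp cv => x; rewrite -[X in _ -> _ --> X](normr0 R) => cx; apply: cvg_norm.
    by rewrite -(subrr (\1_(box3 A B C) x)); apply: cvgB => //; exact: cvg_cst.
  - apply: aeW => x n; rewrite normr_id.
    have i1 : 0 <= moll n (\1_(box3 A B C) : X -> R) x <= 1.
      rewrite mollE// /kernel_op; apply/andP; split.
        by apply: Rintegral_ge0 => z _; rewrite mulr_ge0// moll_kernel_ge0.
      rewrite -(moll_kernel_mass n x); apply: le_Rint.
      + apply: integ_K => //.
        * exact: moll_kernel_measurable.
        * exact: moll_kernel_ge0.
        * exact: moll_kernel_bounded.
      + by apply: integ_ext (integZ (kernel_mass R n)^-1 (integ_power_kernel n x)) => z; rewrite mulrC.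
      + by move=> z; rewrite ler_piMr ?moll_kernel_ge0// indicE lern1 leq_b1.
    have i2 : 0 <= (\1_(box3 A B C) x : R) <= 1 by rewrite indicE ler0n lern1 leq_b1.
    by rewrite ler_norml; move: i1 i2; lra.
rewrite Rint_zero (_ : (fun n => _) = (fun n => \int[mu]_x `|kernel_op mu (@moll_kernel R : nat -> X -> X -> R) n (\1_(box3 A B C)) x - \1_(box3 A B C) x|))//.
by apply/funext => n; apply: eq_Rintegral => x _; rewrite mollE.
Qed.

Lemma moll_lambda d' (T' : measurableType d') (pr : X -> T') (E : set X)
    (G : set (set T')) :
  measurable_fun setT pr -> setI_closed G -> (@measurable d' T' = <<s G >>) ->
  aset E -> (forall A, G A -> aset (pr @^-1` A `&` E)) ->
  forall A, measurable A -> aset (pr @^-1` A `&` E).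
Proof.
apply: (@approximable_lambda _ _ _ _ (torus_lty R) (@torus_tonelli_measurable R)
  (@torus_tonelli R) _ (@moll_kernel_measurable R) (@moll_kernel_ge0 R)
  (@moll_kernel_bounded R) (@moll_kernel_dual_mass R) (@moll_measurable R)).
Qed.

(** Intervals are replaced by Borel sets one coordinate at a time, the box in the other coordinates
    playing the role of E. *)
Lemma approximable_box3 (A B C : set (measurableTypeR R)) :
  measurable A -> measurable B -> measurable C -> aset (box3 A B C).
Proof.
have lam a (E : set X) : aset E -> (forall I, box_side I -> aset (crd a @^-1` I `&` E)) ->
    forall I : set (measurableTypeR R), measurable I -> aset (crd a @^-1` I `&` E).
  move=> aE aI; apply: (@moll_lambda _ _ _ _ (@ocitv R)) => //.
  - exact: measurable_crd.
  - exact: ocitvI.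
  - by move=> I Ii; apply: aI; right.
have sT : box_side (setT : set R) by left.
have e0 (D E F : set R) : crd 0 @^-1` D `&` box3 setT E F = box3 D E F.
  by apply/seteqP; split => x; rewrite /box3/=; tauto.
have e1 (D E F : set R) : crd 1 @^-1` E `&` box3 D setT F = box3 D E F.
  by apply/seteqP; split => x; rewrite /box3/=; tauto.
have e2 (D E F : set R) : crd 2 @^-1` F `&` box3 D E setT = box3 D E F.
  by apply/seteqP; split => x; rewrite /box3/=; tauto.
have h0 (D E F : set R) : measurable (D : set (measurableTypeR R)) -> box_side E -> box_side F ->
    aset (box3 D E F).
  move=> mD sE sF; rewrite -e0; apply: lam => //; first exact: approximable_box3_side.
  by move=> I sI; rewrite e0; exact: approximable_box3_side.
have h1 (D E F : set R) : measurable (D : set (measurableTypeR R)) ->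
    measurable (E : set (measurableTypeR R)) -> box_side F -> aset (box3 D E F).
  move=> mD mE sF; rewrite -e1; apply: lam => //; first exact: h0.
  by move=> I sI; rewrite e1; exact: h0.
move=> mA mB mC; rewrite -e2; apply: lam => //; first exact: h1.
by move=> I sI; rewrite e2; exact: h1.
Qed.

(** The sigma-algebra is that of a product of a product, hence two further extensions: from
    rectangles to sets of the plane, then to sets of the space. *)
Lemma approximable_measurable (A : set X) : measurable A -> aset A.
Proof.
have setIX d1 d2 (T1 : measurableType d1) (T2 : measurableType d2) :
    setI_closed [set A `*` B | A in @measurable _ T1 & B in @measurable _ T2].
  move=> _ _ [A1 mA1 [B1 mB1 <-]] [A2 mA2 [B2 mB2 <-]].
  exists (A1 `&` A2); first exact: measurableI.
  by exists (B1 `&` B2); [exact: measurableI|rewrite setXI].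
have h (C : set (measurableTypeR R)) : measurable C ->
    forall B : set (measurableTypeR R * measurableTypeR R), measurable B -> aset (B `*` C).
  move=> mC B mB.
  have e (D : set (measurableTypeR R * measurableTypeR R)) :
      (fst : X -> _) @^-1` D `&` (setT `*` C) = D `*` C.
    by apply/seteqP; split => x /=; tauto.
  rewrite -e; move: B mB.
  apply: (@moll_lambda _ _ _ _ [set A `*` B | A in measurable & B in measurable]) => //.
  - exact: setIX.
  - by rewrite measurable_prod_measurableType.
  - by rewrite -setXTT; exact: approximable_box3.
  - by move=> _ [D mD [E mE <-]]; rewrite e; exact: approximable_box3.
move=> mA; rewrite -[A]setIT; rewrite -[A]/(id @^-1` A); move: A mA.
apply: (@moll_lambda _ _ _ _ [set A `*` B | A in measurable & B in measurable]) => //.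
- exact: setIX.
- by rewrite measurable_prod_measurableType.
- by rewrite -setXTT; exact: h.
- by move=> _ [D mD [E mE <-]]; rewrite setIT; exact: h.
Qed.

Lemma moll_contraction n f : integ mu (f : X -> R) ->
  integ mu (moll n f : X -> R) /\ \int[mu]_x (`|moll n f x| : R) <= \int[mu]_x (`|f x| : R).
Proof.
move=> iF; rewrite mollE//.
apply: (@kernel_op_contraction _ _ _ _ (torus_lty R) (@torus_tonelli_measurable R)
  (@torus_tonelli R) _ (@moll_kernel_measurable R) (@moll_kernel_ge0 R)
  (@moll_kernel_bounded R) (@moll_kernel_dual_mass R)
  (@moll_measurable R)) => //.
Qed.

Lemma moll_cvg f : integ mu (f : X -> R) ->
  (fun n => \int[mu]_x (`|moll n f x - f x| : R)) @ \oo --> 0.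
Proof.
move=> iF.
have [_] := approximable_all (torus_lty R) (@torus_tonelli_measurable R)
  (@torus_tonelli R) (@moll_kernel_measurable R) (@moll_kernel_ge0 R)
  (@moll_kernel_bounded R) (@moll_kernel_dual_mass R)
  (@moll_measurable R) (fun A mA => (approximable_measurable mA).2) iF.
rewrite (_ : (fun n => _) = (fun n => \int[mu]_x (`|moll n f x - f x| : R)))//.
by apply/funext => n; apply: eq_Rintegral => x _; rewrite mollE.
Qed.

End mollifier_convergence.

(** * Jensen's inequality for powers *)

Section jensen.
Context d (T : measurableType d) (R : realType).
Variable mu : {measure set T -> \bar R}.

(** With c the mean of g, Young's inequality bounds g(x) c^(p-1) by g(x)^p / p + (1 - 1/p) c^p.
    Integrating against k, of mass 1, gives c^p on the left, and the multiple of c^p on the right is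
    absorbed. *)
Lemma jensen_powR (p : R) (k g : T -> R) : 1 < p -> (forall x, 0 <= k x) -> (forall x, 0 <= g x) ->
  integ mu k -> \int[mu]_x k x = 1 -> integ mu (fun x => k x * g x) ->
  integ mu (fun x => k x * g x `^ p) ->
  (\int[mu]_x (k x * g x)) `^ p <= \int[mu]_x (k x * g x `^ p).
Proof.
move=> p1 k0 g0 ik k1 ikg ikgp; set c := \int[mu]_x (k x * g x).
have p0 : 0 < p by lra.
have c0 : 0 <= c by apply: Rintegral_ge0 => x _; rewrite mulr_ge0.
have q1 : (p^-1 + (p / (p - 1))^-1 = 1) by field; apply/andP; split; lra.
have q0 : 0 < p / (p - 1) by rewrite divr_gt0 ?subr_gt0.
have E : c * c `^ (p - 1) = c `^ p.
  have [->|cn0] := eqVneq c 0; first by rewrite mul0r powR0// gt_eqF.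
  rewrite -{1}[c]powRr1// -powRD; last by apply/implyP.
  by congr (_ `^ _); ring.
have E2 : (c `^ (p - 1)) `^ (p / (p - 1)) = c `^ p.
  by rewrite -powRrM; congr (_ `^ _); field; lra.
have H : c `^ (p - 1) * c <= p^-1 * \int[mu]_x (k x * g x `^ p) + (p / (p - 1))^-1 * c `^ p.
  have -> : (p / (p - 1))^-1 * c `^ p = \int[mu]_x (((p / (p - 1))^-1 * c `^ p) * k x).
    by rewrite RintZ// k1 mulr1.
  rewrite -!RintZ// -RintD; [|exact: integZ..].
  apply: le_Rint; [exact: integZ|by apply: integD; exact: integZ|].
  move=> x; have := conjugate_powR (g0 x) (powR_ge0 c (p - 1)) p0 q0 q1.
  rewrite E2 => h; have := ler_wpM2l (k0 x) h.
  by congr (_ <= _); [rewrite mulrCA mulrC|]; ring.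
move: H; rewrite mulrC E -[X in _ <= _ + X](_ : (1 - p^-1) * c `^ p = _); last first.
  by congr (_ * _); apply: (addrI p^-1); rewrite q1 addrC subrK.
rewrite mulrBl mul1r => H.
have : p^-1 * c `^ p <= p^-1 * \int[mu]_x (k x * g x `^ p) by lra.
by rewrite ler_pM2l// invr_gt0.
Qed.

End jensen.

(** * Weak derivatives *)

#[local] Opaque Rintegral spartial.

Section weak_derivatives.
Variable R : realType.
Local Notation X := (mspace3 R).
Local Notation mu := (@torus_measure R).
Implicit Types (f g u phi : space3 R -> R) (a b : 'I_3) (x z : space3 R).

(** A mollification of f at x is, up to a factor, the integral of f against the trigonometric
    polynomial [power_kernel n x]; all of them vanish, and they tend to f in L^1. *)
Lemma torus_ae_eq0 f : integ mu (f : X -> R) ->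
  (forall phi, trig phi -> \int[mu]_x (f x * phi x : R) = 0) ->
  {ae mu, forall x : X, f x = 0}.
Proof.
move=> iF fphi.
have T0 n : moll n f = fun=> 0.
  apply/funext => x; rewrite /moll (_ : \int[mu]_z _ = 0) ?mulr0//.
  rewrite -[RHS](fphi _ (conv_trigr x (conv_power_kernel R n))).
  by apply: eq_Rintegral => z _; rewrite mulrC.
have I0 : \int[mu]_x (`|f x| : R) = 0.
  have := moll_cvg iF; rewrite (_ : (fun n => _) = fun=> \int[mu]_x (`|f x| : R)).
    by move=> /(cvg_lim (@Rhausdorff R)); rewrite lim_cst.
  apply/funext => n; apply: eq_Rintegral => x _.
  by rewrite T0 sub0r normrN.
have := @Rint_eq0_ae _ _ _ mu _ (integ_norm iF) (aeW mu (fun x : X => normr_ge0 (f x))).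
rewrite I0 => /(_ (lexx _)); apply: ae_imp => x /eqP.
by rewrite normr_eq0 => /eqP.
Qed.

(** Duality in place of Schwarz's theorem: two integrations by parts move both derivatives onto a
    trigonometric polynomial, where they commute by induction. *)
Lemma test_spartialC phi a b : test_function phi ->
  {ae mu, forall x : X, spartial a (spartial b phi) x = spartial b (spartial a phi) x}.
Proof.
move=> tphi; have td c d : test_function (spartial c (spartial d phi)) by apply/test_spartial/test_spartial.
have ti c d := test_integ (td c d).
suff : {ae mu, forall x : X, spartial a (spartial b phi) x - spartial b (spartial a phi) x = 0}.
  by apply: ae_imp => x /eqP; rewrite subr_eq0 => /eqP.
apply: torus_ae_eq0 => [|psi tpsi]; first exact: integB.
have tt := trig_test tpsi.
have E c d : \int[mu]_x (spartial c (spartial d phi) x * psi x : R) =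
    \int[mu]_x (phi x * spartial d (spartial c psi) x : R).
  refine (etrans _ (etrans (test_by_parts c tt (test_spartial d tphi)) (etrans (f_equal -%R _)
    (etrans (f_equal -%R (test_by_parts d (test_spartial c tt) tphi)) (opprK _))))).
  - by apply: eq_Rintegral => x _; rewrite mulrC.
  - by apply: eq_Rintegral => x _; rewrite mulrC.
have E' : \int[mu]_x (phi x * spartial b (spartial a psi) x : R) =
    \int[mu]_x (phi x * spartial a (spartial b psi) x : R).
  by rewrite (trig_spartialC a b tpsi).
refine (etrans _ (etrans (RintB (integ_testM tt (ti a b)) (integ_testM tt (ti b a)))
  (etrans (f_equal2 (fun s t => s - t) (etrans (E a b) E') (E b a)) (subrr _)))).
by apply: eq_Rintegral => x _; rewrite mulrBl.
Qed.

(** Each side is minus the integral of y_i against a mixed second derivative of phi, and these agree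
    almost everywhere. *)
Lemma weak_gradient_curl_free (y : space3 R -> 'rV[R]_3) (F : space3 R -> 'M[R]_3) :
  (forall i, integ mu (fun x : X => y x 0 i)) -> weak_gradient y F -> curl_free F.
Proof.
move=> iy yF i a b phi tphi.
have m c d : measurable_fun setT (fun x : X => y x 0 i * spartial c (spartial d phi) x).
  by apply: measurable_funM; [exact: integ_mfun|apply: test_measurable; apply/test_spartial/test_spartial].
have E : torus_int (fun x => y x 0 i * spartial b (spartial a phi) x) =
    torus_int (fun x => y x 0 i * spartial a (spartial b phi) x).
  by apply: Rint_ae => //; apply: ae_imp (test_spartialC b a tphi) => x ->.
apply: oppr_inj.
exact: (etrans (esym (yF i b _ (test_spartial a tphi)))
  (etrans E (yF i a _ (test_spartial b tphi)))).
Qed.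

Lemma moll_subseq (J : finType) (f : J -> space3 R -> R) : (forall j, integ mu (f j : X -> R)) ->
  exists s : nat -> nat, {ae mu, forall x : X, forall j, moll (s n) (f j) x @[n --> \oo] --> f j x}.
Proof.
move=> iF.
have [n j|j|s [_ sP]] := @ae_cvg_subseq_L1 _ _ _ mu J (fun n j => moll n (f j)) f _ iF.
- by exact: (moll_contraction n (iF j)).1.
- exact: moll_cvg.
by exists s.
Qed.

(** Jensen's inequality for the probability density [moll_kernel n x] bounds the power of the
    mollification by the mollification of the power, to which the L^1 contraction applies. *)
Lemma moll_powR p n f : 1 < p -> Lq mu p (f : X -> R) ->
  Lq mu p (moll n f : X -> R) /\ \int[mu]_x (`|moll n f x| `^ p : R) <= \int[mu]_x (`|f x| `^ p : R).
Proof.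
move=> p1 lf; have iF : integ mu (f : X -> R) by apply: Lq_integ lf; [exact: torus_lty|exact: ltW].
have [_ ifp] := lf.
have [iT Tf] := moll_contraction n ifp.
have tn : trig (moll n f) by exact: moll_trig.
have ik x : integ mu (moll_kernel n x : X -> R).
  by apply: integ_ext (integZ (kernel_mass R n)^-1 (integ_power_kernel n x)) => z; rewrite mulrC.
have iK x g : integ mu (g : X -> R) -> integ mu (fun z : X => moll_kernel n x z * g z).
  apply: integ_K; first exact: moll_kernel_measurable.
  - exact: moll_kernel_ge0.
  - exact: moll_kernel_bounded.
have H x : `|moll n f x| `^ p <= moll n (fun x => `|f x| `^ p) x.
  rewrite !mollE// /kernel_op.
  have J := @jensen_powR _ _ _ mu p (moll_kernel n x : X -> R) (fun z => `|f z|) p1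
    (moll_kernel_ge0 n x) (fun z => normr_ge0 (f z)) (ik x) (moll_kernel_mass n x)
    (iK x _ (integ_norm iF)) (iK x _ ifp).
  refine (le_trans _ J).
  rewrite ge0_ler_powR ?nnegrE//; first by lra.
    by apply: Rintegral_ge0 => z _; rewrite mulr_ge0// moll_kernel_ge0.
  apply: (le_trans (le_norm_Rint (iK x _ iF))).
  by rewrite le_eqVlt; apply/orP; left; apply/eqP; apply: eq_Rintegral => z _; rewrite normrM ger0_norm// moll_kernel_ge0.
have [M TM] := test_bounded (trig_test tn).
have lT : Lq mu p (moll n f : X -> R).
  by apply: (Lq_bounded (torus_lty R) _ (trig_measurable tn) TM); lra.
split => //.
have -> : \int[mu]_x (`|f x| `^ p : R) = \int[mu]_x (`| `|f x| `^ p| : R).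
  by apply: eq_Rintegral => x _; rewrite [RHS]ger0_norm ?powR_ge0.
refine (le_trans _ Tf); apply: le_Rint; [by case: lT|exact: integ_norm|].
by move=> x; apply: le_trans (H x) (ler_norm _).
Qed.

Lemma moll_weak_cvg p (s : nat -> nat) f g : 1 < p -> Lq mu p (f : X -> R) ->
  Lq mu (p / (p - 1)) (g : X -> R) ->
  {ae mu, forall x : X, moll (s n) f x @[n --> \oo] --> f x} ->
  (\int[mu]_x (moll (s n) f x * g x : R)) @[n --> \oo] --> \int[mu]_x (f x * g x : R).
Proof.
move=> p1 lf lg fs; have H n := moll_powR n p1 lf.
have [] // := @cvg_Rint_weak _ _ _ mu p (\int[mu]_x (`|f x| `^ p : R))
  (fun n => moll (s n) f : X -> R) f g.
- by move=> n; have [] := H (s n).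
- by move=> n; have [] := H (s n).
- by case: lf.
Qed.

End weak_derivatives.

(** * Null-Lagrangians *)

#[local] Transparent unit_measure3 Rintegral spartial.

Section null_lagrangians.
Variable R : realType.
Implicit Types (F G V : 'M[R]_3) (i j k a b c : 'I_3) (B : ext_idx).

(* The indices are read in Z/3, which absorbs the signs. *)
Definition cyc_minor F i a : R :=
  F (i + 1) (a + 1) * F (i + 2) (a + 2) - F (i + 1) (a + 2) * F (i + 2) (a + 1).

Lemma sum3 (V : nmodType) (f : 'I_3 -> V) : \sum_i f i = f 0 + f 1 + f 2.
Proof.
rewrite 2!big_ord_recr big_ord1/=; congr (f _ + f _ + f _); exact/val_inj.
Qed.

Lemma ord3_addE : ((0 + 1)%R = 1 :> 'I_3) * ((0 + 2)%R = 2 :> 'I_3) *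
  ((1 + 1)%R = 2 :> 'I_3) * ((1 + 2)%R = 0 :> 'I_3) * ((2 + 1)%R = 0 :> 'I_3) *
  ((2 + 2)%R = 1 :> 'I_3).
Proof. by do ![split]; apply/val_inj. Qed.

Lemma levi_civita_sum (f : 'I_3 -> 'I_3 -> R) i :
  \sum_j \sum_k levi_civita R i j k * f j k = f (i + 1) (i + 2) - f (i + 2) (i + 1).
Proof.
rewrite !sum3; move: i; apply: ord3P; rewrite !ord3_addE /levi_civita;
  rewrite -![nat_of_ord 0]/0%N -![nat_of_ord 1]/1%N -![nat_of_ord 2]/2%N; by field.
Qed.

(** Each product occurs twice in the contracted sum, whence the factor 1/2 in the definition of the
    cofactors. *)
Lemma cofmxE F i a : cofmx F i a = cyc_minor F i a.
Proof.
have E j k : \sum_b \sum_c levi_civita R i j k * levi_civita R a b c * F j b * F k c =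
    levi_civita R i j k * (F j (a + 1) * F k (a + 2) - F j (a + 2) * F k (a + 1)).
  rewrite -(levi_civita_sum (fun b c => F j b * F k c)) mulr_sumr; apply: eq_bigr => b _.
  by rewrite mulr_sumr; apply: eq_bigr => c _; rewrite !mulrA.
rewrite mxE; under eq_bigr do under eq_bigr do rewrite E.
by rewrite levi_civita_sum /cyc_minor; field.
Qed.

Lemma det3E F : \det F = \sum_a F 0 a * cyc_minor F 0 a.
Proof.
rewrite (expand_det_row F 0) !sum3.
have E (A : 'M[R]_2) : \det A = A 0 0 * A 1 1 - A 0 1 * A 1 0.
  rewrite (expand_det_row A 0) 2!big_ord_recl big_ord0 /cofactor !det_mx11 !mxE/=.
  rewrite expr0 expr1 addr0 mul1r mulN1r mulrN.
  by congr (A _ _ * A _ _ - A _ _ * A _ _); exact/val_inj.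
rewrite /cofactor !E !mxE /cyc_minor !ord3_addE.
do ![rewrite (_ : lift _ _ = 0 :> 'I_3); last exact/val_inj | rewrite (_ : lift _ _ = 1 :> 'I_3); last exact/val_inj | rewrite (_ : lift _ _ = 2 :> 'I_3); last exact/val_inj].
rewrite -![nat_of_ord 0]/0%N -![nat_of_ord 1]/1%N -![nat_of_ord 2]/2%N; ring.
Qed.

Lemma is_derive_entry F V i a : is_derive F V (fun G => G i a : R) (V i a).
Proof.
have H : (fun h : R => h^-1 *: (((fun G => G i a : R) \o shift F) (h *: V) - F i a)) @ 0^' --> V i a.
  apply: cvg_near_cst; near=> h.
  by rewrite /= !mxE addrK /GRing.scale/= mulKf//; near: h; exact: nbhs_dnbhs_neq.
by split; [apply/cvg_ex; exists (V i a)|exact: cvg_lim].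
Unshelve. all: by end_near. Qed.

Lemma is_derive_cyc_minor F V i a : is_derive F V (fun G => cyc_minor G i a)
  (F (i + 1) (a + 1) * V (i + 2) (a + 2) + V (i + 1) (a + 1) * F (i + 2) (a + 2)
   - F (i + 1) (a + 2) * V (i + 2) (a + 1) - V (i + 1) (a + 2) * F (i + 2) (a + 1)).
Proof.
have d j b := is_derive_entry F V j b.
apply: is_derive_eq; rewrite /GRing.scale/=; ring.
Qed.

Lemma dPhi_F j b i a F : dPhi (inl (inl (j, b))) i a F = ((j == i) && (b == a))%:R.
Proof.
have := is_derive_entry F (delta_mx i a) j b; rewrite /dPhi /= => d.
by rewrite derive_val mxE.
Qed.

Lemma dPhi_cof k c i a F : dPhi (inl (inr (k, c))) i a F =
  F (k + 1) (c + 1) * (delta_mx i a : 'M[R]_3) (k + 2) (c + 2)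
  + (delta_mx i a : 'M[R]_3) (k + 1) (c + 1) * F (k + 2) (c + 2)
  - F (k + 1) (c + 2) * (delta_mx i a : 'M[R]_3) (k + 2) (c + 1)
  - (delta_mx i a : 'M[R]_3) (k + 1) (c + 2) * F (k + 2) (c + 1).
Proof.
have := is_derive_cyc_minor F (delta_mx i a) k c; rewrite /dPhi /= => d.
rewrite (_ : (fun G => _) = (fun G => cyc_minor G k c)) ?derive_val//.
by apply/funext => G; rewrite cofmxE.
Qed.

Lemma dPhi_det i a F : dPhi (inr tt) i a F = cyc_minor F i a.
Proof.
rewrite /dPhi /=.
rewrite (_ : (fun G => _) = (fun G => G 0 0 * cyc_minor G 0 0 + G 0 1 * cyc_minor G 0 1 + G 0 2 * cyc_minor G 0 2)); last first.
  by apply/funext => G; rewrite det3E sum3.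
have d j b := is_derive_entry F (delta_mx i a) j b.
have dd j b := is_derive_cyc_minor F (delta_mx i a) j b.
rewrite derive_val /cyc_minor /GRing.scale/= !mxE.
move: i a {d dd}; apply: ord3P; apply: ord3P; rewrite !ord3_addE/=; ring.
Qed.

End null_lagrangians.

#[local] Opaque unit_measure3 Rintegral spartial.

(** * The Piola identity *)

Section piola.
Variable R : realType.
Local Notation X := (mspace3 R).
Local Notation mu := (@torus_measure R).
Implicit Types (i j k a b c : 'I_3) (B : ext_idx) (chi u : space3 R -> R).
Variable F : space3 R -> 'M[R]_3.

(** The derivatives of F, of the cofactors and of the determinant have degree 0, 1 and 2 in F; the
    constants are counted in L^p as well, the measure being finite. *)
Definition dPhi_exponent (p : R) B : R := if B is inr _ then p / 2 else p.

Lemma dPhi_Lq (p : R) : 2 <= p -> (forall i a, Lq mu p (fun x : X => F x i a)) ->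
  forall B i a, Lq mu (dPhi_exponent p B) (fun x : X => dPhi B i a (F x)).
Proof.
move=> p2 lF; have p0 : 0 <= p by lra.
have lFZ (c : R) i a : Lq mu p (fun x : X => F x i a * c).
  by have := LqZ c (lF i a); under eq_fun do rewrite mulrC.
have lZF (c : R) i a : Lq mu p (fun x : X => c * F x i a) by exact: LqZ.
have lN f q : Lq mu q (f : X -> R) -> Lq mu q (fun x : X => - f x).
  by move=> /(LqZ (-1)); under eq_fun do rewrite mulN1r.
case=> [[[j b]|[j b]]|[]] i a.
- under eq_fun do rewrite dPhi_F.
  by apply: (@Lq_bounded _ _ _ mu (torus_lty R) p _ `|((j == i) && (b == a))%:R|).
- under eq_fun do rewrite dPhi_cof.
  refine (LqD p0 _ (lN _ _ (lZF _ _ _))); refine (LqD p0 _ (lN _ _ (lFZ _ _ _))).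
  exact: (LqD p0 (lFZ _ _ _) (lZF _ _ _)).
- under eq_fun do rewrite dPhi_det.
  have lM j b k c : Lq mu (p / 2) (fun x : X => F x j b * F x k c).
    by apply: Lq_mul; [lra|rewrite divfK//..].
  by apply: LqD (lM _ _ _ _) (lN _ _ (lM _ _ _ _)); lra.
Qed.

Hypothesis F2 : forall i a, Lq mu 2 (fun x : X => F x i a).
Hypothesis F_curl : curl_free F.

Let iF i a : integ mu (fun x : X => F x i a).
Proof. by apply: (Lq_integ (torus_lty R) _ (F2 i a)); rewrite ler1n. Qed.

Section piola_test.
Variable chi : space3 R -> R.
Hypothesis tchi : test_function chi.

Let J j b a : R := \int[mu]_x (F x j b * spartial a chi x : R).
Let iJ j b a : integ mu (fun x : X => F x j b * spartial a chi x).
Proof. exact: integ_testM (test_spartial a tchi) (iF j b). Qed.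
Let Jcurl j b a : J j b a = J j a b.
Proof. exact: F_curl. Qed.

Lemma piola_F j b i a : \int[mu]_x (dPhi (inl (inl (j, b))) i a (F x) * spartial a chi x : R) = 0.
Proof.
under eq_Rintegral do rewrite dPhi_F.
refine (etrans (RintZ _ (test_integ (test_spartial a tchi))) (etrans (f_equal _ (Rint_spartial a tchi)) (mulr0 _))).
Qed.

(** The integrand is linear in F, and the terms pair into differences [J j b a - J j a b], which
    vanish because F is curl-free. *)
Lemma piola_cof k c i :
  \sum_a \int[mu]_x (dPhi (inl (inr (k, c))) i a (F x) * spartial a chi x : R) = 0.
Proof.
have E a : \int[mu]_x (dPhi (inl (inr (k, c))) i a (F x) * spartial a chi x : R) =
    (delta_mx i a : 'M[R]_3) (k + 2) (c + 2) * J (k + 1) (c + 1) a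
  + (delta_mx i a : 'M[R]_3) (k + 1) (c + 1) * J (k + 2) (c + 2) a
  - (delta_mx i a : 'M[R]_3) (k + 2) (c + 1) * J (k + 1) (c + 2) a
  - (delta_mx i a : 'M[R]_3) (k + 1) (c + 2) * J (k + 2) (c + 1) a.
  rewrite -!RintZ; [|exact: iJ..].
  rewrite -RintD; [|exact: (integZ _ (iJ _ _ _))..].
  rewrite -RintB; [|apply: integD; exact: (integZ _ (iJ _ _ _))|exact: (integZ _ (iJ _ _ _))].
  rewrite -RintB; [|apply: integB; [apply: integD; exact: (integZ _ (iJ _ _ _))|exact: (integZ _ (iJ _ _ _))]|exact: (integZ _ (iJ _ _ _))].
  by apply: eq_Rintegral => x _; rewrite dPhi_cof; ring.
under eq_bigr do rewrite E.
have H (J1 J2 : 'I_3 -> 'I_3 -> R) (b1 b2 : bool) : (forall b a, J1 b a = J1 a b) ->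
    (forall b a, J2 b a = J2 a b) -> \sum_a ((b2 && (c + 2 == a))%:R * J1 (c + 1) a
      + (b1 && (c + 1 == a))%:R * J2 (c + 2) a - (b2 && (c + 1 == a))%:R * J1 (c + 2) a
      - (b1 && (c + 2 == a))%:R * J2 (c + 1) a) = 0.
  move=> C1 C2; rewrite sum3; move: c {E}; apply: ord3P; rewrite !ord3_addE /= ?andbT ?andbF (_ : false%:R = 0 :> R)//.
  - by rewrite (C1 1 2) (C2 2 1); ring.
  - by rewrite (C1 2 0) (C2 0 2); ring.
  - by rewrite (C1 0 1) (C2 1 0); ring.
under eq_bigr do rewrite !mxE; exact: H.
Qed.

Let Jdet (f : 'I_3 -> space3 R -> R) k a :=
  \int[mu]_x ((f (a + 1) x * F x k (a + 2) - f (a + 2) x * F x k (a + 1)) * spartial a chi x : R).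

(** One row of the minor is the gradient of a smooth u, and d_d u d_a chi = d_d (u d_a chi) - u d_d
    d_a chi. The first terms, collected in [K], cancel for each a because the other row is
    curl-free; the second, in [H], cancel only in the sum over a, by symmetry of the second
    derivatives of chi. *)
Lemma piola_det_test u k : test_function u -> \sum_a Jdet (fun a => spartial a u) k a = 0.
Proof.
move=> tu.
pose H c d e : R := \int[mu]_x (F x k c * (u x * spartial d (spartial e chi) x) : R).
have tdd d e : test_function (fun x => u x * spartial d (spartial e chi) x).
  by apply: test_functionM tu _; apply/test_spartial/test_spartial.
have iH c d e : integ mu (fun x : X => F x k c * (u x * spartial d (spartial e chi) x)).
  exact: (integ_testM (tdd d e) (iF k c)).
have HC c d e : H c d e = H c e d.
  apply: Rint_ae; [exact: integ_mfun (iH _ _ _)..|].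
  by apply: ae_imp (test_spartialC d e tchi) => x ->.
have tps a : test_function (fun x => u x * spartial a chi x).
  exact: test_functionM tu (test_spartial a tchi).
pose K c d a : R := \int[mu]_x (F x k c * spartial d (fun x => u x * spartial a chi x) x : R).
have iK c d a : integ mu (fun x : X => F x k c * spartial d (fun x => u x * spartial a chi x) x).
  exact: (integ_testM (test_spartial d (tps a)) (iF k c)).
have KC c d a : K c d a = K d c a by exact: (F_curl k d c (tps a)).
have E a : Jdet (fun a => spartial a u) k a =
    (K (a + 2) (a + 1) a - H (a + 2) (a + 1) a) - (K (a + 1) (a + 2) a - H (a + 1) (a + 2) a).
  rewrite -[X in _ = X - _]RintB; [|exact: iK|exact: iH].
  rewrite -[X in _ = _ - X]RintB; [|exact: iK|exact: iH].
  rewrite -RintB; [|by apply: integB; [exact: iK|exact: iH]..].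
  apply: eq_Rintegral => x _.
  have dM d : spartial d (fun x => u x * spartial a chi x) x =
      u x * spartial d (spartial a chi) x + spartial a chi x * spartial d u x.
    by rewrite spartialM// => z; [exact: test_derivable|exact/test_derivable/test_spartial].
  have ring_id (p q A B s v D1 D2 : R) : (p * A - q * B) * s =
      A * (v * D1 + s * p) - A * (v * D1) - (B * (v * D2 + s * q) - B * (v * D2)) by ring.
  rewrite [X in _ = F x k (a + 2) * X - _ - _]dM [X in _ = _ - (F x k (a + 1) * X - _)]dM.
  exact: ring_id.
under eq_bigr do rewrite E.
rewrite sum3 !ord3_addE; clear E iK iH; clearbody K H; rewrite (KC 2 1) (KC 0 2) (KC 1 0) (HC 2 1 0) (HC 0 2 1) (HC 1 0 2); ring.
Qed.

(** The minor is quadratic, but only one of its rows has to be smooth: it is replaced by its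
    mollification, which is the gradient of the mollified y, while the other row stays fixed in L^2
    and acts as the test function of a weak limit. *)
Lemma piola_det (y : 'I_3 -> space3 R -> R) : (forall i, integ mu (y i : X -> R)) ->
  (forall i a, weak_partial a (y i) (fun x => F x i a)) -> forall i,
  \sum_a \int[mu]_x (dPhi (inr tt) i a (F x) * spartial a chi x : R) = 0.
Proof.
move=> iy yF i.
have [s sP] := moll_subseq (fun a => iF (i + 1) a).
pose g k b a : X -> R := fun x => F x k b * spartial a chi x.
have lg k b a : Lq mu 2 (g k b a).
  have tda := test_spartial a tchi; have [M chiM] := test_bounded tda.
  rewrite /g; under eq_fun do rewrite mulrC.
  by apply: LqM_bounded (F2 k b) (test_measurable tda) chiM.
have l2 : (2 / (2 - 1) = 2 :> R) by field.
have il j b k c a : integ mu (fun x : X => F x j b * g k c a x).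
  exact: Lq2M (F2 j b) (lg k c a).
have ilm n b k c a : integ mu (fun x : X => moll n (fun x => F x (i + 1) b) x * g k c a x).
  apply: (integ_testMl (trig_test (moll_trig n (iF _ _)))).
  exact: integ_testM (test_spartial a tchi) (iF _ _).
pose L n : R := \sum_a Jdet (fun a => moll (s n) (fun x => F x (i + 1) a)) (i + 2) a.
have L0 n : L n = 0.
  rewrite -[RHS](piola_det_test (i + 2) (trig_test (moll_trig (s n) (iy (i + 1))))).
  apply: eq_bigr => a _; rewrite /Jdet; congr Rintegral; apply/funext => x.
  by rewrite !(moll_spartial (s n) (iy (i + 1)) (fun a => iF (i + 1) a) (fun a => yF (i + 1) a)).
have cv b c a : (\int[mu]_x (moll (s n) (fun x => F x (i + 1) b) x * g (i + 2) c a x : R))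
    @[n --> \oo] --> \int[mu]_x (F x (i + 1) b * g (i + 2) c a x : R).
  apply: (moll_weak_cvg (ltr1n _ 2) (F2 (i + 1) b)); first by rewrite l2.
  by apply: ae_imp sP => x; apply.
have JE f a : (forall b c, integ mu (fun x : X => f b x * g (i + 2) c a x)) ->
    Jdet f (i + 2) a = \int[mu]_x (f (a + 1) x * g (i + 2) (a + 2) a x : R) -
      \int[mu]_x (f (a + 2) x * g (i + 2) (a + 1) a x : R).
  move=> ifg; rewrite -RintB//; apply: eq_Rintegral => x _; rewrite /g; ring.
have cL : L n @[n --> \oo] --> \sum_a Jdet (fun a x => F x (i + 1) a) (i + 2) a.
  apply: (@cvg_big _ _ _ 0 xpredT add_continuous) => a _.
  rewrite JE//; under eq_fun do rewrite JE//.
  by apply: cvgB; exact: cv.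
have : \sum_a Jdet (fun a x => F x (i + 1) a) (i + 2) a = 0.
  apply: (@cvg_unique _ (@Rhausdorff R) _ _ _ _ cL).
  by rewrite (_ : L = fun=> 0); [exact: cvg_cst|exact/funext].
move=> Z; refine (etrans _ Z); apply: eq_bigr => a _; apply: eq_Rintegral => x _.
by rewrite dPhi_det.
Qed.

End piola_test.

Lemma piola (y : space3 R -> 'rV[R]_3) : (forall i, integ mu (fun x : X => y x 0 i)) ->
  weak_gradient y F -> forall chi, test_function chi -> forall B i,
  \sum_a \int[mu]_x (dPhi B i a (F x) * spartial a chi x : R) = 0.
Proof.
move=> iy yF chi tchi [[[j b]|[k c]]|[]] i.
- by apply: big1 => a _; exact: piola_F.
- exact: piola_cof.
- exact: (piola_det tchi iy yF).
Qed.

End piola.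

(** * Integrability of a function with integrable gradient *)

#[local] Transparent unit_measure3 Rintegral.

Section lebesgue_regularity.
Variable R : realType.
Local Notation X := (mspace3 R).
Local Notation X2 := (measurableTypeR R * measurableTypeR R)%type.
Local Notation mu := (@torus_measure R).
Local Notation nu := (@unit_measure R).
Local Notation nu2 := (@unit_measure2 R).
Implicit Types (u : space3 R -> R) (a b : 'I_3).

Lemma torus_tonelli2 (f : X -> \bar R) : measurable_fun setT f -> (forall x, 0 <= f x)%E ->
  (\int[mu]_x f x = \int[nu]_x2 \int[nu2]_x01 f (x01, x2))%E /\
  (\int[mu]_x f x = \int[nu2]_x01 \int[nu]_x2 f (x01, x2))%E.
Proof.
move=> mf f0; rewrite torus_integralE.
by split; [exact: (@fubini_tonelli2 _ _ _ _ _ nu2 nu)|exact: (@fubini_tonelli1 _ _ _ _ _ nu2 nu)].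
Qed.

Lemma unit2_tonelli (f : X2 -> \bar R) : measurable_fun setT f -> (forall x, 0 <= f x)%E ->
  (\int[nu2]_x f x = \int[nu]_x1 \int[nu]_x0 f (x0, x1))%E /\
  (\int[nu2]_x f x = \int[nu]_x0 \int[nu]_x1 f (x0, x1))%E.
Proof.
by move=> mf f0; split; [exact: (@fubini_tonelli2 _ _ _ _ _ nu nu)|exact: (@fubini_tonelli1 _ _ _ _ _ nu nu)].
Qed.

Lemma unit_integral_cst (c : \bar R) : (0 <= c)%E -> (\int[nu]_t c = c)%E.
Proof.
move=> c0; rewrite integral_cst//; refine (etrans (f_equal (mule c) _) (mule1 c)).
exact: unit_measureT.
Qed.

(** A Chebyshev argument: otherwise the sum of the [f i] divided by 3 (B i + 1) would be at least 1
    on the cube, while its integral is less than 1. The added 1 covers [B i] = 0. *)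
Lemma exists_bounded_point (f : 'I_3 -> X -> \bar R) (B : 'I_3 -> R) :
  (forall i, measurable_fun setT (f i)) -> (forall i x, 0 <= f i x)%E ->
  (forall i, 0 <= B i) -> (forall i, \int[mu]_x f i x <= (B i)%:E)%E ->
  exists2 z, unit_cube z & forall i, (f i z <= (3 * (B i + 1))%:E)%E.
Proof.
move=> mf f0 B0 fB; apply: contrapT => H.
pose k i := (3 * (B i + 1))^-1.
have k0 i : 0 < k i by rewrite invr_gt0 mulr_gt0// ltr_wpDl.
pose s x := (\sum_i (k i)%:E * f i x)%E.
have sk i x : (0 <= (k i)%:E * f i x)%E by rewrite mule_ge0// lee_fin (ltW (k0 i)).
have mk i : measurable_fun setT (fun x => (k i)%:E * f i x)%E.
  exact: measurable_funeM.
have s1 x : unit_cube x -> (1 <= s x)%E.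
  move=> Qx; have [i fi] : exists i, ~ (f i x <= (3 * (B i + 1))%:E)%E.
    by apply/existsNP => h; apply: H; exists x.
  move/negP: fi; rewrite -ltNge => fi.
  apply: (@le_trans _ _ ((k i)%:E * f i x)%E); last first.
    by rewrite /s (bigD1 i)//= leeDl// sume_ge0.
  have -> : 1%E = ((k i)%:E * (3 * (B i + 1))%:E)%E.
    by rewrite -EFinM mulVf// gt_eqF// mulr_gt0// ltr_wpDl.
  by apply: lee_wpmul2l; [rewrite lee_fin; exact: (ltW (k0 i))|exact: (ltW fi)].
have : (1 <= \int[mu]_x s x)%E.
  have <- : (\int[mu]_(x in setT) (cst 1 x) = 1)%E.
    by rewrite integral_cst// torus_measureT mule1.
  apply: ae_ge0_le_integral => //.
  - by move=> x _; rewrite sume_ge0.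
  - exact: emeasurable_sum.
  - by have := ae_unit_cube R; apply: ae_imp => x Qx _; exact: s1.
rewrite /s ge0_integral_sum//; apply/negP; rewrite -ltNge.
apply: (@le_lt_trans _ _ (\sum_i (k i * B i))%:E).
  rewrite -sumEFin; apply: lee_sum => i _.
  have ki : (0 <= (k i)%:E)%E by rewrite lee_fin; exact: (ltW (k0 i)).
  by rewrite ge0_integralZl// EFinM; exact: lee_wpmul2l.
have h i : k i * B i < 1 / 3.
  have p : 0 < B i + 1 by rewrite ltr_wpDl.
  rewrite /k mulrC ltr_pdivrMr ?mulr_gt0//.
  rewrite mulrA divfK//; lra.
by rewrite lte_fin sum3; have := h 0; have := h 1; have := h 2; lra.
Qed.

(** Seen as a function on the whole cube, the integral over a line has the same mean as q; a point
    can thus be chosen that is good for a function and for such traces at once. *)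
Lemma torus_average0 (q : X -> \bar R) : measurable_fun setT q -> (forall x, 0 <= q x)%E ->
  let g := fun z : X => (\int[nu]_t q (t, z.1.2, z.2))%E in
  measurable_fun setT g /\ (\int[mu]_z g z = \int[mu]_x q x)%E.
Proof.
move=> mq q0 g.
have m : measurable_fun [set: measurableTypeR R * (measurableTypeR R * measurableTypeR R)]
    (fun q' => q (q'.1, q'.2.1, q'.2.2)).
  apply: (measurableT_comp mq); apply: measurable_fun_pair; last exact: measurableT_comp.
  by apply: measurable_fun_pair => //; exact: measurableT_comp.
have H := measurable_fun_fubini_tonelli_G (m1 := nu) _ m (fun=> q0 _).
have mp : measurable_fun setT (fun z : X => (z.1.2, z.2)).
  by apply: measurable_fun_pair => //; exact: measurableT_comp.
have mg : measurable_fun setT g by exact: (measurableT_comp H mp).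
have g0 z : (0 <= g z)%E by exact: integral_ge0.
split => //.
refine (etrans (torus_tonelli2 mg g0).1 (etrans _ (esym (torus_tonelli2 mq q0).1))).
apply: eq_integral => x2 _.
have m2 (f : X -> \bar R) : measurable_fun setT f -> measurable_fun [set: X2] (fun x01 => f (x01, x2)).
  by move=> mf; apply: (measurableT_comp mf); exact: measurable_pair2.
refine (etrans (unit2_tonelli (m2 _ mg) (fun=> g0 _)).1
  (etrans _ (esym (unit2_tonelli (m2 _ mq) (fun=> q0 _)).1))).
by apply: eq_integral => x1 _; rewrite /g/= unit_integral_cst//; exact: integral_ge0.
Qed.

Lemma torus_average1 (q : X -> \bar R) : measurable_fun setT q -> (forall x, 0 <= q x)%E ->
  let g := fun z : X => (\int[nu2]_x q (x, z.2))%E in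
  measurable_fun setT g /\ (\int[mu]_z g z = \int[mu]_x q x)%E.
Proof.
move=> mq q0 g.
have mg : measurable_fun setT g.
  exact: (measurableT_comp (measurable_fun_fubini_tonelli_G (m1 := nu2) _ mq q0) measurable_snd).
have g0 z : (0 <= g z)%E by exact: integral_ge0.
split => //.
refine (etrans (torus_tonelli2 mg g0).1 (etrans _ (esym (torus_tonelli2 mq q0).1))).
apply: eq_integral => x2 _; rewrite /g/= integral_cst//.
refine (etrans (f_equal (mule _) _) (mule1 _)); exact: unit_measure2T.
Qed.

Variable p : R.
Hypothesis p1 : 1 < p.
Let c : R := 2 `^ p.

Let P u (x : X) : \bar R := (`|u x| `^ p)%:E.

Let P_ge0 u x : (0 <= P u x)%E.
Proof. by rewrite lee_fin powR_ge0. Qed.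

Let mP u : test_function u -> measurable_fun setT (P u).
Proof. by move=> tu; apply/measurable_EFinP; exact: (mfun_powR _ (test_measurable tu)). Qed.

(** The oscillation on the line is at most the integral of |d_a u|, whose p-th power is bounded by
    Jensen's inequality; the constant c = 2^p comes from the power of a sum. *)
Lemma unit_line_bound u a x (s : R) : test_function u -> s \in `[0, 1] ->
  (\int[nu]_t P u (upd a x t) <= c%:E * (P u (upd a x s) + \int[nu]_t P (spartial a u) (upd a x t)))%E.
Proof.
move=> tu s01; have [cdU dU] := test_upd a x tu.
have [M duM] := test_bounded (test_spartial a tu).
have mdU := measurable_dU cdU.
have fin : (nu [set: _] < +oo)%E by rewrite unit_measureT ltry.
have p0 : 0 <= p by exact: ltW (lt_trans ltr01 p1).
have idU : integ nu (fun t => `|spartial a u (upd a x t)|).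
  by apply: integ_norm; apply: (integ_bounded fin mdU (M := M)).
have idUp : integ nu (fun t => `|spartial a u (upd a x t)| `^ p).
  by have [] := @Lq_bounded _ _ _ nu fin p _ M p0 mdU (fun t => duM _).
pose D := \int[nu]_t `|spartial a u (upd a x t)|.
have D0 : 0 <= D by exact: Rintegral_ge0.
have DE : D `^ p <= \int[nu]_t (`|spartial a u (upd a x t)| `^ p).
  have E1 : (fun t => 1 * `|spartial a u (upd a x t)|) = (fun t => `|spartial a u (upd a x t)|).
    by apply/funext => t; rewrite mul1r.
  have E2 : (fun t => 1 * `|spartial a u (upd a x t)| `^ p) = (fun t => `|spartial a u (upd a x t)| `^ p).
    by apply/funext => t; rewrite mul1r.
  have := @jensen_powR _ _ _ nu p (fun=> 1) (fun t => `|spartial a u (upd a x t)|) p1.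
  rewrite E1 E2; apply => //; first exact: integ_cst.
  by apply: (congr1 fine (unit_integral_cst (c := 1%:E) _)); rewrite lee_fin.
rewrite -(EFin_Rint idUp) -EFinD -EFinM.
set K := c * _.
have -> : (K%:E = \int[nu]_t K%:E)%E by rewrite unit_integral_cst// lee_fin mulr_ge0 ?powR_ge0// addr_ge0 ?powR_ge0// Rintegral_ge0.
apply: ae_ge0_le_integral => //.
- apply/measurable_EFinP/mfun_powR.
  apply: continuous_measurable_fun => t.
  by apply: (@continuous_comp _ _ _ (upd a x) u); [exact: continuous_upd|exact: test_continuous].
- by move=> t _; rewrite lee_fin mulr_ge0 ?powR_ge0// addr_ge0 ?powR_ge0// Rintegral_ge0.
have : {ae nu, forall t, t \in `[0, 1]}.
  exists (~` `[0, 1]%classic); split => //; first by apply: measurableC; exact: measurable_itv.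
  by rewrite [LHS]/(mfrestr _ _ _) /mfrestr /mrestr setICl measure0.
apply: ae_imp => t t01 _; rewrite lee_fin /K.
have h : `|u (upd a x t)| <= `|u (upd a x s)| + D.
  have := unit_FTC_abs cdU dU s01 t01; rewrite -(EFin_Rint idU) lee_fin -/D.
  have := ler_normD (u (upd a x s)) (u (upd a x t) - u (upd a x s)); rewrite addrC subrK; lra.
apply: (le_trans (ge0_ler_powR p0 _ _ h)); rewrite ?nnegrE ?addr_ge0//.
apply: (le_trans (powRD_le p0 (normr_ge0 _) D0)).
by rewrite ler_wpM2l ?powR_ge0// lerD2l.
Qed.

Let G0 u (z : X) : \bar R := (\int[nu]_t P (spartial 0%R u) (t, z.1.2, z.2))%E.
Let G1 u (z : X) : \bar R := (\int[nu2]_x P (spartial 1%R u) (x, z.2))%E.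

(** The line bound is used in the directions 2, 1 and 0: from the cube to the plane x_2 = z_2, from
    this plane to a line, and from the line to the point z. [G1] and [G0] are the contributions of
    d_1 u on that plane and of d_0 u on that line. *)
Lemma cube_bound u z : test_function u -> unit_cube z ->
  (\int[mu]_x P u x <= c%:E * (c%:E * (c%:E * (P u z + G0 u z) + G1 u z) + \int[mu]_x P (spartial 2%R u) x))%E.
Proof.
move=> tu; case: z => -[z0 z1] z2 [[/= q0 q1] q2].
have c0 : (0 <= c%:E)%E by rewrite lee_fin powR_ge0.
have step d (T : measurableType d) (m : {measure set T -> \bar R}) (f1 f2 f3 : T -> \bar R) :
    measurable_fun setT f1 -> measurable_fun setT f2 -> measurable_fun setT f3 ->
    (forall x, 0 <= f1 x)%E -> (forall x, 0 <= f2 x)%E -> (forall x, 0 <= f3 x)%E ->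
    (forall x, f1 x <= c%:E * (f2 x + f3 x))%E ->
    (\int[m]_x f1 x <= c%:E * (\int[m]_x f2 x + \int[m]_x f3 x))%E.
  move=> m1 m2 m3 h1 h2 h3 h; rewrite -ge0_integralD// -ge0_integralZl//.
  - apply: ge0_le_integral => //.
      by apply: measurable_funeM; exact: emeasurable_funD.
  - exact: emeasurable_funD.
  - by move=> x _; rewrite adde_ge0.
have md a := mP (test_spartial a tu).
have m2 (f : X -> \bar R) : measurable_fun setT f -> measurable_fun [set: X2] (fun x01 => f (x01, z2)).
  by move=> mf; apply: (measurableT_comp mf); exact: measurable_pair2.
have m1 (f : X2 -> \bar R) : measurable_fun setT f -> measurable_fun [set: measurableTypeR R] (fun x0 => f (x0, z1)).
  by move=> mf; apply: (measurableT_comp mf); exact: measurable_pair2.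
have le2 (A B C : \bar R) : (A <= B)%E -> (c%:E * (A + C) <= c%:E * (B + C))%E.
  by move=> AB; rewrite lee_wpmul2l// leeD2r.
apply: (@le_trans _ _ (c%:E * (\int[nu2]_x P u (x, z2) + \int[mu]_x P (spartial 2%R u) x))%E).
  rewrite (torus_tonelli2 (mP tu) (@P_ge0 u)).2 (torus_tonelli2 (md 2) (@P_ge0 _)).2.
  apply: step.
  - exact: (measurable_fun_fubini_tonelli_F _ (mP tu)).
  - exact: (m2 _ (mP tu)).
  - exact: (measurable_fun_fubini_tonelli_F _ (md 2)).
  - by move=> x; exact: integral_ge0.
  - by [].
  - by move=> x; exact: integral_ge0.
  - move=> x; have := unit_line_bound 2 (x, 0) tu q2.
    by rewrite !updE/=; under eq_integral do rewrite updE; under [X in (_ <= _ * (_ + X))%E -> _]eq_integral do rewrite updE.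
refine (le2 _ _ _ _).
apply: (@le_trans _ _ (c%:E * (\int[nu]_x P u (x, z1, z2) + \int[nu2]_x P (spartial 1%R u) (x, z2)))%E).
  rewrite (unit2_tonelli (m2 _ (mP tu)) (fun=> P_ge0 _ _)).2 (unit2_tonelli (m2 _ (md 1)) (fun=> P_ge0 _ _)).2.
  apply: step.
  - exact: (measurable_fun_fubini_tonelli_F _ (m2 _ (mP tu))).
  - exact: (m1 _ (m2 _ (mP tu))).
  - exact: (measurable_fun_fubini_tonelli_F _ (m2 _ (md 1))).
  - by move=> x; exact: integral_ge0.
  - by [].
  - by move=> x; exact: integral_ge0.
  - move=> x; have := unit_line_bound 1 (x, 0, z2) tu q1.
    by rewrite !updE/=; under eq_integral do rewrite updE; under [X in (_ <= _ * (_ + X))%E -> _]eq_integral do rewrite updE.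
refine (le2 _ _ _ _).
have := unit_line_bound 0 (0, z1, z2) tu q0.
by rewrite !updE/=; under eq_integral do rewrite updE; under [X in (_ <= _ * (_ + X))%E -> _]eq_integral do rewrite updE.
Qed.

(* [u] is compared with its value at one point, chosen so that the traces of the
   gradient on the line and on the plane used for the comparison are controlled. *)
Lemma test_poincare u (A : R) (D : 'I_3 -> R) : test_function u -> 0 <= A ->
  (forall a, 0 <= D a) -> \int[mu]_x (`|u x| : R) <= A ->
  (forall a, \int[mu]_x (`|spartial a u x| `^ p : R) <= D a) ->
  \int[mu]_x (`|u x| `^ p : R) <=
    c * (c * (c * ((3 * (A + 1)) `^ p + 3 * (D 0 + 1)) + 3 * (D 1 + 1)) + D 2).
Proof.
move=> tu A0 D0 uA uD; have p0 : 0 <= p by exact: ltW (lt_trans ltr01 p1).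
have c0 : 0 <= c by rewrite powR_ge0.
have iP v : test_function v -> integ mu (fun x : X => `|v x| `^ p).
  move=> tv; have [M vM] := test_bounded tv.
  by have [] := Lq_bounded (torus_lty R) p0 (test_measurable tv) vM.
have IP v : test_function v -> (\int[mu]_x P v x = (\int[mu]_x (`|v x| `^ p : R))%:E)%E.
  by move=> tv; rewrite EFin_Rint//; exact: iP.
have md a := mP (test_spartial a tu).
have m2 v (z2 : R) : test_function v -> measurable_fun [set: X2] (fun x01 => P v (x01, z2)).
  by move=> tv; apply: (measurableT_comp (mP tv)); exact: measurable_pair2.
have uDE a : (\int[mu]_x P (spartial a u) x <= (D a)%:E)%E.
  by rewrite (IP _ (test_spartial a tu)) lee_fin.
have [mG0 IG0] := torus_average0 (md 0) (@P_ge0 _).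
have [mG1 IG1] := torus_average1 (md 1) (@P_ge0 _).
pose f (i : 'I_3) : X -> \bar R := if i == 0 then (fun x => `|u x|%:E) else if i == 1 then G0 u else G1 u.
pose B (i : 'I_3) : R := if i == 0 then A else if i == 1 then D 0 else D 1.
have [||||z Qz zB] := @exists_bounded_point f B.
- apply: ord3P => //.
  by apply/measurable_EFinP; apply: measurableT_comp => //; exact: test_measurable tu.
- by move=> i x; rewrite /f; case: ifP => _; [rewrite lee_fin|case: ifP => _; exact: integral_ge0].
- by apply: ord3P => //; exact: D0.
- apply: ord3P.
  + by rewrite /f /B/= -EFin_Rint ?lee_fin//; exact/integ_norm/test_integ.
  + refine (le_trans _ (uDE 0)); rewrite -IG0; exact: lexx.
  + refine (le_trans _ (uDE 1)); rewrite -IG1; exact: lexx.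
have zu := zB 0; have z0 := zB 1; have z1 := zB 2.
have H := cube_bound tu Qz; rewrite (IP _ tu) in H; rewrite -lee_fin.
have st (x y : \bar R) (r s : R) : (x <= r%:E)%E -> (y <= s%:E)%E ->
    (c%:E * (x + y) <= (c * (r + s))%:E)%E.
  by move=> xr ys; rewrite EFinM EFinD; apply: lee_wpmul2l; [rewrite lee_fin|exact: leeD].
refine (le_trans H _); refine (st _ _ _ _ (st _ _ _ _ (st _ _ _ _ _ z0) z1) (uDE 2)).
by rewrite lee_fin; apply: (ge0_ler_powR p0 _ _ zu); rewrite nnegrE// mulr_ge0 ?addr_ge0.
Qed.

(** The Poincare estimate holds for the mollifications uniformly in n, since mollifying increases
    neither the L^1 norm of y nor the L^p norms of its derivatives; Fatou's lemma transfers it to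
    y. *)
Lemma weak_partial_Lq (y : space3 R -> R) (F : 'I_3 -> space3 R -> R) :
  integ mu (y : X -> R) -> (forall a, Lq mu p (F a : X -> R)) ->
  (forall a, weak_partial a y (F a)) -> Lq mu p (y : X -> R).
Proof.
move=> iy lF yF; have p0 : 0 < p by exact: lt_trans p1.
have iF a : integ mu (F a : X -> R) by apply: (Lq_integ (torus_lty R) _ (lF a)); exact: ltW.
have [s sP] := @moll_subseq R unit (fun=> y) (fun=> iy).
pose A := \int[mu]_x (`|y x| : R).
pose D a := \int[mu]_x (`|F a x| `^ p : R).
pose K := c * (c * (c * ((3 * (A + 1)) `^ p + 3 * (D 0 + 1)) + 3 * (D 1 + 1)) + D 2).
have A0 : 0 <= A by exact: Rintegral_ge0.
have D0 a : 0 <= D a by apply: Rintegral_ge0 => x _; exact: powR_ge0.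
have H n : \int[mu]_x (`|moll n y x| `^ p : R) <= K.
  apply: (test_poincare (trig_test (moll_trig n iy)) A0 D0).
    exact: (moll_contraction n iy).2.
  move=> a; rewrite (moll_spartial n iy iF yF).
  exact: (moll_powR n p1 (lF a)).2.
have my : measurable_fun setT (y : X -> R) by exact: integ_mfun iy.
split => //.
have [|||||||//] := @fatou_Rint _ _ _ mu (fun n x => `|moll (s n) y x| `^ p)
  (fun x => `|y x| `^ p) (fun=> K) K.
- move=> n; have t := trig_test (moll_trig (s n) iy); have [M tM] := test_bounded t.
  by have [] := Lq_bounded (torus_lty R) (ltW p0) (test_measurable t) tM.
- by move=> n x; exact: powR_ge0.
- exact: mfun_powR.
- by move=> x; exact: powR_ge0.
- by apply: ae_imp sP => x /(_ tt) cv; exact: cvg_norm_powR.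
- by move=> n; exact: H.
- exact: cvg_cst.
Qed.

End lebesgue_regularity.

(** * The constraint set *)

#[local] Opaque Rintegral.

Notation state_idx := ('I_3 + energy_idx)%type.

Section state_coordinates.
Variable R : realType.
Local Notation X := (mspace3 R).
Local Notation mu := (@torus_measure R).
Implicit Types (y : state R) (k : state_idx) (z g : space3 R -> state R).

Definition scrd k y : R :=
  match k with inl i => vel y 0 i | inr j => ecoord j (ext y, ent y) end.

Definition of_scrd (c : state_idx -> R) : state R :=
  (\row_i c (inl i), (of_ecoord (fun j => c (inr j))).1, (of_ecoord (fun j => c (inr j))).2).

Lemma of_scrdK c k : scrd k (of_scrd c) = c k.
Proof.
case: k => [i|j]; first by rewrite /scrd /vel mxE.
by rewrite /scrd /ext /ent /of_scrd [X in ecoord j X]/=; exact: (of_ecoordK (fun j => c (inr j)) j).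
Qed.

Lemma scrdK y : of_scrd (scrd^~ y) = y.
Proof.
case: y => -[v xi] eta; rewrite /of_scrd.
have -> : (fun j : energy_idx => scrd (inr j) (v, xi, eta)) =
    (fun j => ecoord j (xi, eta)) by [].
rewrite ecoordK /=; congr (_, _, _); by apply/rowP => i; rewrite mxE.
Qed.

Lemma scrd_inj y y' : (forall k, scrd k y = scrd k y') -> y = y'.
Proof. by move=> h; rewrite -(scrdK y) -(scrdK y'); congr of_scrd; apply/funext. Qed.

Lemma scrdD k y y' : scrd k (y + y') = scrd k y + scrd k y'.
Proof. by case: k => [i|j]; [rewrite /= mxE|exact: (ecoordD j (ext y, ent y) (ext y', ent y'))]. Qed.

Lemma scrdZ k (t : R) y : scrd k (t *: y) = t * scrd k y.
Proof. by case: k => [i|j]; [rewrite /= mxE|exact: (ecoordZ j t (ext y, ent y))]. Qed.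

Lemma sum_energy_idx (f : energy_idx -> R) : \sum_j f j = \sum_B f (Some B) + f None.
Proof.
rewrite (bigD1 None)//= addrC; congr (_ + _).
by rewrite (reindex_omap Some id)//=; [apply: eq_bigl => B; rewrite eqxx|case].
Qed.

Lemma sum_state_idx (f : state_idx -> R) :
  \sum_k f k = \sum_i f (inl i) + \sum_B f (inr (Some B)) + f (inr None).
Proof. by rewrite big_sumType/= sum_energy_idx addrA. Qed.

Section exponents.
Variables p q rho l : R.

Definition state_exponent k : R :=
  match k with
  | inl _ => 2
  | inr (Some B) => ext_exponent p q rho B
  | inr None => l
  end.

Lemma state_spaceP z : (forall k, 1 <= state_exponent k) ->
  state_space p q rho l z <-> forall k, Lq mu (state_exponent k) (fun x : X => scrd k (z x)).
Proof.
move=> s1; split.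
  move=> [zv zx ze]; case=> [i|[B|]].
  - exact: (LfunE mu _ (s1 (inl i))).1 (zv i).
  - exact: (LfunE mu _ (s1 (inr (Some B)))).1 (zx B).
  - exact: (LfunE mu _ (s1 (inr None))).1 ze.
move=> zk; split.
- by move=> i; exact: (LfunE mu _ (s1 (inl i))).2 (zk (inl i)).
- by move=> B; exact: (LfunE mu _ (s1 (inr (Some B)))).2 (zk (inr (Some B))).
- exact: (LfunE mu _ (s1 (inr None))).2 (zk (inr None)).
Qed.

End exponents.

Lemma pairingE p q rho l g z : (forall k, 1 < state_exponent p q rho l k) ->
  (forall k, Lq mu (state_exponent p q rho l k) (fun x : X => scrd k (z x))) ->
  (forall k, Lq mu (conj_exp (state_exponent p q rho l k)) (fun x : X => scrd k (g x))) ->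
  pairing g z = \sum_k \int[mu]_x (scrd k (g x) * scrd k (z x) : R).
Proof.
move=> s1 lz lg.
have ik k : integ mu (fun x : X => scrd k (g x) * scrd k (z x)).
  by have := LqM (s1 k) (lz k) (lg k); apply: integ_ext => x; rewrite mulrC.
rewrite /pairing /torus_int.
refine (etrans _ (Rint_sum _ (fun k _ => ik k))).
by apply: eq_Rintegral => x _; rewrite sum_state_idx.
Qed.

Lemma conj_exponent p q rho l k :
  state_exponent (conj_exp p) (conj_exp q) (conj_exp rho) (conj_exp l) k =
  conj_exp (state_exponent p q rho l k).
Proof.
case: k => [i|[[[]|]|]] //=.
by rewrite /conj_exp; field.
Qed.

Lemma conj_exp_ge1 (s : R) : 1 < s -> 1 <= conj_exp s.
Proof. by move=> s1; rewrite /conj_exp ler_pdivlMr ?subr_gt0//; lra. Qed.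

End state_coordinates.

(** * The constraints as linear equations, and their weak closedness *)

Section constraint.
Variable R : realType.
Local Notation X := (mspace3 R).
Local Notation mu := (@torus_measure R).
Variables (p q rho l h : R) (e : ext_var R * R -> R) (r : space3 R -> R).
Variable z0 : space3 R -> state R.
Implicit Types (phi : space3 R -> R) (j : energy_idx) (k : state_idx) (z : space3 R -> state R).
Hypothesis p4 : 4 <= p.
Hypothesis q2 : 2 <= q.
Hypothesis rho1 : 1 < rho.
Hypothesis l1 : 1 < l.
Hypothesis h0 : 0 < h.
Local Notation sexp := (state_exponent p q rho l).

Lemma sexp_gt1 k : 1 < sexp k.
Proof.
case: k => [i|[[[]|]|]] //=; first by rewrite ltr1n.
- by move=> _; move: p4; lra.
- by move=> _; move: q2; lra.
Qed.

Definition in_space z := forall k, Lq mu (sexp k) (fun x : X => scrd k (z x)).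

Lemma in_spaceP z : state_space p q rho l z <-> in_space z.
Proof. by apply: state_spaceP => k; exact: ltW (sexp_gt1 k). Qed.

Hypothesis z0_space : in_space z0.
Local Notation heat := (heating e r z0).
Hypothesis heat_l : Lq mu l (heat : X -> R).
Let F0 x := Fpart (ext (z0 x)).

(* The two constraints of index [j] read [\sum_k \int cform phi j k * z_k = cval phi j]. *)
Definition cform phi j k (x : space3 R) : R :=
  match k with
  | inl i => if j is Some B then \sum_a dPhi B i a (F0 x) * spartial a phi x else 0
  | inr j' => (j == j')%:R * (h^-1 * phi x)
  end.

Definition cval phi j : R :=
  \int[mu]_x (h^-1 * phi x * ecoord j (ext (z0 x), ent (z0 x)) : R) +
  (if j is None then \int[mu]_x (heat x * phi x : R) else 0).

(** With 4 <= p even the cofactors, which are in L^(p/2), are square integrable and can be paired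
    with the velocity. *)
Lemma dPhi_L2 B i a : Lq mu 2 (fun x : X => dPhi B i a (F0 x)).
Proof.
have p2 : 2 <= p by move: p4; lra.
have := @dPhi_Lq R F0 p p2 (fun i a => z0_space (inr (Some (inl (inl (i, a)))))) B i a.
apply: Lq_le; [exact: torus_lty|by []|].
by case: B => [B|B] /=; move: p4; lra.
Qed.

Lemma Lq_test (s : R) phi : 0 <= s -> test_function phi -> Lq mu s (phi : X -> R).
Proof.
move=> s0 tphi; have [M phiM] := test_bounded tphi.
exact: (Lq_bounded (torus_lty R) s0 (test_measurable tphi) phiM).
Qed.

Lemma Lq_zero (s : R) : 0 <= s -> Lq mu s (fun=> 0 : R).
Proof. by move=> s0; apply: Lq_test => //; exact/trig_test/trig_cst. Qed.

Lemma conj_ge0 k : 0 <= conj_exp (sexp k).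
Proof. by have := conj_exp_ge1 (sexp_gt1 k); lra. Qed.

Lemma cform_Lq phi j k : test_function phi -> Lq mu (conj_exp (sexp k)) (cform phi j k : X -> R).
Proof.
move=> tphi; case: k => [i|j'] /=; last first.
  rewrite /cform; do 2 apply: LqZ.
  exact: Lq_test (conj_ge0 (inr j')) tphi.
have -> : conj_exp 2 = 2 :> R by rewrite /conj_exp; field.
case: j => [B|]; last by apply: Lq_zero; rewrite ler0n.
have H s : Lq mu 2 (fun x : X => \sum_(a <- s) dPhi B i a (F0 x) * spartial a phi x).
  elim: s => [|a s ih].
    by under eq_fun do rewrite big_nil; apply: Lq_zero; rewrite ler0n.
  under eq_fun do rewrite big_cons; apply: LqD => //.
  have [M phiM] := test_bounded (test_spartial a tphi).
  under eq_fun do rewrite mulrC.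
  exact: LqM_bounded _ (dPhi_L2 B i a) (test_measurable (test_spartial a tphi)) phiM.
exact: H.
Qed.

Lemma integ_cform phi j k z : test_function phi -> in_space z ->
  integ mu (fun x : X => cform phi j k x * scrd k (z x)).
Proof.
move=> tphi lz; have := LqM (sexp_gt1 k) (lz k) (cform_Lq j k tphi).
by apply: integ_ext => x; rewrite mulrC.
Qed.

Definition cint phi j z := \sum_k \int[mu]_x (cform phi j k x * scrd k (z x) : R).

Lemma in_space_integ z k : in_space z -> integ mu (fun x : X => scrd k (z x)).
Proof. by move=> /(_ k); apply: Lq_integ; [exact: torus_lty|exact: ltW (sexp_gt1 k)]. Qed.

Lemma cintE phi j z : test_function phi -> in_space z -> cint phi j z =
  \sum_i \int[mu]_x (cform phi j (inl i) x * scrd (inl i) (z x) : R) +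
  \int[mu]_x (h^-1 * phi x * ecoord j (ext (z x), ent (z x)) : R).
Proof.
move=> tphi lz; rewrite /cint big_sumType/=; congr (_ + _).
rewrite (bigD1 j)//= [X in _ + X]big1 ?addr0.
  by apply: eq_Rintegral => x _; rewrite eqxx mul1r.
move=> j' jj'; rewrite -[RHS](Rint_zero mu); apply: eq_Rintegral => x _.
by rewrite eq_sym (negbTE jj') !mul0r.
Qed.

Lemma constraintP z : in_space z -> constraint_set p q rho l h e r z0 z <->
  forall phi, test_function phi -> forall j, cint phi j z = cval phi j.
Proof.
move=> lz.
have E j phi : test_function phi ->
    torus_int (fun x => phi x * (h^-1 * (ecoord j (ext (z x), ent (z x)) - ecoord j (ext (z0 x), ent (z0 x))))) =
    \int[mu]_x (h^-1 * phi x * ecoord j (ext (z x), ent (z x)) : R) -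
    \int[mu]_x (h^-1 * phi x * ecoord j (ext (z0 x), ent (z0 x)) : R).
  move=> tphi.
  have ie z' : in_space z' -> integ mu (fun x : X => h^-1 * phi x * ecoord j (ext (z' x), ent (z' x))).
    move=> lz'; have := integ_testMl tphi (integZ h^-1 (in_space_integ (inr j) lz')).
    by apply: integ_ext => x; rewrite mulrA [phi x * _]mulrC.
  rewrite -RintB; [|exact: ie..].
  by apply: eq_Rintegral => x _; ring.
have V B phi : test_function phi -> torus_int (fun x => \sum_i \sum_a
    dPhi B i a (Fpart (ext (z0 x))) * vel (z x) 0 i * spartial a phi x) =
    \sum_i \int[mu]_x (cform phi (Some B) (inl i) x * scrd (inl i) (z x) : R).
  move=> tphi.
  refine (etrans _ (Rint_sum _ (fun i _ => integ_cform (Some B) (inl i) tphi lz))).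
  apply: eq_Rintegral => x _; apply: eq_bigr => i _; rewrite mulr_suml.
  by apply: eq_bigr => a _; rewrite mulrAC.
split.
  move=> [_ c1 c2] phi tphi [B|]; rewrite cintE//.
    have := c1 phi tphi B; rewrite (E (Some B))// V// => H.
    by rewrite /cval addr0; move: H; lra.
  have := c2 phi tphi; rewrite (E None)// => H; rewrite big1 ?add0r; last first.
    by move=> i _; rewrite -[RHS](Rint_zero mu); apply: eq_Rintegral => x _; rewrite mul0r.
  by rewrite /cval -[X in _ + X]H; ring.
move=> c; split; first exact/in_spaceP.
  move=> phi tphi B; rewrite (E (Some B))// V//.
  have := c phi tphi (Some B); rewrite cintE// /cval addr0; lra.
move=> phi tphi; rewrite (E None)//.
have := c phi tphi None; rewrite cintE// big1 ?add0r; last first.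
  by move=> i _; rewrite -[RHS](Rint_zero mu); apply: eq_Rintegral => x _; rewrite mul0r.
move=> ->; rewrite /cval addrC addKr//.
Qed.

Lemma constraint_in_space z : constraint_set p q rho l h e r z0 z -> in_space z.
Proof. by case=> /in_spaceP. Qed.

Lemma in_space_lin (s t : R) z z' : in_space z -> in_space z' ->
  in_space (fun x => s *: z x + t *: z' x).
Proof.
move=> lz lz' k; have s0 : 0 <= sexp k by have := sexp_gt1 k; lra.
have := LqD s0 (LqZ s (lz k)) (LqZ t (lz' k)).
by congr Lq; apply/funext => x; rewrite scrdD !scrdZ.
Qed.

Lemma cint_lin phi j (s t : R) z z' : test_function phi -> in_space z -> in_space z' ->
  cint phi j (fun x => s *: z x + t *: z' x) = s * cint phi j z + t * cint phi j z'.
Proof.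
move=> tphi lz lz'; rewrite /cint !mulr_sumr -big_split/=; apply: eq_bigr => k _.
have i1 := integ_cform j k tphi lz; have i2 := integ_cform j k tphi lz'.
rewrite -!RintZ// -RintD; [|exact: integZ..].
by apply: eq_Rintegral => x _; rewrite scrdD !scrdZ; ring.
Qed.

Lemma constraint_lin (t : R) z z' : constraint_set p q rho l h e r z0 z ->
  constraint_set p q rho l h e r z0 z' ->
  constraint_set p q rho l h e r z0 (fun x => t *: z x + (1 - t) *: z' x).
Proof.
move=> cz cz'; have lz := constraint_in_space cz; have lz' := constraint_in_space cz'.
apply/constraintP; first exact: in_space_lin.
move=> phi tphi j; rewrite cint_lin//.
by rewrite ((constraintP lz).1 cz)// ((constraintP lz').1 cz')//; ring.
Qed.

Lemma constraint_shift (t : R) z d : constraint_set p q rho l h e r z0 z -> in_space d ->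
  (forall phi, test_function phi -> forall j, cint phi j d = 0) ->
  constraint_set p q rho l h e r z0 (fun x => z x + t *: d x).
Proof.
move=> cz ld cd; have lz := constraint_in_space cz.
rewrite (_ : (fun x => z x + t *: d x) = (fun x => 1 *: z x + t *: d x)); last first.
  by apply/funext => x; rewrite scale1r.
apply/constraintP; first exact: in_space_lin.
by move=> phi tphi j; rewrite cint_lin// ((constraintP lz).1 cz)// cd// mul1r mulr0 addr0.
Qed.

(** The witness that the constraint set is nonempty: without velocity, xi does not move and the
    entropy is only heated. *)
Definition rest_state (x : space3 R) : state R := (0, ext (z0 x), ent (z0 x) + h * heat x).

Lemma rest_state_in_space : in_space rest_state.
Proof.
case=> [i|[B|]].
- rewrite (_ : (fun x : X => scrd (inl i) (rest_state x)) = fun=> 0).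
    by apply: Lq_zero; rewrite ler0n.
  by apply/funext => x; rewrite /scrd /vel/= mxE.
- exact: (z0_space (inr (Some B))).
- by apply: LqD (z0_space (inr None)) (LqZ h heat_l); move: l1; rewrite /=; lra.
Qed.

Lemma rest_state_constraint : constraint_set p q rho l h e r z0 rest_state.
Proof.
have ls := rest_state_in_space.
apply/constraintP => // phi tphi j; rewrite cintE// big1 ?add0r; last first.
  move=> i _; rewrite -[RHS](Rint_zero mu); apply: eq_Rintegral => x _.
  by rewrite /scrd /vel/= mxE mulr0.
rewrite /cval; case: j => [B|]; first by rewrite addr0.
have i1 : integ mu (fun x : X => h^-1 * phi x * ecoord None (ext (z0 x), ent (z0 x))).
  have := integ_testMl tphi (integZ h^-1 (in_space_integ (inr None) z0_space)).
  by apply: integ_ext => x; rewrite mulrA [phi x * _]mulrC.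
have ih : integ mu (heat : X -> R) by apply: (Lq_integ (torus_lty R) _ heat_l); exact: ltW.
rewrite -RintD; [|exact: i1|exact: integ_testM tphi ih].
apply: eq_Rintegral => x _; rewrite /rest_state /ecoord /ent /=.
by field; rewrite gt_eqF.
Qed.

Lemma constraint_ent z : constraint_set p q rho l h e r z0 z ->
  {ae mu, forall x : X, ent (z x) = ent (z0 x) + h * heat x}.
Proof.
move=> cz; have lz := constraint_in_space cz.
have ih : integ mu (heat : X -> R) by apply: (Lq_integ (torus_lty R) _ heat_l); exact: ltW.
have iz := in_space_integ (inr None) lz; have iz0 := in_space_integ (inr None) z0_space.
have id : integ mu (fun x : X => h^-1 * (ent (z x) - ent (z0 x))).
  exact: (integZ h^-1 (integB iz iz0)).
have : {ae mu, forall x : X, h^-1 * (ent (z x) - ent (z0 x)) - heat x = 0}.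
  apply: torus_ae_eq0; first exact: integB.
  move=> phi /trig_test tphi; have [_ _ /(_ phi tphi)] := cz.
  rewrite /torus_int => H.
  have i1 : integ mu (fun x : X => phi x * (h^-1 * (ent (z x) - ent (z0 x)))) by exact: integ_testMl.
  have i2 : integ mu (fun x : X => heat x * phi x) by exact: integ_testM.
  refine (etrans _ (etrans (RintB i1 i2) (etrans (f_equal (fun s => s - _) H) (subrr _)))).
  by apply: eq_Rintegral => x _; ring.
apply: ae_imp => x /eqP; rewrite subr_eq0 => /eqP <-.
by rewrite mulrA divff ?gt_eqF// mul1r addrC subrK.
Qed.

Lemma constraint_affine : affine_subspace p q rho l (constraint_set p q rho l h e r z0).
Proof.
split.
- by move=> z [].
- by exists rest_state; exact: rest_state_constraint.
- by move=> z z' t; exact: constraint_lin.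
Qed.

(** A state off the set violates the equation of some phi and some index j; this single functional
    separates it, the radius of the neighbourhood being the defect in that equation. *)
Lemma constraint_weakly_closed : weakly_closed p q rho l (constraint_set p q rho l h e r z0).
Proof.
move=> z /in_spaceP lz ncz.
have [phi [tphi [j nj]]] : exists phi, test_function phi /\ exists j, cint phi j z <> cval phi j.
  apply: contrapT => /forallNP H; apply: ncz; apply/constraintP => // phi tphi j.
  by apply: contrapT => nj; apply: (H phi); split => //; exists j.
pose g (x : space3 R) := of_scrd (fun k => cform phi j k x).
have gE k : (fun x => scrd k (g x)) = cform phi j k.
  by apply/funext => x; rewrite of_scrdK.
have lg k : Lq mu (conj_exp (sexp k)) (fun x : X => scrd k (g x)).
  by rewrite gE; exact: cform_Lq.
have pE z' : in_space z' -> pairing g z' = cint phi j z'.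
  move=> lz'; rewrite (pairingE sexp_gt1 lz' lg); apply: eq_bigr => k _.
  by apply: eq_Rintegral => x _; rewrite of_scrdK.
exists 1%N, (fun=> g), `|cint phi j z - cval phi j|; split.
- by rewrite normr_gt0 subr_eq0; exact/eqP.
- move=> _; apply/(state_spaceP (p := conj_exp p)) => k; rewrite conj_exponent; last exact: lg.
  exact: conj_exp_ge1 (sexp_gt1 k).
- move=> z' /in_spaceP lz' /(_ ord0); rewrite !pE// => d cz'.
  by move: d; rewrite ((constraintP lz').1 cz')// distrC ltxx.
Qed.

Lemma constraint_lim (u : nat -> space3 R -> state R) z :
  (forall n, constraint_set p q rho l h e r z0 (u n)) -> in_space z ->
  (forall k a, Lq mu (conj_exp (sexp k)) (a : X -> R) ->
    (\int[mu]_x (scrd k (u n x) * a x : R)) @[n --> \oo] --> \int[mu]_x (scrd k (z x) * a x : R)) ->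
  constraint_set p q rho l h e r z0 z.
Proof.
move=> cu lz uz; apply/constraintP => // phi tphi j.
have E z' k : \int[mu]_x (cform phi j k x * scrd k (z' x) : R) = \int[mu]_x (scrd k (z' x) * cform phi j k x : R).
  by apply: eq_Rintegral => x _; rewrite mulrC.
have : (fun n => cint phi j (u n)) @ \oo --> cint phi j z.
  rewrite /cint; apply: (@cvg_big _ _ _ 0 xpredT add_continuous) => k _.
  rewrite E; under eq_fun do rewrite E; exact: (uz k _ (cform_Lq j k tphi)).
rewrite (_ : (fun n => _) = fun=> cval phi j).
  by move=> H; apply: (@cvg_unique _ (@Rhausdorff R) _ _ _ _ H); exact: cvg_cst.
by apply/funext => n; rewrite ((constraintP (constraint_in_space (cu n))).1 (cu n)).
Qed.

End constraint.

(** * Minimization *)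

(** Each a_i is at most S^(1/s), where S is the sum of the powers; the crude constant |I|^s then
    serves for every s > 0. *)
Lemma powR_sum_le (R : realType) (I : finType) (s : R) (a : I -> R) : 0 < s ->
  (forall i, 0 <= a i) -> (\sum_i a i) `^ s <= #|I|%:R `^ s * \sum_i a i `^ s.
Proof.
move=> s0 a0; set S := \sum_i a i `^ s.
have S0 : 0 <= S by apply: sumr_ge0 => i _; exact: powR_ge0.
have aS i : a i <= S `^ s^-1.
  rewrite -[leLHS](@powRr1 _ (a i))// -(divff (lt0r_neq0 s0)) powRrM.
  rewrite ge0_ler_powR ?nnegrE ?powR_ge0 ?invr_ge0 ?(ltW s0)//.
  by rewrite /S (bigD1 i)//= lerDl; apply: sumr_ge0 => j _; exact: powR_ge0.
have : \sum_i a i <= #|I|%:R * S `^ s^-1.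
  by rewrite (le_trans (ler_sum _ (fun i _ => aS i)))// sumr_const mulr_natl.
move=> H; apply: (le_trans (ge0_ler_powR (ltW s0) _ _ H)); rewrite ?nnegrE ?sumr_ge0 ?mulr_ge0 ?powR_ge0//.
by rewrite powRM ?powR_ge0// -powRrM mulVf ?gt_eqF// powRr1.
Qed.

Section frobenius.
Variable R : realType.
Implicit Type A : 'M[R]_3.

Lemma frobE A : frob A = Num.sqrt (\sum_(k : 'I_3 * 'I_3) A k.1 k.2 ^+ 2).
Proof. by rewrite /frob pair_bigA. Qed.

Lemma frob_ge0 A : 0 <= frob A.
Proof. exact: sqrtr_ge0. Qed.

Lemma entry_le_frob A i j : `|A i j| <= frob A.
Proof.
rewrite frobE -sqrtr_sqr ler_sqrt ?sumr_ge0// => [|k _]; last exact: sqr_ge0.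
by rewrite (bigD1 (i, j))//= lerDl sumr_ge0// => k _; exact: sqr_ge0.
Qed.

Lemma frob_le_sum A : frob A <= \sum_(k : 'I_3 * 'I_3) `|A k.1 k.2|.
Proof.
have S0 : 0 <= \sum_(k : 'I_3 * 'I_3) `|A k.1 k.2| by exact: sumr_ge0.
rewrite frobE -[leRHS]ger0_norm// -sqrtr_sqr ler_sqrt ?sqr_ge0//.
rewrite expr2 mulr_suml; apply: ler_sum => k _.
rewrite -real_normK ?num_real// expr2 ler_wpM2l// (bigD1 k)//= lerDl; exact: sumr_ge0.
Qed.

Lemma frob_powR_ge (s : R) A : 0 <= s ->
  \sum_(k : 'I_3 * 'I_3) `|A k.1 k.2| `^ s <= 9 * frob A `^ s.
Proof.
move=> s0; have : \sum_(k : 'I_3 * 'I_3) `|A k.1 k.2| `^ s <= \sum_(k : 'I_3 * 'I_3) frob A `^ s.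
  by apply: ler_sum => k _; rewrite ge0_ler_powR ?nnegrE ?frob_ge0 ?entry_le_frob.
by move=> /le_trans; apply; rewrite sumr_const card_prod card_ord -[leLHS]mulr_natl.
Qed.

Lemma frob_powR_le (s : R) A : 0 < s ->
  frob A `^ s <= 9 `^ s * \sum_(k : 'I_3 * 'I_3) `|A k.1 k.2| `^ s.
Proof.
move=> s0; have := @powR_sum_le R _ s (fun k : 'I_3 * 'I_3 => `|A k.1 k.2|) s0 (fun=> normr_ge0 _).
rewrite card_prod card_ord; apply: le_trans.
by rewrite ge0_ler_powR ?nnegrE ?frob_ge0 ?(ltW s0) ?frob_le_sum ?sumr_ge0.
Qed.

End frobenius.

(** * Growth and measurability of the density of the functional *)

Section energy_density.
Variable R : realType.
Local Notation X := (mspace3 R).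
Local Notation mu := (@torus_measure R).
Variables (p q rho l : R) (e : ext_var R * R -> R).
Hypothesis p4 : 4 <= p.
Hypothesis q2 : 2 <= q.
Hypothesis rho1 : 1 < rho.
Hypothesis l1 : 1 < l.
Hypothesis e_C3 : C_k 3 e.
Hypothesis e_growth : energy_growth p q rho l e.
Hypothesis e_convex : strictly_convex e.
Local Notation sexp := (state_exponent p q rho l).
Local Notation in_space := (in_space p q rho l).
Implicit Types (y : state R) (k : state_idx) (z : space3 R -> state R).

Definition dens y : R := 2^-1 * (\sum_i vel y 0 i ^+ 2) + e (ext y, ent y).

Definition state_pow y : R := \sum_k `|scrd k y| `^ sexp k.

Lemma state_powE y : state_pow y = \sum_i `|vel y 0 i| `^ 2 +
  ((\sum_(k : 'I_3 * 'I_3) `|(ext y).1.1 k.1 k.2| `^ p +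
   \sum_(k : 'I_3 * 'I_3) `|(ext y).1.2 k.1 k.2| `^ q + `|(ext y).2| `^ rho) + `|ent y| `^ l).
Proof.
rewrite /state_pow sum_state_idx !big_sumType/= -!addrA; congr (_ + _).
congr (_ + _); first by apply: eq_bigr => -[].
congr (_ + _); first by apply: eq_bigr => -[].
by rewrite (big_pred1 tt)//; case.
Qed.

Lemma dens_bounds : exists kap K c : R, [/\ 0 < kap, 0 < K, 0 < c & forall y, 0 <= ent y ->
  kap * state_pow y - c <= dens y <= K * state_pow y + c].
Proof.
have [c1 [c2 [c3 [c4 [c10 c20 c30 c40 H]]]]] := e_growth.
have p0 : 0 < p by move: p4; lra.
have q0 : 0 < q by move: q2; lra.
(* The 1/2 is that of the kinetic energy and 9 is the number of entries of a matrix: the powers of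
   the entries sum to at most 9 times the power of the Frobenius norm, which conversely costs a
   factor 9^p or 9^q in [K]. *)
pose kap := Num.min (1 / 2) (c1 / 9).
pose K := 1 + c3 * (9 `^ p + 9 `^ q + 1).
have kap0 : 0 < kap by rewrite lt_min !divr_gt0.
have K0 : 0 < K by rewrite ltr_wpDr// mulr_ge0 ?(ltW c30)// !addr_ge0 ?powR_ge0.
exists kap, K, (c2 + c4); split => //; first exact: addr_gt0.
move=> y y0; have := H (ext y).1.1 (ext y).1.2 (ext y).2 (ent y) y0.
rewrite /dens state_powE (_ : ((ext y).1.1, (ext y).1.2, (ext y).2, ent y) = (ext y, ent y)); last first.
  by case: (y) => -[v [[F zeta] w]] eta.
have -> : \sum_i `|vel y 0 i| `^ 2 = \sum_i vel y 0 i ^+ 2.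
  by apply: eq_bigr => i _; rewrite powR_mulrn// real_normK// num_real.
rewrite /growth_fun.
have hF1 := frob_powR_ge (ext y).1.1 (ltW p0); have hF2 := frob_powR_le (ext y).1.1 p0.
have hz1 := frob_powR_ge (ext y).1.2 (ltW q0); have hz2 := frob_powR_le (ext y).1.2 q0.
have V0 : 0 <= \sum_i vel y 0 i ^+ 2 by apply: sumr_ge0 => i _; exact: sqr_ge0.
have SF0 : 0 <= \sum_(k : 'I_3 * 'I_3) `|(ext y).1.1 k.1 k.2| `^ p by apply: sumr_ge0 => k _; exact: powR_ge0.
have Sz0 : 0 <= \sum_(k : 'I_3 * 'I_3) `|(ext y).1.2 k.1 k.2| `^ q by apply: sumr_ge0 => k _; exact: powR_ge0.
have w0 := powR_ge0 `|(ext y).2| rho; have n0 := powR_ge0 `|ent y| l.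
have p9 := powR_ge0 (9 : R) p; have q9 := powR_ge0 (9 : R) q.
have k1 : kap <= 1 / 2 by rewrite ge_min lexx.
have k2 : kap * 9 <= c1 by rewrite -ler_pdivlMr// ge_min lexx orbT.
have fF0 := powR_ge0 (frob (ext y).1.1) p; have fz0 := powR_ge0 (frob (ext y).1.2) q.
rewrite /K.
move: hF1 hF2 hz1 hz2 V0 SF0 Sz0 w0 n0 p9 q9 k1 k2 fF0 fz0 kap0 c10 c30 c40 c20.
set V := \sum_i vel y 0 i ^+ 2; set SF := \sum_k `|(ext y).1.1 k.1 k.2| `^ p.
set Sz := \sum_k `|(ext y).1.2 k.1 k.2| `^ q; set W := `|(ext y).2| `^ rho.
set N := `|ent y| `^ l; set P := 9 `^ p; set Q := 9 `^ q.
set fF := frob (ext y).1.1 `^ p; set fz := frob (ext y).1.2 `^ q; set E := e (ext y, ent y).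
move: V SF Sz W N P Q fF fz E kap {K K0 H} => V SF Sz W N P Q fF fz E kap.
move=> hF1 hF2 hz1 hz2 V0 SF0 Sz0 w0 n0 p9 q9 k1 k2 fF0 fz0 kap0 c10 c30 c40 c20 /andP[E1 E2].
apply/andP; split.
  have a1 : kap * V <= 1 / 2 * V by rewrite ler_wpM2r.
  have a2 : kap * SF <= c1 * fF.
    by apply: (le_trans (ler_wpM2l (ltW kap0) hF1)); rewrite mulrA ler_wpM2r.
  have a3 : kap * Sz <= c1 * fz.
    by apply: (le_trans (ler_wpM2l (ltW kap0) hz1)); rewrite mulrA ler_wpM2r.
  have kc : kap <= c1 by lra.
  have a4 : kap * W <= c1 * W by rewrite ler_wpM2r.
  have a5 : kap * N <= c1 * N by rewrite ler_wpM2r.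
  move: E1; rewrite !mulrDr; lra.
have b1 : c3 * fF <= c3 * (P * SF) by rewrite ler_pM2l.
have b2 : c3 * fz <= c3 * (Q * Sz) by rewrite ler_pM2l.
have m1 : 0 <= c3 * P * V by rewrite !mulr_ge0// ltW.
have m2 : 0 <= c3 * P * W by rewrite !mulr_ge0// ltW.
have m3 : 0 <= c3 * P * N by rewrite !mulr_ge0// ltW.
have m4 : 0 <= c3 * P * Sz by rewrite !mulr_ge0// ltW.
have m5 : 0 <= c3 * Q * V by rewrite !mulr_ge0// ltW.
have m6 : 0 <= c3 * Q * W by rewrite !mulr_ge0// ltW.
have m7 : 0 <= c3 * Q * N by rewrite !mulr_ge0// ltW.
have m8 : 0 <= c3 * Q * SF by rewrite !mulr_ge0// ltW.
have m9 : 0 <= c3 * V by rewrite !mulr_ge0// ltW.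
have m10 : 0 <= c3 * SF by rewrite !mulr_ge0// ltW.
have m11 : 0 <= c3 * Sz by rewrite !mulr_ge0// ltW.
have E3 := le_trans E2 (lexx _).
have -> : (1 + c3 * (P + Q + 1)) * (V + (SF + Sz + W + N)) =
  V + SF + Sz + W + N + (c3 * P * V + c3 * (P * SF) + c3 * P * Sz + c3 * P * W + c3 * P * N)
  + (c3 * Q * V + c3 * Q * SF + c3 * (Q * Sz) + c3 * Q * W + c3 * Q * N)
  + (c3 * V + c3 * SF + c3 * Sz + c3 * W + c3 * N) by ring.
move: E3; rewrite !mulrDr; lra.
Qed.

(** The energy is continuous on the half-space only; the approximation by rounded coordinates does
    not leave it. *)
Lemma dens_measurable z : (forall k, measurable_fun setT (fun x : X => scrd k (z x))) ->
  (forall x, 0 <= ent (z x)) -> measurable_fun setT (fun x : X => dens (z x)).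
Proof.
move=> mz z0; apply: measurable_funD.
  apply: measurable_funM => //; apply: measurable_sum => i.
  exact: (measurable_funX 2 (mz (inl i))).
have -> : (fun x : X => e (ext (z x), ent (z x))) =
    (fun x : X => (fun c : energy_idx -> R => e (of_ecoord c)) (fun j => scrd (inr j) (z x))).
  apply/funext => x; congr e.
  by rewrite -[LHS]ecoordK.
apply: (@measurable_comp_continuous _ _ _ _ (fun c => 0 <= c None) (fun c => e (of_ecoord c))
  (fun (x : X) j => scrd (inr j) (z x))).
- by move=> j; exact: (mz (inr j)).
- exact: z0.
- move=> n v v0; rewrite /discretize divr_ge0// ler0z floor_ge0 mulr_ge0//.
- move=> v v0 eps eps0.
  have hc := C_k_hcont e_C3 (s := [::]) (leq0n _).
  have Hv : half_space (of_ecoord v) by [].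
  have [del del0 dP] := hc _ Hv _ eps0; exists del => // v' v'0 vv'.
  by apply: dP => // j; rewrite !of_ecoordK.
Qed.

Lemma state_pow_ge0 y : 0 <= state_pow y.
Proof. by apply: sumr_ge0 => k _; exact: powR_ge0. Qed.

Lemma integ_state_pow z : in_space z -> integ mu (fun x : X => state_pow (z x)).
Proof. by move=> lz; apply: integ_sum => k _; case: (lz k). Qed.

Lemma integ_dens z : in_space z -> (forall x, 0 <= ent (z x)) ->
  integ mu (fun x : X => dens (z x)).
Proof.
move=> lz z0; have [kap [K [c [kap0 K0 c0 H]]]] := dens_bounds.
apply: integ_le (integD (integZ K (integ_state_pow lz)) (integ_cst (torus_lty R) c)).
  by apply: dens_measurable => // k; case: (lz k).
move=> x; have /andP[h1 h2] := H (z x) (z0 x); rewrite ler_norml h2 andbT.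
have := state_pow_ge0 (z x) => s0.
have := mulr_ge0 (ltW kap0) s0; have := mulr_ge0 (ltW K0) s0; lra.
Qed.

End energy_density.

(** Multiplied by the indicator of the complement of a measurable null set, the sequence converges
    everywhere, and its limit is measurable. *)
Lemma ae_cvg_measurable_limit d (T : measurableType d) (R : realType)
    (mu : {measure set T -> \bar R}) (J : Type) (u : nat -> J -> T -> R) :
  (forall n j, measurable_fun setT (u n j)) ->
  {ae mu, forall x j, cvgn (fun n => u n j x)} ->
  exists w : J -> T -> R, (forall j, measurable_fun setT (w j)) /\
    {ae mu, forall x j, u n j x @[n --> \oo] --> w j x}.
Proof.
move=> mu_ [N [mN N0 NP]].
pose u' n j x := \1_(~` N) x * u n j x.
have cu' j x : cvgn (fun n => u' n j x).
  have [Nx|Nx] := pselect (N x).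
    rewrite (_ : (fun n => _) = fun=> 0); first exact: is_cvg_cst.
    by apply/funext => n; rewrite /u' indicE in_setC mem_set// mul0r.
  have cx : cvgn (fun n => u n j x).
    by apply: contrapT => nc; apply: Nx; apply: NP => /= /(_ j).
  rewrite (_ : (fun n => _) = fun n => u n j x)//.
  by apply/funext => n; rewrite /u' indicE in_setC memNset// mul1r.
exists (fun j x => limn (fun n => u' n j x)); split.
  move=> j; apply: (measurable_fun_cvg (h := fun n => u' n j)).
    by move=> n; apply: measurable_funM => //; apply: measurable_indic; exact: measurableC.
  by move=> x _; exact: cu'.
exists N; split => // x /= nx; apply: contrapT => Nx; apply: nx => j.
have E : (fun n => u n j x) = fun n => u' n j x.
  by apply/funext => n; rewrite /u' indicE in_setC memNset// mul1r.
by rewrite E; exact: cu'.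
Qed.

(** * Strict convexity of the density *)

Section dens_convexity.
Variable R : realType.
Variable e : ext_var R * R -> R.
Hypothesis e_C3 : C_k 3 e.
Hypothesis e_convex : strictly_convex e.
Implicit Types (y : state R) (k : state_idx).

Definition side k : set R := if k is inr None then [set t | 0 <= t] else setT.

Definition cdens (c : state_idx -> R) : R := dens e (of_scrd c).

Lemma cdensE c : cdens c = 2^-1 * (\sum_i c (inl i) ^+ 2) + e (of_ecoord (fun j => c (inr j))).
Proof.
rewrite /cdens /dens; congr (_ * _ + _).
by apply: eq_bigr => i _; rewrite /vel mxE.
Qed.

Lemma side_None c : (forall k, side k (c k)) -> half_space (of_ecoord (fun j => c (inr j))).
Proof. by move=> /(_ (inr None)). Qed.

Lemma side_closed k : closed (side k).
Proof. by case: k => [i|[B|]] /=; [exact: closedT|exact: closedT|exact: closed_ge]. Qed.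

Lemma side_mid k (a b : R) : side k a -> side k b -> side k ((a + b) / 2).
Proof. by case: k => [i|[B|]] //= a0 b0; rewrite divr_ge0// addr_ge0. Qed.

Lemma cdens_cont : cont_on_box side cdens.
Proof.
move=> v Av eps eps0.
have hc := C_k_hcont e_C3 (s := [::]) (leq0n _).
have e2 : 0 < eps / 2 by rewrite divr_gt0.
have [d1 d10 d1P] := hc _ (side_None Av) _ e2.
(* Since [del] is at most 1, each |v' + v| is at most 1 + 2 |v|, so [del * S] bounds the variation
   of the sum of squares. *)
pose S := \sum_(i < 3) (1 + 2 * `|v (inl i)|).
have S0 : 0 < S.
  rewrite /S sum3; have := normr_ge0 (v (inl 0)); have := normr_ge0 (v (inl 1)).
  have := normr_ge0 (v (inl 2)); lra.
pose del := Num.min d1 (Num.min 1 (eps / S)).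
have del0 : 0 < del by rewrite !lt_min d10 ltr01 divr_gt0.
have dd1 : del <= d1 by rewrite ge_min lexx.
have dl1 : del <= 1 by rewrite !ge_min lexx !orbT.
have delS : del * S <= eps by rewrite -ler_pdivlMr// !ge_min lexx !orbT.
exists del => // v' Av' vv'; rewrite !cdensE.
have E1 : `|e (of_ecoord (fun j => v' (inr j))) - e (of_ecoord (fun j => v (inr j)))| < eps / 2.
  by apply: d1P; [exact: side_None|move=> j; rewrite !of_ecoordK; exact: lt_le_trans (vv' _) dd1].
have E2 : `|\sum_(i < 3) v' (inl i) ^+ 2 - \sum_(i < 3) v (inl i) ^+ 2| <= del * S.
  rewrite -sumrB (le_trans (ler_norm_sum _ _ _))// /S mulr_sumr; apply: ler_sum => i _.
  rewrite subr_sqr normrM; apply: ler_pM => //; first exact: ltW.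
  rewrite (_ : v' _ + v _ = (v' (inl i) - v (inl i)) + 2 * v (inl i)); last ring.
  rewrite (le_trans (ler_normD _ _))// normrM ger0_norm// lerD2r.
  exact: ltW (lt_le_trans (vv' _) dl1).
rewrite (_ : _ - _ = 2^-1 * (\sum_(i < 3) v' (inl i) ^+ 2 - \sum_(i < 3) v (inl i) ^+ 2) +
   (e (of_ecoord (fun j => v' (inr j))) - e (of_ecoord (fun j => v (inr j))))); last ring.
apply: (le_lt_trans (ler_normD _ _)); rewrite normrM ger0_norm//.
move: E1 E2 delS; set A := `|e _ - _|; set B := `|_ - _|; lra.
Qed.

(** The kinetic part has gap |u - v|^2 / 8 and the energy part is strictly convex: whichever
    component differs provides positivity. *)
Lemma cdens_gap u v : (forall k, side k (u k)) -> (forall k, side k (v k)) ->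
  (exists k, u k != v k) -> 0 < convex_gap cdens u v.
Proof.
move=> Au Av [k0 uv].
pose ue := of_ecoord (fun j => u (inr j)); pose ve := of_ecoord (fun j => v (inr j)).
have mE : of_ecoord (fun j => midpoint u v (inr j)) = ue + (1 / 2) *: (ve - ue).
  apply: ecoord_inj => j; rewrite ecoordD ecoordZ ecoordB !of_ecoordK /midpoint; lra.
have E : convex_gap cdens u v = \sum_(i < 3) (u (inl i) - v (inl i)) ^+ 2 / 8 +
    ((e ue + e ve) / 2 - e (ue + (1 / 2) *: (ve - ue))).
  by rewrite /convex_gap !cdensE mE -/ue -/ve !sum3 /midpoint; field.
have V0 : 0 <= \sum_(i < 3) (u (inl i) - v (inl i)) ^+ 2 / 8.
  by apply: sumr_ge0 => i _; rewrite divr_ge0// sqr_ge0.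
rewrite E; have [uve|uve] := eqVneq ue ve.
  rewrite uve subrr scaler0 addr0 (_ : (_ + _) / 2 - _ = 0) ?addr0; last by lra.
  case: k0 uv => [i|j] uv; last first.
    by move: uv; rewrite -(of_ecoordK (fun j => u (inr j)) j) -/ue uve of_ecoordK eqxx.
  rewrite (bigD1 i)//= ltr_pwDl ?sumr_ge0// => [|j _]; last by rewrite divr_ge0// sqr_ge0.
  by rewrite divr_gt0// exprn_even_gt0//= subr_eq0.
apply: ltr_pwDr => //; rewrite subr_gt0.
by apply: strictly_convex_midpoint => //; exact: side_None.
Qed.

(** If some coordinate is large, the second term is at least 1; if u and v are close, the first
    suffices; otherwise the gap is at least the constant of [convex_gap_lbound]. Once integrated,
    the distance in measure is bounded through L^1 norms and the integral of the gap. *)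
Lemma cut_dist_gap (M eps : R) : 0 < M -> 0 < eps -> exists2 c, 0 < c &
  forall u v, (forall k, side k (u k)) -> (forall k, side k (v k)) ->
    cut_dist u v <= eps + (\sum_k (`|u k| + `|v k|)) / M + convex_gap cdens u v / c.
Proof.
move=> M0 eps0.
have [c c0 cP] := convex_gap_lbound side_closed side_mid cdens_cont cdens_gap M eps0.
exists c => // u v Au Av.
have g0 : 0 <= convex_gap cdens u v by apply: (convex_gap_ge0 cdens_gap).
have S0 : 0 <= \sum_k (`|u k| + `|v k|) by apply: sumr_ge0 => k _; exact: addr_ge0.
have SM0 : 0 <= (\sum_k (`|u k| + `|v k|)) / M by rewrite divr_ge0// ltW.
have gc0 : 0 <= convex_gap cdens u v / c by rewrite divr_ge0// ltW.
have d1 : cut_dist u v <= 1 by rewrite ge_min lexx.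
have big k : M <= `|u k| + `|v k| -> 1 <= (\sum_k (`|u k| + `|v k|)) / M.
  move=> Mk; rewrite ler_pdivlMr// mul1r (le_trans Mk)// (bigD1 k)//= lerDl.
  by apply: sumr_ge0 => k' _; exact: addr_ge0.
have [h|] := pselect (forall k, `|u k| <= M /\ `|v k| <= M); last first.
  move=> /existsNP[k nk]; have : M <= `|u k| + `|v k|.
    rewrite leNgt; apply/negP => hM; apply: nk.
    have := normr_ge0 (u k); have := normr_ge0 (v k); split; lra.
  by move=> /big H; lra.
have [ge|lt] := leP eps (\sum_k `|u k - v k|); last first.
  have : cut_dist u v <= \sum_k `|u k - v k| by rewrite ge_min lexx orbT.
  lra.
have : 1 <= convex_gap cdens u v / c.
  rewrite ler_pdivlMr// mul1r.
  exact: cP u v Au Av (fun k => (h k).1) (fun k => (h k).2) ge.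
lra.
Qed.

Lemma convex_gap_dens y y' : convex_gap cdens (fun k => scrd k y) (fun k => scrd k y') =
  (dens e y + dens e y') / 2 - dens e (2^-1 *: y + (1 - 2^-1) *: y').
Proof.
rewrite /convex_gap /cdens !scrdK; congr (_ - dens e _).
apply: scrd_inj => k; rewrite of_scrdK scrdD !scrdZ /midpoint; by field.
Qed.

End dens_convexity.

(** * Existence and uniqueness of the minimizer *)

Section minimization.
Variable R : realType.
Local Notation X := (mspace3 R).
Local Notation mu := (@torus_measure R).
Variables (p q rho l h : R) (e : ext_var R * R -> R) (r : space3 R -> R).
Variable z0 : space3 R -> state R.
Hypothesis p4 : 4 <= p.
Hypothesis q2 : 2 <= q.
Hypothesis rho1 : 1 < rho.
Hypothesis l1 : 1 < l.
Hypothesis h0 : 0 < h.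
Hypothesis e_C3 : C_k 3 e.
Hypothesis e_growth : energy_growth p q rho l e.
Hypothesis e_convex : strictly_convex e.
Hypothesis z0_space : in_space p q rho l z0.
Local Notation heat := (heating e r z0).
Hypothesis heat_l : Lq mu l (heat : X -> R).
Hypothesis heated_ge0 : {ae mu, forall x : X, 0 <= ent (z0 x) + h * heat x}.
Local Notation sexp := (state_exponent p q rho l).
Local Notation space := (in_space p q rho l).
Local Notation C := (constraint_set p q rho l h e r z0).
Implicit Types (k : state_idx) (z : space3 R -> state R).

(* The state in which the integrand of the functional is [dens e]; clipping the
   entropy changes nothing almost everywhere on the constraint set. *)
Definition relative z (x : space3 R) : state R :=
  (vel (z x) - vel (z0 x), ext (z x), Num.max 0 (ent (z x))).

Lemma ent_rel_ge0 z x : 0 <= ent (relative z x).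
Proof. by rewrite /ent/= le_max lexx. Qed.

Lemma rel_side z x k : side k (scrd k (relative z x)).
Proof. by case: k => [i|[B|]] //; exact: ent_rel_ge0. Qed.

Lemma scrd_rel z x k : scrd k (relative z x) =
  match k with
  | inl i => scrd k (z x) - scrd k (z0 x)
  | inr (Some B) => scrd k (z x)
  | inr None => Num.max 0 (scrd k (z x))
  end.
Proof. by case: k => [i|[B|]] //; rewrite /scrd /relative /vel/= !mxE. Qed.

Lemma rel_in_space z : space z -> space (relative z).
Proof.
move=> lz k; have sk : 0 <= sexp k by have := sexp_gt1 p4 q2 rho1 l1 k; lra.
under eq_fun do rewrite scrd_rel.
case: k sk => [i|[B|]] sk.
- have := LqD sk (lz (inl i)) (LqZ (-1) (z0_space (inl i))).
  by congr Lq; apply/funext => x; rewrite mulN1r.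
- exact: lz.
- apply: (Lq_dom sk _ _ (lz (inr None))).
    by apply: measurable_maxr => //; case: (lz (inr None)).
  by move=> x; rewrite maxEle; case: ifP => // _; rewrite normr0.
Qed.

Lemma measurable_ent_ge0 z : space z -> measurable [set x : X | 0 <= ent (z x)].
Proof.
move=> lz; have ment : measurable_fun setT (fun x : X => ent (z x)) by case: (lz (inr None)).
rewrite (_ : [set x : X | _] = (fun x : X => ent (z x)) @^-1` `[0, +oo[%classic).
  by rewrite -[X in measurable X]setTI; exact: ment.
by apply/seteqP; split => x; rewrite /= in_itv/= andbT.
Qed.

Lemma constraint_ent_ge0 z : C z -> {ae mu, forall x : X, 0 <= ent (z x)}.
Proof.
move=> cz; have H := constraint_ent p4 q2 rho1 l1 h0 z0_space heat_l cz.
by apply: ae_imp2 H heated_ge0 => x ->.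
Qed.

Definition cost z : R := \int[mu]_x (dens e (relative z x) : R).

Lemma integ_dens_rel z : space z -> integ mu (fun x : X => dens e (relative z x)).
Proof.
move=> lz; apply: (integ_dens p4 q2 e_C3 e_growth) => //; first exact: rel_in_space.
by move=> x; exact: ent_rel_ge0.
Qed.

Lemma functionalE z : C z -> functional e z0 z = (cost z)%:E.
Proof.
move=> cz; have lz := constraint_in_space p4 q2 rho1 l1 cz.
rewrite /cost EFin_Rint; last exact: integ_dens_rel.
pose S : set X := [set x : X | 0 <= ent (z x)].
have mS : measurable S by exact: measurable_ent_ge0 lz.
pose V (x : X) := 2^-1 * (\sum_i (vel (z x) 0 i - vel (z0 x) 0 i) ^+ 2).
have mV : measurable_fun setT V.
  apply: measurable_funM => //; apply: measurable_sum => i; apply: measurable_funX.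
  by apply: measurable_funB; [case: (lz (inl i))|case: (z0_space (inl i))].
have vE x : 2^-1 * (\sum_i vel (relative z x) 0 i ^+ 2) = V x.
  by congr (_ * _); apply: eq_bigr => i _; rewrite /vel/= !mxE.
(* The energy is extended by 0 off the half-space, whence the indicator; in this form the integrand
   is visibly measurable. *)
have E (x : X) : patch (fun=> 0) (@half_space R) e (ext (z x), ent (z x)) =
    (dens e (relative z x) - V x) * \1_S x.
  rewrite /dens vE addrAC subrr add0r /patch indicE.
  have -> : ((ext (z x), ent (z x)) \in @half_space R) = (x \in S).
    by apply/idP/idP => /set_mem H; apply/mem_set.
  case: (boolP (x \in S)) => [/set_mem Sx|_]; last by rewrite mulr0.
  by rewrite mulr1 /ext /ent/= max_r.
have mi := integ_mfun (integ_dens_rel lz).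
rewrite /functional; apply: ae_eq_integral => //.
- apply/measurable_EFinP; apply: measurable_funD; first exact: mV.
  rewrite (_ : (fun x => _) = (fun x : X => (dens e (relative z x) - V x) * \1_S x)); last exact/funext.
  by apply: measurable_funM; [exact: measurable_funB|exact: measurable_indic].
- exact/measurable_EFinP.
- apply: ae_imp (constraint_ent_ge0 cz) => x Sx _; congr EFin.
  by rewrite E indicE mem_set// mulr1 -/(V x) addrC subrK.
Qed.

Definition gap z z' (x : space3 R) : R :=
  convex_gap (cdens e) (fun k => scrd k (relative z x)) (fun k => scrd k (relative z' x)).

Lemma gap_ge0 z z' x : 0 <= gap z z' x.
Proof.
apply: (convex_gap_ge0 (cdens_gap e_C3 e_convex)) => k; exact: rel_side.
Qed.

(** Clipping makes [relative] non-affine, but on the constraint set the entropies are nonnegative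
    almost everywhere, so the relative state of the midpoint is almost everywhere the midpoint of
    the relative states. *)
Lemma cost_midpoint z z' : C z -> C z' -> exists2 m, C m &
  integ mu (gap z z' : X -> R) /\ \int[mu]_x (gap z z' x : R) = (cost z + cost z') / 2 - cost m.
Proof.
move=> cz cz'; have cm := constraint_lin p4 q2 rho1 l1 z0_space 2^-1 cz cz'.
exists (fun x => 2^-1 *: z x + (1 - 2^-1) *: z' x) => //.
set m := fun x => _ in cm *.
have lz := constraint_in_space p4 q2 rho1 l1 cz; have lz' := constraint_in_space p4 q2 rho1 l1 cz'.
have lm := constraint_in_space p4 q2 rho1 l1 cm.
pose M (x : X) := dens e (2^-1 *: relative z x + (1 - 2^-1) *: relative z' x).
have gE : (gap z z' : X -> R) = (fun x => 2^-1 * dens e (relative z x) + 2^-1 * dens e (relative z' x) - M x).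
  by apply/funext => x; rewrite /gap convex_gap_dens mulrDl [in RHS]mulrC [2^-1 * dens e (relative z' x)]mulrC.
have iz := integ_dens_rel lz; have iz' := integ_dens_rel lz'; have im := integ_dens_rel lm.
have lmid := in_space_lin p4 q2 rho1 l1 2^-1 (1 - 2^-1) (rel_in_space lz) (rel_in_space lz').
have mid_ge0 x : 0 <= ent (2^-1 *: relative z x + (1 - 2^-1) *: relative z' x).
  have h2 : 0 <= (1 - 2^-1 : R) by rewrite subr_ge0 invf_le1// ler1n.
  by rewrite addr_ge0// mulr_ge0// ent_rel_ge0.
have iM : integ mu M by exact: (integ_dens p4 q2 e_C3 e_growth lmid mid_ge0).
have ME : {ae mu, forall x : X, M x = dens e (relative m x)}.
  apply: ae_imp2 (constraint_ent_ge0 cz) (constraint_ent_ge0 cz') => x e1 e2.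
  congr dens; apply: scrd_inj => k; rewrite scrdD !scrdZ !scrd_rel /m.
  case: k => [i|[B|]]; rewrite scrdD !scrdZ//; first by ring.
  have h2 : 0 <= (1 - 2^-1 : R) by rewrite subr_ge0 invf_le1// ler1n.
  by rewrite (max_r e1) (max_r e2) max_r// addr_ge0// mulr_ge0.
split; first by rewrite gE; apply: integB => //; apply: integD; exact: integZ.
rewrite gE RintB//; last by apply: integD; exact: integZ.
rewrite RintD; [|exact: integZ..].
rewrite !RintZ// /cost -(Rint_ae (integ_mfun iM) (integ_mfun im) ME); ring.
Qed.

Lemma minimizer_unique z z' : minimizer p q rho l h e r z0 z ->
  minimizer p q rho l h e r z0 z' -> ae_equal z z'.
Proof.
move=> [cz mz] [cz' mz']; have [m cm [ig gE]] := cost_midpoint cz cz'.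
have h1 := mz _ cm; have h2 := mz' _ cm; rewrite !functionalE// !lee_fin in h1 h2.
have g0 : \int[mu]_x (gap z z' x : R) <= 0 by rewrite gE; lra.
have G := Rint_eq0_ae ig (aeW mu (fun x : X => gap_ge0 z z' x)) g0.
have H := ae_and G (ae_and (constraint_ent_ge0 cz) (constraint_ent_ge0 cz')).
apply: ae_imp H => x [gx [e1 e2]].
have E : forall k, scrd k (relative z x) = scrd k (relative z' x).
  apply: contrapT => /existsNP[k /eqP nk].
  have : 0 < gap z z' x.
    by apply: (cdens_gap e_C3 e_convex); [exact: rel_side|exact: rel_side|exists k].
  by rewrite gx ltxx.
apply: scrd_inj => k; have := E k; rewrite !scrd_rel; case: k => [i|[B|]] //.
  by move=> /addIr.
by rewrite !max_r.
Qed.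

Lemma cost_coercive : exists K L : R, [/\ 0 < K & forall z, C z ->
  forall k, \int[mu]_x (`|scrd k (relative z x)| `^ sexp k : R) <= K * (cost z + L)].
Proof.
have [kap [K' [c [kap0 _ c0 H]]]] := dens_bounds p4 q2 e_growth.
exists kap^-1, c; split; first by rewrite invr_gt0.
move=> z cz k; have lz := rel_in_space (constraint_in_space p4 q2 rho1 l1 cz).
have id := integ_dens_rel (constraint_in_space p4 q2 rho1 l1 cz).
rewrite mulrC ler_pdivlMr// mulrC -RintZ; last by case: (lz k).
rewrite -[X in _ + X](Rint_torus_cst c) -RintD//; last exact: integ_cst (torus_lty R) c.
apply: le_Rint; first by apply: integZ; case: (lz k).
  by apply: integD => //; exact: integ_cst (torus_lty R) c.
move=> x; have /andP[h1 _] := H (relative z x) (ent_rel_ge0 z x).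
rewrite -lerBlDr (le_trans _ h1)// lerD2r ler_pM2l// /state_pow (bigD1 k)//= lerDl.
by apply: sumr_ge0 => j _; exact: powR_ge0.
Qed.

Lemma cvg_cdens (v : nat -> state_idx -> R) (w : state_idx -> R) :
  (forall n k, side k (v n k)) -> (forall k, side k (w k)) ->
  (forall k, v n k @[n --> \oo] --> w k) -> cdens e (v n) @[n --> \oo] --> cdens e w.
Proof.
move=> Av Aw vw; apply/cvgrPdist_lt => eps eps0.
have [del del0 dP] := cdens_cont e_C3 Aw eps0.
have H : \forall n \near \oo, forall k, `|w k - v n k| < del.
  apply: filter_forall => k.
  by have /cvgrPdist_lt := vw k; apply.
apply: filterS H => n vn; rewrite distrC; apply: dP => // k.
by rewrite distrC.
Qed.

Lemma minimizer_exists : exists z, minimizer p q rho l h e r z0 z.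
Proof.
have [K [L [K0 KL]]] := cost_coercive.
have Cs z : C z -> space z := constraint_in_space p4 q2 rho1 l1 (z := z).
have cost_lb z : C z -> - L <= cost z.
  move=> cz; rewrite -subr_ge0 opprK -(pmulr_rge0 _ K0).
  apply: le_trans (KL z cz (inr None)).
  by apply: Rintegral_ge0 => x _; exact: powR_ge0.
pose S := [set cost z | z in C].
have Cr := rest_state_constraint p4 q2 rho1 l1 h0 z0_space heat_l.
have Si : has_inf S.
  split; first by exists (cost (rest_state h e r z0)), (rest_state h e r z0).
  by exists (- L) => _ [z cz <-]; exact: cost_lb.
pose m := inf S.
have m_le z : C z -> m <= cost z by move=> cz; apply: ge_inf; [exact: Si.2|exists z].
have /choice[u uP] : forall n : nat, exists z, C z /\ cost z <= m + n.+1%:R^-1.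
  move=> n; have n0 : 0 < (n.+1%:R^-1 : R) by rewrite invr_gt0.
  by have [_ [z cz <-] zm] := inf_adherent n0 Si; exists z; split => //; exact: ltW.
have Cu n := (uP n).1; have su n := Cs _ (Cu n).
pose B := K * (m + 1 + L).
have uB n k : \int[mu]_x (`|scrd k (relative (u n) x)| `^ sexp k : R) <= B.
  apply: (le_trans (KL _ (Cu n) k)); rewrite ler_pM2l// lerD2r (le_trans (uP n).2)// lerD2l.
  by rewrite invf_le1// ler1n.
have B0 : 0 <= B.
  by apply: le_trans (uB 0%N (inr None)); apply: Rintegral_ge0 => x _; exact: powR_ge0.
have ri n k : integ mu (fun x : X => `|scrd k (relative (u n) x)|).
  by apply/integ_norm/(in_space_integ p4 q2 rho1 l1); exact: rel_in_space.
have uB1 n k : \int[mu]_x (`|scrd k (relative (u n) x)| : R) <= 1 + B.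
  have ip : integ mu (fun x : X => `|scrd k (relative (u n) x)| `^ sexp k).
    by have [] := rel_in_space (su n) k.
  rewrite -lerBlDl; apply: le_trans (uB n k).
  rewrite -[X in _ - X](Rint_torus_cst 1) -RintB//; last exact: integ_cst (torus_lty R) 1.
  apply: le_Rint => //; first by apply: integB => //; exact: integ_cst (torus_lty R) 1.
  move=> x; rewrite lerBlDl; have s1 := sexp_gt1 p4 q2 rho1 l1 k.
  have [a1|a1] := leP `|scrd k (relative (u n) x)| 1.
    by rewrite (le_trans a1)// lerDl powR_ge0.
  rewrite -[leLHS]powRr1// ler_wpDl// ler_powR// ltW//.
have mrel n k : measurable_fun setT (fun x : X => scrd k (relative (u n) x)).
  by have [] := rel_in_space (su n) k.
have cauchy eps : 0 < eps -> exists N, forall n n', (N <= n)%N -> (n <= n')%N ->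
    \int[mu]_x (cut_dist (fun k => scrd k (relative (u n) x)) (fun k => scrd k (relative (u n') x)) : R) <= eps.
  move=> eps0.
  (* [T] bounds the L^1 norms of the coordinates of both states together, by |a| <= 1 + |a|^s; the
     added 1 makes it positive. [M] then makes the second term of [cut_dist_gap] integrate to at
     most eps / 3. *)
  pose T := 2 * #|{: state_idx}|%:R * (1 + B) + 1.
  have T0 : 0 < T by rewrite ltr_wpDl// !mulr_ge0// addr_ge0.
  have e3 : 0 < eps / 3 by rewrite divr_gt0.
  pose M := T / (eps / 3).
  have M0 : 0 < M by rewrite divr_gt0.
  have [c c0 cP] := cut_dist_gap e_C3 e_convex M0 e3.
  have ce : 0 < c * (eps / 3) by rewrite mulr_gt0.
  have [N _ NP] : \forall n \near \oo, (n.+1%:R^-1 : R) < c * (eps / 3).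
    have /cvgrPdist_lt/(_ _ ce) := @cvg_harmonic R.
    by apply: filterS => n; rewrite sub0r normrN ger0_norm// invr_ge0.
  exists N => n n' Nn nn'.
  have [mm Cm [ig gE]] := cost_midpoint (Cu n) (Cu n').
  (* The midpoint costs at least the infimum [m], and each of the two states at most [m] + 1/(n +
     1). *)
  have gle : \int[mu]_x (gap (u n) (u n') x : R) <= c * (eps / 3).
    rewrite gE; have := m_le _ Cm; have := (uP n).2; have := (uP n').2.
    have := NP n Nn; have : (n'.+1%:R^-1 : R) <= n.+1%:R^-1 by rewrite lef_pV2 ?posrE// ler_nat.
    rewrite /=; move: (n.+1%:R^-1) (n'.+1%:R^-1) (c * _) => a a' b; lra.
  have iS : integ mu (fun x : X => \sum_k (`|scrd k (relative (u n) x)| + `|scrd k (relative (u n') x)|)).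
    by apply: integ_sum => k _; exact: integD.
  have Sle : \int[mu]_x (\sum_k (`|scrd k (relative (u n) x)| + `|scrd k (relative (u n') x)|) : R) <= T.
    rewrite Rint_sum => [|k _]; last exact: integD.
    apply: (@le_trans _ _ (\sum_(k : state_idx) (2 * (1 + B)))).
      apply: ler_sum => k _; rewrite RintD//; have := uB1 n k; have := uB1 n' k; lra.
    by rewrite sumr_const -[leLHS]mulr_natl /T mulrCA mulrA lerDl ler01.
  apply: (@le_trans _ _ (\int[mu]_x (eps / 3 + (M^-1 * \sum_k (`|scrd k (relative (u n) x)| + `|scrd k (relative (u n') x)|)
      + c^-1 * gap (u n) (u n') x) : R))).
    apply: le_Rint.
    - exact: (@integ_cut_dist _ _ _ mu (torus_lty R) _ (fun x k => scrd k (relative (u n) x))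
        (fun x k => scrd k (relative (u n') x)) (mrel n) (mrel n')).
    - by apply: integD; [exact: integ_cst (torus_lty R) _|apply: integD; exact: integZ].
    - move=> x; have := cP _ _ (rel_side (u n) x) (rel_side (u n') x).
      by rewrite addrA [M^-1 * _]mulrC [c^-1 * _]mulrC.
  rewrite RintD; [|exact: integ_cst (torus_lty R) _|by apply: integD; exact: integZ].
  rewrite RintD; [|exact: integZ..].
  rewrite Rint_torus_cst !RintZ//.
  have h1 : M^-1 * \int[mu]_x (\sum_k (`|scrd k (relative (u n) x)| + `|scrd k (relative (u n') x)|) : R) <= eps / 3.
    by rewrite mulrC ler_pdivrMr// /M mulrC divfK// gt_eqF.
  have h2 : c^-1 * \int[mu]_x (gap (u n) (u n') x : R) <= eps / 3.
    by rewrite mulrC ler_pdivrMr// mulrC.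
  move: h1 h2; set A1 := M^-1 * _; set A2 := c^-1 * _; lra.
have [phi [phi_ge phi_cv]] := ae_cvg_subseq (torus_lty R) mrel cauchy.
have [w [mw wcv]] := @ae_cvg_measurable_limit _ _ _ mu _
  (fun n k (x : X) => scrd k (relative (u (phi n)) x)) (fun n k => mrel (phi n) k) phi_cv.
have W k : Lq mu (sexp k) (w k) /\ forall a, Lq mu (conj_exp (sexp k)) (a : X -> R) ->
    (\int[mu]_x (scrd k (relative (u (phi n)) x) * a x : R)) @[n --> \oo] --> \int[mu]_x (w k x * a x : R).
  have cvk : {ae mu, forall x, (fun n => scrd k (relative (u (phi n)) x)) @ \oo --> w k x}.
    by apply: ae_imp wcv => x; exact.
  have H a := @cvg_Rint_weak _ _ _ mu (sexp k) B (fun n x => scrd k (relative (u (phi n)) x)) (w k) a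
    (sexp_gt1 p4 q2 rho1 l1 k) (fun n => rel_in_space (su (phi n)) k) (fun n => uB (phi n) k) (mw k) cvk.
  split; last by move=> a la; exact: (H a la).2.
  apply: (H (fun=> 0) _).1; apply: Lq_zero; exact: conj_ge0 p4 q2 rho1 l1 k.
(* [relative] subtracts the initial velocity, which is added back here. *)
pose b k (x : space3 R) : R := if k is inl i then scrd (inl i) (z0 x) else 0.
pose z x := of_scrd (fun k => w k x + b k x).
have scz k x : scrd k (z x) = w k x + b k x by rewrite of_scrdK.
have bs k : Lq mu (sexp k) (b k : X -> R).
  case: k => [i|j]; first exact: z0_space.
  by apply: Lq_zero; apply: ltW (lt_trans ltr01 (sexp_gt1 p4 q2 rho1 l1 _)).
have sz : space z.
  move=> k; under eq_fun do rewrite scz; apply: LqD => //; last exact: (W k).1.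
  exact: ltW (lt_trans ltr01 (sexp_gt1 p4 q2 rho1 l1 _)).
have ub n : {ae mu, forall x : X, forall k, scrd k (u n x) = scrd k (relative (u n) x) + b k x}.
  apply: ae_imp (constraint_ent_ge0 (Cu n)) => x ux k; rewrite scrd_rel.
  by case: k => [i|[B'|]]; rewrite /b ?subrK ?addr0// (max_r ux).
have Cz : C z.
  apply: (constraint_lim p4 q2 rho1 l1 z0_space (fun n => Cu (phi n)) sz) => k a la.
  have s1 := sexp_gt1 p4 q2 rho1 l1 k.
  have ir n : integ mu (fun x : X => scrd k (relative (u n) x) * a x).
    exact: LqM s1 (rel_in_space (su n) k) la.
  have ib : integ mu (fun x : X => b k x * a x) by exact: LqM s1 (bs k) la.
  have iw : integ mu (fun x : X => w k x * a x) by exact: LqM s1 (W k).1 la.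
  rewrite (_ : \int[mu]_x _ = \int[mu]_x (w k x * a x : R) + \int[mu]_x (b k x * a x : R)).
    rewrite (_ : (fun n => _) = (fun n => \int[mu]_x (scrd k (relative (u (phi n)) x) * a x : R) + \int[mu]_x (b k x * a x : R))).
      by apply: cvgD; [exact: (W k).2|exact: cvg_cst].
    apply/funext => n; rewrite -RintD//; apply: Rint_ae.
    - by apply: integ_mfun; exact: LqM s1 (su (phi n) k) la.
    - by apply: integ_mfun; exact: integD.
    - by apply: ae_imp (ub (phi n)) => x ->; rewrite mulrDl.
  by rewrite -RintD//; apply: eq_Rintegral => x _; rewrite scz mulrDl.
have relz : {ae mu, forall x : X, forall k, scrd k (relative (u (phi n)) x) @[n --> \oo] --> scrd k (relative z x)}.
  apply: ae_imp wcv => x wx k; rewrite scrd_rel; move: (wx k).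
  case: k => [i|[B'|]] wk; rewrite scz /b ?addrK ?addr0//.
  (* The limit entropy is a limit of nonnegative numbers, so clipping does not alter it. *)
  rewrite max_r//; apply: (cvgr_to_ge wk).
  by apply: nearW => n; exact: ent_rel_ge0.
exists z; split => // z' Cz'; rewrite !functionalE// lee_fin.
apply: le_trans (m_le _ Cz').
(* The coercivity supplies a constant [c] whose addition makes the density nonnegative, as Fatou's
   lemma requires. *)
have [kap [K' [c [kap0 K'0 c0 H]]]] := dens_bounds p4 q2 e_growth.
have dc y : 0 <= ent y -> 0 <= dens e y + c.
  move=> /H /andP[h1 _]; have := mulr_ge0 (ltW kap0) (state_pow_ge0 p q rho l y); lra.
have ic : integ mu (fun=> c : R) by exact: integ_cst (torus_lty R) c.
have [|||||||_ Hc] := @fatou_Rint _ _ _ mu (fun n x => dens e (relative (u (phi n)) x) + c)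
  (fun x => dens e (relative z x) + c) (fun n => m + n.+1%:R^-1 + c) (m + c).
- by move=> n; apply: integD => //; exact: integ_dens_rel.
- by move=> n x; apply: dc; exact: ent_rel_ge0.
- exact: (integ_mfun (integD (integ_dens_rel sz) ic)).
- by move=> x; apply: dc; exact: ent_rel_ge0.
- apply: ae_imp relz => x rx; apply: cvgD; last exact: cvg_cst.
  have := cvg_cdens (fun n => rel_side (u (phi n)) x) (rel_side z x) rx.
  by rewrite /cdens scrdK; under eq_fun do rewrite scrdK.
- move=> n; rewrite RintD//; last exact: integ_dens_rel.
  rewrite Rint_torus_cst lerD2r (le_trans (uP (phi n)).2)// lerD2l lef_pV2 ?posrE// ler_nat ltnS.
  exact: phi_ge.
- by apply: cvgD; [rewrite -[X in _ --> X]addr0; apply: cvgD; [exact: cvg_cst|exact: cvg_harmonic]|exact: cvg_cst].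
move: Hc; rewrite RintD//; last exact: integ_dens_rel.
by rewrite Rint_torus_cst lerD2r.
Qed.

End minimization.

(** * The Euler-Lagrange equation *)

Lemma powR_exponent_le (R : realType) (a b K : R) : 0 <= b ->
  (forall s, 1 <= s -> s `^ a <= K * (s `^ b + 1)) -> a <= b.
Proof.
move=> b0 H; rewrite leNgt; apply/negP => ba.
have K1 : 1 <= 2 * K.
  by have := H 1 (lexx _); rewrite !powR1 (_ : 1 + 1 = 2) ?[K * 2]mulrC//; ring.
have K0 : 0 <= K by lra.
have d0 : 0 < a - b by rewrite subr_gt0.
(* Chosen so that s^a = (2 K + 1) s^b, which exceeds K (s^b + 1) because s^b >= 1. *)
pose s := (2 * K + 1) `^ (a - b)^-1.
have K2 : 1 <= 2 * K + 1 by lra.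
have s1 : 1 <= s by rewrite -(powRr0 (2 * K + 1)) ler_powR// invr_ge0 ltW.
have s0 : 0 < s by lra.
have sb1 : 1 <= s `^ b by rewrite -(powRr0 s) ler_powR.
have := H s s1; rewrite -{1}(subrK b a) powRD; last by rewrite (gt_eqF s0) implybT.
have -> : s `^ (a - b) = 2 * K + 1.
  by rewrite /s -powRrM mulVf ?gt_eqF// powRr1//; lra.
move=> H1; have : K * (s `^ b + 1) <= K * (2 * s `^ b) by rewrite ler_wpM2l//; lra.
move: H1 sb1; set y := s `^ b => H1 y1 H2; have : (2 * K + 1) * y <= 2 * K * y by lra.
by rewrite ler_pM2r; lra.
Qed.

(** Midpoint convexity alone shows that halving the step does not increase the quotient, which is
    why the steps are dyadic. The lower bound is the upper one for the reflected function, carried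
    across 0 by the midpoint inequality. *)
Lemma midpoint_convex_quotient (R : realType) (g : R -> R) :
  (forall a b, g (2^-1 * a + (1 - 2^-1) * b) <= (g a + g b) / 2) -> forall n,
  g 0 - g (- 1) <= 2 ^+ n * (g (2^-1 ^+ n) - g 0) <= g 1 - g 0.
Proof.
move=> gm.
have up (f : R -> R) : (forall a b, f (2^-1 * a + (1 - 2^-1) * b) <= (f a + f b) / 2) -> forall n,
    2 ^+ n * (f (2^-1 ^+ n) - f 0) <= f 1 - f 0.
  move=> fm; elim=> [|n ih]; first by rewrite !expr0 mul1r.
  apply: le_trans ih; rewrite exprSr -mulrA ler_pM2l ?exprn_gt0//.
  have := fm (2^-1 ^+ n) 0; rewrite mulr0 addr0 -exprS; lra.
move=> n; rewrite up// andbT.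
have := up (fun t => g (- t)) _ n.
move=> H; have {}H : 2 ^+ n * (g (- 2^-1 ^+ n) - g (- 0)) <= g (- 1) - g (- 0).
  by apply: H => a b; rewrite -(opprK (2^-1 * a)) opprD opprK -!mulrN; exact: gm.
rewrite oppr0 in H.
have c := gm (2^-1 ^+ n) (- 2^-1 ^+ n).
have E : 2^-1 * 2^-1 ^+ n + (1 - 2^-1) * - 2^-1 ^+ n = 0 :> R by field.
rewrite E in c.
have p : 0 < (2 ^+ n : R) by rewrite exprn_gt0.
have : 0 <= 2 ^+ n * (g (2^-1 ^+ n) + g (- 2^-1 ^+ n) - 2 * g 0) by rewrite mulr_ge0 ?(ltW p)//; lra.
move: H; set G := g (2^-1 ^+ n); set G' := g (- _); set P := 2 ^+ n; lra.
Qed.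

Lemma cvg_dyadic_quotient (R : realType) (g : R -> R) (dg : R) : is_derive (0 : R) 1 g dg ->
  2 ^+ n * (g (2^-1 ^+ n) - g 0) @[n --> \oo] --> dg.
Proof.
move=> [dr <-]; rewrite /derive.
have c : (2^-1 ^+ n : R) @[n --> \oo] --> (0 : R)^'.
  have c0 : (2^-1 ^+ n : R) @[n --> \oo] --> (0 : R).
    by apply: cvg_expr; rewrite ger0_norm// invf_lt1// ltr1n.
  move=> A A0.
  have H : \forall n \near \oo, (2^-1 ^+ n : R) != 0 -> A (2^-1 ^+ n) := c0 _ A0.
  by apply: filterS H => n; apply; rewrite expf_neq0.
have H : (fun n => (2^-1 ^+ n)^-1 *: ((g \o shift 0) (2^-1 ^+ n *: 1) - g 0)) @ \oo -->
   lim ((fun h : R => h^-1 *: ((g \o shift 0) (h *: 1) - g 0)) @ 0^').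
  exact: (cvg_comp _ _ c dr).
rewrite (_ : (fun n => _) = (fun n => (2^-1 ^+ n)^-1 *: ((g \o shift 0) (2^-1 ^+ n *: 1) - g 0)))//.
by apply/funext => n; rewrite /= addr0 /GRing.scale/= mulr1 exprVn invrK.
Qed.

(** * Bounds on the exponents forced by the growth conditions *)

Section growth_exponents.
Variable R : realType.
Variables (p q rho l : R) (e : ext_var R * R -> R).
Hypothesis p4 : 4 <= p.
Hypothesis q2 : 2 <= q.
Hypothesis rho1 : 1 < rho.
Hypothesis l1 : 1 < l.
Hypothesis e_C3 : C_k 3 e.
Hypothesis e_growth : energy_growth p q rho l e.
Hypothesis e_stress : stress_growth p q rho l e.

(* Integrating the bound on the derivative along an axis bounds [e] from above by
   a power [1 + s / tau], which the coercivity requires to be at least [s]. *)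
Lemma coordinate_exponent_le (j : energy_idx) (s tau a a' c c' : R) :
  j != None -> 0 < s -> 1 < tau -> 0 < a -> 0 < c -> 0 <= c' ->
  (forall t, 0 <= t -> a * t `^ s - a' <= e (t *: energy_vec R j)) ->
  (forall t, 0 <= t -> `|epartial j e (t *: energy_vec R j)| `^ tau <= c * t `^ s + c') ->
  s <= 1 + s / tau.
Proof.
move=> j0 s0 tau1 a0 c0 c'0 lo up.
have tau0 : 0 < tau by lra.
have hC := C_k_hC1 (s := [::]) e_C3 isT.
(* For t >= 1 the bound c t^s + c' is at most (c + c') t^s; taking the root of order tau, the
   derivative is at most N t^(s/tau) along the whole segment from 0 to t. *)
pose N := (c + c') `^ tau^-1.
have N0 : 0 <= N by exact: powR_ge0.
have Hj t : half_space (t *: energy_vec R j).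
  by rewrite half_spaceE ecoordZ ecoord_vec eq_sym (negbTE j0) mulr0.
apply: (@powR_exponent_le _ _ _ ((N + `|a'| + `|e 0|) / a)).
  by rewrite addr_ge0// divr_ge0// ltW.
move=> t t1; have t0 : 0 < t by lra.
have ts1 : 1 <= t `^ s by rewrite -(powRr0 t) ler_powR// ltW.
have H0 : half_space (0 : ext_var R * R) by rewrite half_spaceE ecoord0.
have Ht : half_space (0 + t *: energy_vec R j) by rewrite add0r.
have [th /andP[th0 th1]] := MVT_coord hC H0 Ht.
rewrite !add0r /= => mvt.
have tht : 0 <= th * t by rewrite mulr_ge0// ltW.
have D : `|epartial j e ((th * t) *: energy_vec R j)| <= N * t `^ (s / tau).
  have h1 : c * (th * t) `^ s + c' <= (c + c') * t `^ s.
    have : (th * t) `^ s <= t `^ s.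
      by rewrite ge0_ler_powR ?nnegrE ?(ltW s0) ?(ltW t0)// ler_piMl// ltW.
    move=> h; have := ler_wpM2l (ltW c0) h; have := ler_wpM2l c'0 ts1; rewrite mulrDl; lra.
  have h2 := le_trans (up _ tht) h1.
  rewrite -[leLHS]powRr1// -(mulfV (lt0r_neq0 tau0)) [leLHS]powRrM.
  rewrite (le_trans (ge0_ler_powR _ _ _ h2)) ?nnegrE ?invr_ge0 ?(ltW tau0) ?powR_ge0//.
    by rewrite mulr_ge0 ?powR_ge0// addr_ge0// ltW.
  by rewrite powRM ?powR_ge0 ?addr_ge0 ?(ltW c0)// -powRrM.
have L := lo t (ltW t0).
have tt : t * t `^ (s / tau) = t `^ (1 + s / tau).
  by rewrite powRD ?(gt_eqF t0) ?implybT// powRr1// ltW.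
have M : t * epartial j e ((th * t) *: energy_vec R j) <= N * t `^ (1 + s / tau).
  rewrite -tt mulrCA ler_pM2l//; exact: le_trans (ler_norm _) D.
have T1 : 0 <= t `^ (1 + s / tau) by exact: powR_ge0.
have aT : a * t `^ s <= N * t `^ (1 + s / tau) + `|a'| + `|e 0|.
  have := ler_norm a'; have := ler_norm (e 0); lra.
rewrite mulrAC ler_pdivlMr// mulrC (le_trans aT)//.
have := normr_ge0 a'; have := normr_ge0 (e 0) => x0 y0.
have := mulr_ge0 x0 T1; have := mulr_ge0 y0 T1; lra.
Qed.

Let drop_sides (x y z b b' : R) : 0 <= x -> 0 <= z -> x + y + z <= b -> b <= b' -> y <= b'.
Proof. by lra. Qed.

Lemma frob0 : frob (0 : 'M[R]_3) = 0.
Proof. by rewrite frobE big1 ?sqrtr0// => k _; rewrite mxE expr0n. Qed.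

Lemma frob_delta (t : R) : 0 <= t ->
  t <= frob (t *: delta_mx 0 0 : 'M[R]_3) /\ frob (t *: delta_mx 0 0 : 'M[R]_3) <= 9 * t.
Proof.
move=> t0; split.
  by have := entry_le_frob (t *: delta_mx 0 0 : 'M[R]_3) 0 0; rewrite !mxE eqxx mulr1 ger0_norm.
apply: (le_trans (frob_le_sum _)).
have : \sum_(k : 'I_3 * 'I_3) `|(t *: delta_mx 0 0 : 'M[R]_3) k.1 k.2| <= \sum_(k : 'I_3 * 'I_3) t.
  apply: ler_sum => k _; rewrite !mxE normrM ger0_norm// ler_piMr// ger0_norm ?ler0n//.
  by case: (_ && _).
by move=> /le_trans; apply; rewrite sumr_const card_prod card_ord -[leLHS]mulr_natl.
Qed.

(** Along an entry of zeta the exponent tau is p/(p - 2), and q <= 1 + q (p - 2)/p amounts to 2 q <=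
    p. *)
Lemma q_le : 2 * q <= p.
Proof.
have [c1 [c2 [c3 [c4 [c10 c20 c30 c40 G]]]]] := e_growth.
have [c [c' [c0 c'0 S]]] := e_stress.
have q0 : 0 < q by move: q2; lra.
have p0 : 0 < p by move: p4; lra.
have p20 : 0 < p - 2 by move: p4; lra.
have vE t : t *: energy_vec R (Some (inl (inr (0, 0)))) = (0, t *: delta_mx 0 0, 0, 0).
  transitivity ((t *: (0 : 'M[R]_3), t *: (delta_mx 0 0 : 'M[R]_3), t *: (0 : R^o)), t *: (0 : R^o)) => //.
  by rewrite !scaler0.
have gE t : growth_fun p q rho l 0 (t *: delta_mx 0 0) 0 0 = frob (t *: delta_mx 0 0 : 'M[R]_3) `^ q.
  rewrite /growth_fun frob0 !normr0 !powR0 ?gt_eqF// ?add0r ?addr0//; last exact: lt_trans rho1.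
  exact: lt_trans l1.
have : q <= 1 + q / (p / (p - 2)).
  apply: (@coordinate_exponent_le (Some (inl (inr (0, 0)))) q (p / (p - 2)) c1 c2 (c * 9 `^ q) c') => //.
  - by rewrite ltr_pdivlMr// mul1r; move: p4; lra.
  - by rewrite mulr_gt0// powR_gt0.
  - exact: ltW.
  - move=> t t0; have [d1 d2] := frob_delta t0; rewrite vE.
    have /andP[g1 _] := G 0 (t *: delta_mx 0 0) 0 0 (lexx 0); rewrite gE in g1.
    apply: le_trans g1; rewrite lerD2r ler_pM2l//.
    by rewrite ge0_ler_powR ?nnegrE ?frob_ge0 ?(ltW q0).
  - move=> t t0; have [d1 d2] := frob_delta t0; rewrite vE.
    have s1 := S 0 (t *: delta_mx 0 0) 0 0 (lexx 0); rewrite gE in s1.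
    have e1 := entry_le_frob (dzeta e (0, t *: delta_mx 0 0, 0, 0)) 0 0; rewrite mxE in e1.
    have tau0 : 0 <= p / (p - 2) by rewrite divr_ge0// ltW.
    have := ge0_ler_powR tau0 (normr_ge0 _) (frob_ge0 _) e1 => /le_trans; apply.
    apply: drop_sides (powR_ge0 _ _) (powR_ge0 _ _) s1 _; rewrite lerD2r.
    have : c * frob (t *: delta_mx 0 0 : 'M[R]_3) `^ q <= c * 9 `^ q * t `^ q.
      rewrite -mulrA ler_pM2l// -powRM//.
      by rewrite ge0_ler_powR ?nnegrE ?frob_ge0 ?(ltW q0)// mulr_ge0.
    exact.
rewrite invf_div mulrA -lerBlDl ler_pdivlMr//; lra.
Qed.

(** Along w the exponent tau is p/(p - 3), and rho <= 1 + rho (p - 3)/p amounts to 3 rho <= p. *)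
Lemma rho_le : 3 * rho <= p.
Proof.
have [c1 [c2 [c3 [c4 [c10 c20 c30 c40 G]]]]] := e_growth.
have [c [c' [c0 c'0 S]]] := e_stress.
have r0 : 0 < rho by exact: lt_trans rho1.
have p0 : 0 < p by move: p4; lra.
have p30 : 0 < p - 3 by move: p4; lra.
have vE t : t *: energy_vec R (Some (inr tt)) = (0, 0, t, 0).
  transitivity ((t *: (0 : 'M[R]_3), t *: (0 : 'M[R]_3), t *: (1 : R^o)), t *: (0 : R^o)) => //.
  by rewrite !scaler0 /GRing.scale/= mulr1.
have gE t : 0 <= t -> growth_fun p q rho l 0 0 t 0 = t `^ rho.
  move=> t0; rewrite /growth_fun frob0 normr0 ger0_norm// !powR0 ?gt_eqF// ?add0r ?addr0//.
    exact: lt_trans l1.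
  by move: q2; lra.
have : rho <= 1 + rho / (p / (p - 3)).
  apply: (@coordinate_exponent_le (Some (inr tt)) rho (p / (p - 3)) c1 c2 c c') => //.
  - by rewrite ltr_pdivlMr// mul1r; move: p4; lra.
  - exact: ltW.
  - move=> t t0; rewrite vE; have /andP[g1 _] := G 0 0 t 0 (lexx 0); rewrite gE// in g1.
  - move=> t t0; rewrite vE; have s1 := S 0 0 t 0 (lexx 0); rewrite gE// in s1.
    apply: (@drop_sides _ _ 0 _ _ _ (lexx 0) _ (lexx _)); last by rewrite addr0; exact: s1.
    by rewrite addr_ge0// powR_ge0.
rewrite invf_div mulrA -lerBlDl ler_pdivlMr//; lra.
Qed.

End growth_exponents.

(** * Admissible variations and the first variation of the cost *)

Section euler_lagrange.
Variable R : realType.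
Local Notation X := (mspace3 R).
Local Notation mu := (@torus_measure R).
Variables (p q rho l h : R) (e : ext_var R * R -> R) (r : space3 R -> R).
Variable z0 : space3 R -> state R.
Hypothesis p4 : 4 <= p.
Hypothesis q2 : 2 <= q.
Hypothesis rho1 : 1 < rho.
Hypothesis l1 : 1 < l.
Hypothesis h0 : 0 < h.
Hypothesis e_C3 : C_k 3 e.
Hypothesis e_growth : energy_growth p q rho l e.
Hypothesis e_stress : stress_growth p q rho l e.
Hypothesis e_convex : strictly_convex e.
Hypothesis z0_space : in_space p q rho l z0.
Local Notation heat := (heating e r z0).
Hypothesis heat_l : Lq mu l (heat : X -> R).
Hypothesis heated_ge0 : {ae mu, forall x : X, 0 <= ent (z0 x) + h * heat x}.
Local Notation F0 := (fun x => Fpart (ext (z0 x))).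
Variable y : space3 R -> 'rV[R]_3.
Hypothesis iy : forall i, integ mu (fun x : X => y x 0 i).
Hypothesis yF : weak_gradient y F0.
Local Notation sexp := (state_exponent p q rho l).
Local Notation space := (in_space p q rho l).
Local Notation C := (constraint_set p q rho l h e r z0).
Local Notation relative := (relative z0).
Local Notation cost := (cost e z0).
Implicit Types (k : state_idx).

Section variation.
Variables (phi : space3 R -> R) (i : 'I_3).
Hypothesis tphi : test_function phi.

Definition stress_form B (x : space3 R) : R := \sum_a dPhi B i a (F0 x) * spartial a phi x.

(* Moving the velocity by [phi] along the axis [i] forces this change of [xi],
   which is admissible by the Piola identity. *)
Definition variation (x : space3 R) : state R := of_scrd (fun k =>
  match k with
  | inl i' => (i' == i)%:R * phi x
  | inr (Some B) => h * stress_form B x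
  | inr None => 0
  end).

Lemma variation_entE x : ecoord None (ext (variation x), ent (variation x)) = 0.
Proof. by rewrite -[LHS]/(scrd (inr None) (variation x)) of_scrdK. Qed.

Lemma variation_extE B x :
  ecoord (Some B) (ext (variation x), ent (variation x)) = h * stress_form B x.
Proof. by rewrite -[LHS]/(scrd (inr (Some B)) (variation x)) of_scrdK. Qed.

Let F0p j a : Lq mu p (fun x : X => F0 x j a).
Proof. exact: (z0_space (inr (Some (inl (inl (j, a)))))). Qed.

Lemma stress_form_Lq B : Lq mu (dPhi_exponent p B) (stress_form B : X -> R).
Proof.
have p2 : 2 <= p by move: p4; lra.
have d0 : 0 <= dPhi_exponent p B by case: B => [B|B] /=; move: p4; lra.
have H s : Lq mu (dPhi_exponent p B) (fun x : X => \sum_(a <- s) dPhi B i a (F0 x) * spartial a phi x).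
  elim: s => [|a s ih].
    by under eq_fun do rewrite big_nil; exact: Lq_zero.
  under eq_fun do rewrite big_cons; apply: LqD => //.
  have [M phiM] := test_bounded (test_spartial a tphi).
  under eq_fun do rewrite mulrC.
  exact: LqM_bounded d0 (dPhi_Lq p2 F0p B i a) (test_measurable (test_spartial a tphi)) phiM.
exact: H.
Qed.

(** The increment of zeta is linear in F0, hence in L^p, and that of w quadratic, hence in L^(p/2);
    2 q <= p and 3 rho <= p give q <= p and rho <= p/2. *)
Lemma variation_in_space : space variation.
Proof.
have hq := q_le p4 q2 rho1 l1 e_C3 e_growth e_stress.
have hr := rho_le p4 q2 rho1 l1 e_C3 e_growth e_stress.
move=> k; have sk : 0 <= sexp k by exact: ltW (lt_trans ltr01 (sexp_gt1 p4 q2 rho1 l1 k)).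
under eq_fun do rewrite of_scrdK.
case: k sk => [i'|[B|]] sk; last exact: Lq_zero.
- by apply: LqZ; exact: Lq_test.
- apply: LqZ; apply: (Lq_le (torus_lty R) sk _ (stress_form_Lq B)).
  by case: B sk => [[B|B]|B] _ //=; move: p4 q2 hq hr; lra.
Qed.

(** The velocity contributes phi d_a psi and the extended variable psi d_a phi; they add up to d_a
    (phi psi), so the equation is the Piola identity tested with phi psi. *)
Lemma variation_cint psi (j : energy_idx) : test_function psi -> cint h z0 psi j variation = 0.
Proof.
move=> tpsi; have lv := variation_in_space.
rewrite (cintE h z0 j tpsi lv).
case: j => [B|]; last first.
  rewrite big1 ?add0r; last first.
    by move=> i' _; rewrite -[RHS](Rint_zero mu); apply: eq_Rintegral => x _; rewrite mul0r.
  rewrite -[RHS](Rint_zero mu); apply: eq_Rintegral => x _.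
  by rewrite variation_entE mulr0.
have tpp : test_function (fun x => phi x * psi x) by exact: test_functionM.
have F2 j a : Lq mu 2 (fun x : X => F0 x j a).
  by apply: (Lq_le (torus_lty R) _ _ (F0p j a)); move: p4; lra.
have P := piola F2 (weak_gradient_curl_free iy yF) iy yF tpp B i.
have idP a chi : test_function chi -> integ mu (fun x : X => dPhi B i a (F0 x) * chi x).
  move=> tchi; apply: integ_testM => //.
  by apply: (Lq_integ (torus_lty R) _ (dPhi_L2 p4 z0_space B i a)); rewrite ler1n.
have id1 a := idP a _ (test_functionM tphi (test_spartial a tpsi)).
have id2 a := idP a _ (test_functionM tpsi (test_spartial a tphi)).
have S1 i' : \int[mu]_x (cform h z0 psi (Some B) (inl i') x * scrd (inl i') (variation x) : R) =
    (i' == i)%:R * \sum_a \int[mu]_x (dPhi B i a (F0 x) * (phi x * spartial a psi x) : R).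
  rewrite -(Rint_sum _ (fun a _ => id1 a)) -RintZ; last exact: integ_sum (fun a _ => id1 a).
  apply: eq_Rintegral => x _; rewrite (of_scrdK _ (inl i')) /cform.
  have [->|_] := eqVneq i' i; last by rewrite !mul0r mulr0.
  by rewrite !mul1r mulr_suml; apply: eq_bigr => a _; rewrite -mulrA [_ * phi x]mulrC.
have S2 : \int[mu]_x (h^-1 * psi x * ecoord (Some B) (ext (variation x), ent (variation x)) : R) =
    \sum_a \int[mu]_x (dPhi B i a (F0 x) * (psi x * spartial a phi x) : R).
  rewrite -(Rint_sum _ (fun a _ => id2 a)).
  apply: eq_Rintegral => x _; rewrite variation_extE /stress_form.
  rewrite mulrACA mulVf ?gt_eqF// mul1r mulr_sumr; apply: eq_bigr => a _.
  by rewrite mulrCA.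
have pick (c : R) : \sum_i' (i' == i)%:R * c = c.
  by rewrite (bigD1 i)//= eqxx mul1r big1 ?addr0// => i' /negbTE ->; rewrite mul0r.
have T a : \int[mu]_x (dPhi B i a (F0 x) * (phi x * spartial a psi x) : R) +
    \int[mu]_x (dPhi B i a (F0 x) * (psi x * spartial a phi x) : R) =
    \int[mu]_x (dPhi B i a (F0 x) * spartial a (fun x => phi x * psi x) x : R).
  refine (etrans (esym (RintD (id1 a) (id2 a))) _).
  apply: eq_Rintegral => x _; rewrite spartialM; last 2 first.
  - by move=> x'; exact: test_derivable.
  - by move=> x'; exact: test_derivable.
  by rewrite mulrDr.
refine (etrans (f_equal2 +%R (eq_bigr _ (fun i' _ => S1 i')) S2) _).
refine (etrans (f_equal (fun s => s + _) (pick _)) _).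
refine (etrans (esym (big_split _ _ _ _ _)) (etrans (eq_bigr _ (fun a _ => T a)) P)).
Qed.

Variable z : space3 R -> state R.
Hypothesis z_min : minimizer p q rho l h e r z0 z.

Let Cz : C z. Proof. by case: z_min. Qed.

Let Czt t : C (fun x => z x + t *: variation x).
Proof.
exact: (constraint_shift p4 q2 rho1 l1 z0_space t Cz variation_in_space (fun psi tpsi j => variation_cint j tpsi)).
Qed.

(** The variation leaves the entropy fixed, hence commutes with the clipping. *)
Lemma rel_variation t x : relative (fun x => z x + t *: variation x) x = relative z x + t *: variation x.
Proof.
apply: scrd_inj => k; rewrite scrdD !scrd_rel.
case: k => [i'|[B|]]; rewrite scrdD scrdZ//; first by rewrite addrAC.
by rewrite of_scrdK mulr0 !addr0.
Qed.

Lemma cost_min t : cost z <= cost (fun x => z x + t *: variation x).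
Proof.
have := z_min.2 _ (Czt t).
by rewrite !(functionalE p4 q2 rho1 l1 h0 e_C3 e_growth z0_space heat_l heated_ge0)// lee_fin.
Qed.

Definition line_derivative (x : space3 R) : R :=
  phi x * vel (relative z x) 0 i +
  h * \sum_B stress_form B x * epartial (Some B) e (ext (relative z x), ent (relative z x)).

(** The entropy is constant along the line, which therefore stays in the half-space for all t: the
    derivative is two-sided even where the entropy is 0. *)
Lemma is_derive_dens x :
  is_derive (0 : R) 1 (fun t : R => dens e (relative z x + t *: variation x)) (line_derivative x).
Proof.
have hC := C_k_hC1 (s := [::]) e_C3 isT.
have hc j : hcont (epartial j e) := C_k_hcont (s := [:: j]) e_C3 isT.
pose u := (ext (relative z x), ent (relative z x)); pose d := (ext (variation x), ent (variation x)).
have H1 : is_derive (0 : R) 1 (fun t : R => e (u + t *: d)) (\sum_j ecoord j d * epartial j e (u + 0 *: d)).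
  apply: (@is_derive_line R e u d (- 1) 1 0 hC hc); first by rewrite ltrN10 ltr01.
  move=> t _; rewrite half_spaceE ecoordD ecoordZ.
  rewrite variation_entE mulr0 addr0; exact: ent_rel_ge0.
have E : (fun t : R => dens e (relative z x + t *: variation x)) =
    (fun t => (2^-1 * (\sum_i' vel (relative z x) 0 i' ^+ 2) + (phi x * vel (relative z x) 0 i) * t
      + (2^-1 * phi x ^+ 2) * (t * t)) + e (u + t *: d)).
  apply/funext => t; rewrite /dens; congr (_ + _).
  have V i' : vel (relative z x + t *: variation x) 0 i' = vel (relative z x) 0 i' + t * ((i' == i)%:R * phi x).
    by have := scrdD (inl i') (relative z x) (t *: variation x); rewrite scrdZ of_scrdK.
  rewrite (bigD1 i)//= V eqxx [in RHS](bigD1 i)//=.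
  rewrite (eq_bigr (fun i' => vel (relative z x) 0 i' ^+ 2)).
    by field.
  by move=> i' /negbTE ni; rewrite V ni mul0r mulr0 addr0.
rewrite E /line_derivative; apply: is_derive_eq.
rewrite scale0r addr0 sum_energy_idx variation_entE mul0r addr0.
congr (_ + _); first by rewrite /GRing.scale/=; ring.
rewrite mulr_sumr; apply: eq_bigr => B _.
by rewrite variation_extE mulrA.
Qed.

Lemma line_midpoint x a b : dens e (relative z x + (2^-1 * a + (1 - 2^-1) * b) *: variation x) <=
  (dens e (relative z x + a *: variation x) + dens e (relative z x + b *: variation x)) / 2.
Proof.
have side t k : side k (scrd k (relative z x + t *: variation x)).
  by rewrite -rel_variation; exact: rel_side.
have := convex_gap_ge0 (cdens_gap e_C3 e_convex) (side a) (side b).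
rewrite convex_gap_dens subr_ge0; congr (dens e _ <= _).
by apply: scrd_inj => k; rewrite !(scrdD, scrdZ); field.
Qed.

(** The integrability of the derivative is an output of the domination by integrable quotients; its
    integral is a limit of quotients of the cost, nonnegative by minimality. *)
Lemma line_derivative_int : integ mu (line_derivative : X -> R) /\
  0 <= \int[mu]_x (line_derivative x : R).
Proof.
pose g t (x : X) := dens e (relative z x + t *: variation x).
have gE t : g t = (fun x : X => dens e (relative (fun x => z x + t *: variation x) x)).
  by apply/funext => x; rewrite rel_variation.
have ig t : integ mu (g t).
  rewrite gE; apply: (integ_dens_rel p4 q2 rho1 l1 e_C3 e_growth z0_space).
  exact: (constraint_in_space p4 q2 rho1 l1 (Czt t)).
have g0 : g 0 = (fun x : X => dens e (relative z x)).
  by apply/funext => x; rewrite /g scale0r addr0.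
pose D n (x : X) := 2 ^+ n * (g (2^-1 ^+ n) x - g 0 x).
have iD n : integ mu (D n) by apply: integZ; exact: integB.
have cD x : D n x @[n --> \oo] --> line_derivative x.
  exact: (cvg_dyadic_quotient (is_derive_dens x)).
have mL : measurable_fun setT (line_derivative : X -> R).
  apply: (measurable_fun_cvg (h := D)) => [n|x _]; first exact: integ_mfun (iD n).
  exact: cD.
have [iL cv] : integ mu (line_derivative : X -> R) /\
    (\int[mu]_x (D n x : R)) @[n --> \oo] --> \int[mu]_x (line_derivative x : R).
  apply: (@integ_cvg_dominated _ _ _ _ D _ (fun x => `|g 1 x - g 0 x| + `|g 0 x - g (-1) x|)) => //.
  - by move=> n; exact: integ_mfun (iD n).
  - by apply: integD; apply/integ_norm/integB.
  - by apply: aeW => x; exact: cD.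
  - apply: aeW => x n.
    have b : g 0 x - g (-1) x <= D n x <= g 1 x - g 0 x.
      exact: midpoint_convex_quotient (line_midpoint x) n.
    have bound (lo d hi : R) : lo <= d <= hi -> `|d| <= `|hi| + `|lo|.
      move=> /andP[ld dh]; have := ler_norm hi; have := ler_norm (- lo).
      have := normr_ge0 hi; have := normr_ge0 lo; rewrite normrN ler_norml; lra.
    exact: bound b.
split => //; apply: (cvgr_to_ge cv); apply: nearW => n.
rewrite RintZ; last exact: integB.
rewrite RintB// mulr_ge0 ?exprn_ge0// subr_ge0 g0 gE.
exact: cost_min.
Qed.

End variation.

Variable z : space3 R -> state R.
Hypothesis z_min : minimizer p q rho l h e r z0 z.

Lemma stress_formN phi i B x : test_function phi ->
  stress_form (fun x => - phi x) i B x = - stress_form phi i B x.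
Proof.
move=> tphi; have E a : spartial a (fun x => - phi x) = (fun x => - spartial a phi x).
  have := spartialZ (a := a) (-1) (fun x' => test_derivable tphi).
  under eq_fun do rewrite mulN1r; move=> ->.
  by apply/funext => x'; rewrite mulN1r.
rewrite /stress_form -sumrN; apply: eq_bigr => a _.
by rewrite E mulrN.
Qed.

(** The derivative along the variation changes sign with phi, so its integral, nonnegative for phi
    and for - phi, is zero; dividing by h leaves the equation. *)
Lemma minimizer_euler_lagrange : euler_lagrange h e z0 z.
Proof.
move=> phi tphi i.
have tN : test_function (fun x => - phi x).
  have := test_functionM (trig_test (trig_cst (-1 : R))) tphi.
  by congr test_function; apply/funext => x; rewrite mulN1r.
pose L := line_derivative phi i z.
have [iL L1] := line_derivative_int i tphi z_min; rewrite -/L in iL L1.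
have [_ L2] := line_derivative_int i tN z_min.
have LN : (line_derivative (fun x => - phi x) i z : X -> R) = (fun x => - L x).
  apply/funext => x; rewrite /L /line_derivative opprD mulNr; congr (_ + _).
  rewrite -mulrN -sumrN; congr (_ * _); apply: eq_bigr => B _.
  by rewrite stress_formN// mulNr.
rewrite LN RintN// in L2.
have L0 : \int[mu]_x (L x : R) = 0 by apply/eqP; rewrite eq_le L1 andbT -oppr_ge0.
have lz := constraint_in_space p4 q2 rho1 l1 z_min.1.
have iv : integ mu (fun x : X => vel (z x) 0 i - vel (z0 x) 0 i).
  apply: integB; [exact: (in_space_integ p4 q2 rho1 l1 (inl i) lz)|].
  exact: (in_space_integ p4 q2 rho1 l1 (inl i) z0_space).
pose V (x : X) := phi x * (h^-1 * (vel (z x) 0 i - vel (z0 x) 0 i)).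
have iV : integ mu V by apply: (integ_testMl tphi); exact: integZ.
pose W (x : X) := \sum_B stress_form phi i B x * epartial (Some B) e (ext (relative z x), ent (relative z x)).
have LE x : L x = h * (V x + W x).
  have -> : L x = phi x * (vel (z x) 0 i - vel (z0 x) 0 i) + h * W x.
    by rewrite /L /line_derivative /vel/= !mxE.
  rewrite [RHS]mulrDr /V; congr (_ + _).
  by rewrite mulrCA; congr (_ * _); rewrite mulrA divff ?gt_eqF// mul1r.
(* The integrability of the stress term is read off this identity, from that of the derivative and
   of the velocity term. *)
have WE : W = (fun x => h^-1 * L x - V x).
  by apply/funext => x; rewrite LE mulrA mulVf ?gt_eqF// mul1r addrC addKr.
have iW : integ mu W by rewrite WE; apply: integB => //; exact: integZ.
have IVW : \int[mu]_x (V x : R) = - \int[mu]_x (W x : R).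
  have : \int[mu]_x (W x : R) = - \int[mu]_x (V x : R).
    rewrite [X in Rintegral _ _ X = _]WE RintB//; last exact: integZ.
    by rewrite RintZ// L0 mulr0 sub0r.
  by move=> ->; rewrite opprK.
pose S : set X := [set x : X | 0 <= ent (z x)].
have mS : measurable S by exact: measurable_ent_ge0 lz.
pose W' (x : X) := \sum_(B : ext_idx) \sum_a
  epartial (Some B) e (ext (z x), ent (z x)) * dPhi B i a (F0 x) * spartial a phi x.
(* [epartial] is 0 off the half-space whereas [relative] clips the entropy: the two integrands agree
   where the entropy is nonnegative, that is almost everywhere, and the indicator accounts for the
   rest. *)
have W'E x : W' x = W x * \1_S x.
  rewrite /W mulr_suml; apply: eq_bigr => B _.
  transitivity (stress_form phi i B x * epartial (Some B) e (ext (z x), ent (z x))).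
    by rewrite /stress_form mulr_suml; apply: eq_bigr => a _; rewrite -mulrA mulrC.
  rewrite -mulrA; congr (_ * _); rewrite indicE.
  case: (boolP (x \in S)) => [/set_mem Sx|nS].
    by rewrite mulr1 /relative /ext /ent/= (max_r Sx).
  rewrite mulr0 /epartial /patch ifF//; apply/negP => /set_mem H.
  by move/negP: nS; apply; apply/mem_set.
have IW : \int[mu]_x (W' x : R) = \int[mu]_x (W x : R).
  apply: Rint_ae.
  - rewrite (_ : W' = (fun x => W x * \1_S x)); last exact/funext.
    by apply: measurable_funM; [exact: integ_mfun iW|exact: measurable_indic].
  - exact: integ_mfun iW.
  - have := constraint_ent_ge0 p4 q2 rho1 l1 h0 z0_space heat_l heated_ge0 z_min.1.
    by apply: ae_imp => x Sx; rewrite W'E indicE mem_set// mulr1.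
exact: (etrans IVW (f_equal -%R (esym IW))).
Qed.

End euler_lagrange.

(** * Gradients *)

Section gradient_preservation.
Variable R : realType.
Local Notation X := (mspace3 R).
Local Notation mu := (@torus_measure R).
Variables (p q rho l h : R) (e : ext_var R * R -> R) (r : space3 R -> R).
Variables d z : space3 R -> state R.
Hypothesis p4 : 4 <= p.
Hypothesis q2 : 2 <= q.
Hypothesis rho1 : 1 < rho.
Hypothesis l1 : 1 < l.
Hypothesis h0 : 0 < h.
Hypothesis d_space : in_space p q rho l d.
Hypothesis Cz : constraint_set p q rho l h e r d z.
Local Notation Fd := (fun x => Fpart (ext (d x))).
Local Notation Fz := (fun x => Fpart (ext (z x))).

Let z_space : in_space p q rho l z.
Proof. exact: (constraint_in_space p4 q2 rho1 l1 Cz). Qed.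

Let iFd j b : integ mu (fun x : X => Fd x j b).
Proof. exact: (in_space_integ p4 q2 rho1 l1 (inr (Some (inl (inl (j, b))))) d_space). Qed.

Let iFz j b : integ mu (fun x : X => Fz x j b).
Proof. exact: (in_space_integ p4 q2 rho1 l1 (inr (Some (inl (inl (j, b))))) z_space). Qed.

Let iv j : integ mu (fun x : X => vel (z x) 0 j).
Proof. exact: (in_space_integ p4 q2 rho1 l1 (inl j) z_space). Qed.

Lemma F_update phi (j b : 'I_3) : test_function phi ->
  \int[mu]_x (Fz x j b * phi x : R) =
  \int[mu]_x (Fd x j b * phi x : R) - h * \int[mu]_x (vel (z x) 0 j * spartial b phi x : R).
Proof.
move=> tphi; have [_ /(_ phi tphi (inl (inl (j, b)))) H _] := Cz.
have iz : integ mu (fun x : X => Fz x j b * phi x) by exact: integ_testM.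
have id : integ mu (fun x : X => Fd x j b * phi x) by exact: integ_testM.
have E1 : torus_int (fun x => phi x * (h^-1 * (ext_coord (inl (inl (j, b))) (ext (z x)) -
    ext_coord (inl (inl (j, b))) (ext (d x))))) =
    h^-1 * (\int[mu]_x (Fz x j b * phi x : R) - \int[mu]_x (Fd x j b * phi x : R)).
  rewrite -RintB// -RintZ; last exact: integB.
  by apply: eq_Rintegral => x _; rewrite /Fpart /=; ring.
have E2 : torus_int (fun x => \sum_i \sum_a dPhi (inl (inl (j, b))) i a (Fpart (ext (d x))) *
    vel (z x) 0 i * spartial a phi x) = \int[mu]_x (vel (z x) 0 j * spartial b phi x : R).
  apply: eq_Rintegral => x _; rewrite (bigD1 j)//= (bigD1 b)//= !dPhi_F !eqxx mul1r.
  rewrite big1 ?addr0 => [|a /negbTE nab]; last by rewrite dPhi_F eq_sym nab andbF !mul0r.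
  rewrite big1 ?addr0// => i /negbTE nij; apply: big1 => a _.
  by rewrite dPhi_F eq_sym nij !mul0r.
rewrite E1 E2 in H.
move: H; set A := \int[mu]_x _; set B := \int[mu]_x _; set V := \int[mu]_x _ => H.
have : h * (h^-1 * (A - B)) = h * - V by rewrite H.
by rewrite mulrA divff ?gt_eqF// mul1r mulrN => /eqP; rewrite subr_eq => /eqP ->; rewrite addrC.
Qed.

(** Testing the update with first derivatives of phi, the velocity enters only through mixed second
    derivatives of phi, which commute almost everywhere, so the curl is unchanged. *)
Lemma curl_free_update : curl_free Fd -> curl_free Fz.
Proof.
move=> cd i a b phi tphi.
have Vm c c' : measurable_fun setT (fun x : X => vel (z x) 0 i * spartial c (spartial c' phi) x).
  apply: measurable_funM; first exact: integ_mfun (iv i).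
  by apply: test_measurable; apply/test_spartial/test_spartial.
have VC : \int[mu]_x (vel (z x) 0 i * spartial b (spartial a phi) x : R) =
    \int[mu]_x (vel (z x) 0 i * spartial a (spartial b phi) x : R).
  by apply: Rint_ae => //; apply: ae_imp (test_spartialC b a tphi) => x ->.
refine (etrans (F_update i b (test_spartial a tphi)) (etrans _ (esym (F_update i a (test_spartial b tphi))))).
exact: (f_equal2 (fun s t => s - h * t) (cd i a b phi tphi) VC).
Qed.

Lemma weak_gradient_update y : sobolev1 p y -> weak_gradient y Fd ->
  exists y', sobolev1 p y' /\ weak_gradient y' Fz.
Proof.
move=> sy yF; have p1 : 1 < p by move: p4; lra.
have iy i : integ mu (fun x : X => y x 0 i).
  have [ly _] := sy i.
  exact: (Lq_integ (torus_lty R) (ltW p1) ((LfunE mu _ (ltW p1)).1 ly)).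
pose y' (x : space3 R) : 'rV[R]_3 := y x + h *: vel (z x).
have y'E i x : y' x 0 i = y x 0 i + h * vel (z x) 0 i by rewrite !mxE.
have iy' i : integ mu (fun x : X => y' x 0 i).
  by under eq_fun do rewrite y'E; apply: integD => //; exact: integZ.
have wy' i a : weak_partial a (fun x => y' x 0 i) (fun x => Fz x i a).
  move=> phi tphi; have tdphi := test_spartial a tphi.
  have i1 : integ mu (fun x : X => y x 0 i * spartial a phi x) by exact: integ_testM.
  have i2 : integ mu (fun x : X => vel (z x) 0 i * spartial a phi x) by exact: integ_testM.
  have E : torus_int (fun x => y' x 0 i * spartial a phi x) =
      \int[mu]_x (y x 0 i * spartial a phi x : R) + h * \int[mu]_x (vel (z x) 0 i * spartial a phi x : R).
    rewrite -(RintZ h i2) -(RintD i1 (integZ h i2)).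
    by apply: eq_Rintegral => x _; rewrite y'E mulrDl mulrA.
  refine (etrans E (etrans (f_equal (fun s => s + _) (yF i a phi tphi)) (etrans _ (f_equal -%R (esym (F_update i a tphi)))))).
  by rewrite opprB addrC.
have lF i a : Lq mu p (fun x : X => Fz x i a) := z_space (inr (Some (inl (inl (i, a))))).
exists y'; split => // i; split.
  (* The velocity is in L^2, so y' is at this point only known to be integrable; its weak gradient
     being in L^p raises it to L^p. *)
  apply: (LfunE mu _ (ltW p1)).2.
  exact: (weak_partial_Lq p1 (iy' i) (lF i) (wy' i)).
move=> a; exists (fun x => Fz x i a); split => //.
exact: (LfunE mu _ (ltW p1)).2 (lF i a).
Qed.

End gradient_preservation.

Theorem theorem1 (R : realType) (p q rho l h : R)
    (e : ext_var R * R -> R) (r : space3 R -> R)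
    (hp : 4 <= p) (hq : 2 <= q) (hrho : 1 < rho) (hl : 1 < l) (hh : 0 < h)
    (he : C_k 3 e) (hgrowth : energy_growth p q rho l e)
    (hconv : strictly_convex e)
    (y0 v0 : space3 R -> 'rV[R]_3) (F0 : space3 R -> 'M[R]_3)
    (eta0 : space3 R -> R)
    (hy0 : sobolev1 p y0) (hF0 : weak_gradient y0 F0) :
  let z0 := fun x => (v0 x, Phi (F0 x), eta0 x) : state R in
  state_space p q rho l z0 ->
  compatible_heating l h e r z0 ->
  [/\ [/\ affine_subspace p q rho l (constraint_set p q rho l h e r z0),
          weakly_closed p q rho l (constraint_set p q rho l h e r z0)
        & exists z, minimizer p q rho l h e r z0 z /\
            forall z', minimizer p q rho l h e r z0 z' -> ae_equal z z'],
      stress_growth p q rho l e ->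
        forall z, minimizer p q rho l h e r z0 z -> euler_lagrange h e z0 z
    & [/\ forall d z, state_space p q rho l d -> compatible_heating l h e r d ->
            minimizer p q rho l h e r d z ->
            curl_free (fun x => Fpart (ext (d x))) ->
            curl_free (fun x => Fpart (ext (z x))),
          forall d z, state_space p q rho l d -> compatible_heating l h e r d ->
            minimizer p q rho l h e r d z ->
            (exists y, sobolev1 p y /\
               weak_gradient y (fun x => Fpart (ext (d x)))) ->
            exists y, sobolev1 p y /\
              weak_gradient y (fun x => Fpart (ext (z x)))
        & forall z, minimizer p q rho l h e r z0 z ->
            exists y, sobolev1 p y /\
              weak_gradient y (fun x => Fpart (ext (z x)))]].
Proof.
move=> z0 /(in_spaceP hp hq hrho hl) sz0 [_ /(LfunE _ _ (ltW hl)) lheat heated].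
have update d z : in_space p q rho l d -> minimizer p q rho l h e r d z ->
    (exists y, sobolev1 p y /\ weak_gradient y (fun x => Fpart (ext (d x)))) ->
    exists y, sobolev1 p y /\ weak_gradient y (fun x => Fpart (ext (z x))).
  by move=> sd [cz _] [y [sy yF]]; exact: (weak_gradient_update hp hq hrho hl hh sd cz sy yF).
split.
- split.
  + exact: constraint_affine.
  + exact: constraint_weakly_closed.
  + have [z mz] := minimizer_exists hp hq hrho hl hh he hgrowth hconv sz0 lheat heated.
    exists z; split => // z' mz'.
    exact: (minimizer_unique hp hq hrho hl hh he hgrowth hconv sz0 lheat heated mz mz').
- move=> hstress z mz.
  have iy i : integ (torus_measure R) (fun x : mspace3 R => y0 x 0 i).
    have p1 : 1 <= p by move: hp; lra.
    have [ly _] := hy0 i.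
    exact: (Lq_integ (torus_lty R) p1 ((LfunE _ _ p1).1 ly)).
  exact: (minimizer_euler_lagrange hp hq hrho hl hh he hgrowth hstress hconv sz0 lheat heated iy hF0 mz).
- split.
  + move=> d z /(in_spaceP hp hq hrho hl) sd _ [cz _].
    exact: (curl_free_update hp hq hrho hl hh sd cz).
  + by move=> d z /(in_spaceP hp hq hrho hl) sd _; exact: update.
  + by move=> z mz; apply: (update _ _ sz0 mz); exists y0.
Qed.
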